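(* Let $P\curvearrowright_{\theta}X$ and $S\curvearrowright_{\rho}Y$ be two topologically free injective right actions, where $P\subseteq G$ and $S\subseteq H$ are right Ore sub-semigroups of countable discrete groups $G$, $H$, $X$ and $Y$ are second-countable compact Hausdorff spaces, and $\theta_a(X)$ is open in $X$ for all $a\in P$ and $\rho_s(Y)$ is open in $Y$ for all $s\in S$. Then the following are equivalent: (i) $P\curvearrowright_{\theta}X$ and $S\curvearrowright_{\rho}Y$ are continuously orbit equivalent; (ii) $X\rtimes P$ and $Y\rtimes S$ are isomorphic as étale groupoids; (iii) there is a $C^*$-isomorphism $\Phi: C^*_r(X\rtimes P)\to C^*_r(Y\rtimes S)$ such that $\Phi(C(X))=C(Y)$; (iv) there is a $C^*$-isomorphism $\Psi: C(X)\rtimes^{\widehat{\alpha}}_{r}G\to C(Y)\rtimes^{\widehat{\beta}}_{r}H$ such that $\Psi(C(X))=C(Y)$, where $\widehat{\alpha}$ is the partial action of $G$ on $C(X)$ and $\widehat{\beta}$ the partial action of $H$ on $C(Y)$ induced by $\theta$ and $\rho$ respectively. Moreover, (ii) $\Rightarrow$ (i) holds without the assumption of topological freeness.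
   Context: Let $G$ be a countable discrete group with identity $e$. A right Ore sub-semigroup $P$ of $G$ is a sub-semigroup with $e\in P$ and $G=PP^{-1}$. An injective right action $P\curvearrowright_\theta X$ on a second-countable compact Hausdorff space $X$ is a family of continuous injective maps $\theta_a:X\to X$ ($a\in P$) with $\theta_a\theta_b=\theta_{ba}$ for all $a,b\in P$ and $\theta_e=\mathrm{id}_X$. For $x\in X$ put $Q_x=\{g\in G:\exists\, a,b\in P,\ y\in X \text{ with } g=ab^{-1},\ \theta_a(x)=\theta_b(y)\}$. For $g\in Q_x$ there is a unique element $u(x,g)\in X$ such that $\theta_a(x)=\theta_b(u(x,g))$ whenever $g=ab^{-1}$ with $a,b\in P$. The transformation groupoid is $X\rtimes P=\{(x,g)\in X\times G: g\in Q_x\}$ with product $(x,g)(y,h)=(x,gh)$ defined only if $y=u(x,g)$, inverse $(x,g)^{-1}=(u(x,g),g^{-1})$, and the relative topology from the product $X\times G$ ($G$ discrete). Its unit space $X\times\{e\}$ is identified with $X$; then $r(x,g)=x$, $s(x,g)=u(x,g)$. When all $\theta_a(X)$ are open it is an étale (locally compact Hausdorff) groupoid. Isomorphic as étale groupoids means there is a groupoid isomorphism that is a homeomorphism. The action is topologically free if $\{x\in X: x\ne u(x,g)\text{ for all } g\in Q_x \text{ with } g\neq e\}$ is dense in $X$. Continuous orbit equivalence: there exist a homeomorphism $\varphi:X\to Y$ and continuous maps $a:X\rtimes P\to H$, $b:Y\rtimes S\to G$ such that $\varphi(u(x,g))=u(\varphi(x),a(x,g))$ for $(x,g)\in X\rtimes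 P$ and $\varphi^{-1}(u(y,h))=u(\varphi^{-1}(y),b(y,h))$ for $(y,h)\in Y\rtimes S$ (in particular $a(x,g)\in Q_{\varphi(x)}$ and $b(y,h)\in Q_{\varphi^{-1}(y)}$). $C^*_r(X\rtimes P)$ is the reduced groupoid $C^*$-algebra, and $C(X)$ is viewed in it as the functions supported on the (clopen) unit space. Partial crossed product: for $g\in G$ let $X_g=\{x\in X: g\in Q_x\}$, a clopen subset of $X$; regard $C(X_g)$ as the ideal of functions in $C(X)$ vanishing off $X_g$. Define $\hat\alpha_g:C(X_{g^{-1}})\to C(X_g)$ by $\hat\alpha_g(f)(x)=f(u(x,g))$ for $x\in X_g$. This is a partial action of $G$ on $C(X)$. Let $l^2(G,C(X))$ be the right Hilbert $C(X)$-module of maps $\xi:G\to C(X)$ with $\sum_g|\xi(g)|^2$ convergent in $C(X)$, with $(\xi f)(g)=\xi(g)f$ and $\langle\xi,\eta\rangle=\sum_g\xi(g)^*\eta(g)$; let $F=\{\xi\in l^2(G,C(X)):\xi(g)\in C(X_g)\ \forall g\}$, and $\mathcal L(F)$ its adjointable operators. For $f\in C(X)$, $h\in G$ define $\tau(f),v_h\in\mathcal L(F)$ by $(\tau(f)\xi)(g)(x)=f(u(x,g))\,\xi(g)(x)$ for $x\in X_g$ (and $0$ for $x\notin X_g$), and $(v_h\xi)(g)(x)=\xi(gh)(x)$ for $x\in X_g\cap X_{gh}$ (and $0$ otherwise). Then $C(X)\rtimes^{\widehat\alpha}_rG$ is the $C^*$-algebra generated by $\{\tau(f),v_g:f\in C(X),g\in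 G\}$ in $\mathcal L(F)$, and $C(X)$ is viewed in it as $\tau(C(X))$. All notions for $S\curvearrowright_\rho Y$, $S\subseteq H$, are defined in the same way. *)

(* Defs.v *)
From HB Require Import structures.
From mathcomp Require Import all_boot all_order all_algebra finmap complex.
From mathcomp Require Import all_classical all_reals all_analysis ring lra.

Set Implicit Arguments.
Unset Strict Implicit.
Unset Printing Implicit Defensive.

Import Order.TTheory GRing.Theory Num.Theory.
Import numFieldNormedType.Exports.

Local Open Scope classical_set_scope.
Local Open Scope ring_scope.

(* [R[i]] seen as a [numClosedFieldType], which is what gives it the topology
   of its norm. *)
Definition Cplx (R : realType) : numClosedFieldType := R[i].

Definition cmod (R : realType) (z : Cplx R) : R := ComplexField.Normc.normc z.

Lemma cmod2E (R : realType) (z : Cplx R) :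
  cmod z ^+ 2 = complex.Re z ^+ 2 + complex.Im z ^+ 2.
Proof. by case: z => a b; rewrite /cmod /= sqr_sqrtr // addr_ge0 // sqr_ge0. Qed.

Lemma cmod2_lin (R : realType) (c z w : Cplx R) :
  cmod (c * z + w) ^+ 2 <= 2 * (1 + cmod c ^+ 2) * (cmod z ^+ 2 + cmod w ^+ 2).
Proof.
have H : cmod (c * z + w) ^+ 2 <= 2 * (cmod (c * z) ^+ 2 + cmod w ^+ 2).
  rewrite !cmod2E; case: (c * z) => p q; case: w => r s /=.
  have := sqr_ge0 (p - r); have := sqr_ge0 (q - s); nra.
apply: (le_trans H); rewrite -mulrA ler_pM2l //.
have -> : cmod (c * z) = cmod c * cmod z by exact: ComplexField.Normc.normcM.
rewrite exprMn mulrDl mul1r mulrDr.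
have := sqr_ge0 (cmod c); have := sqr_ge0 (cmod z); have := sqr_ge0 (cmod w).
move: (cmod c ^+ 2) (cmod z ^+ 2) (cmod w ^+ 2) => A B D; nra.
Qed.

Lemma cmod_continuous (R : realType) : continuous (@cmod R).
Proof.
move=> z; have F0 : Filter (nbhs z) := nbhs_filter z.
apply/(@cvgrPdist_lt _ _ _ (nbhs z) F0) => e e0.
have L (a b : R) : (a%:C < b%:C)%C = (a < b) by rewrite ltcR.
exists (e%:C)%C => [|w /=]; first by rewrite /= L.
rewrite normc_def L; apply: le_lt_trans.
rewrite (_ : Num.sqrt _ = cmod (z - w)); last by case: (z - w).
have T (a b : Cplx R) : cmod (a + b) <= cmod a + cmod b by exact: le_normcD.
have S (a b : Cplx R) : cmod (a - b) = cmod (b - a).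
  by rewrite -opprB; exact: normcN.
have := T (z - w) w; have := T (w - z) z; rewrite !subrK (S w z) => h1 h2.
by rewrite ler_norml; apply/andP; split; lra.
Qed.

(* Unconditional sums: limits of nets of finite partial sums. *)
Definition totally {I : choiceType} : set_system {fset I} :=
  filter_from [set: {fset I}] (fun A => [set B | (A `<=` B)%fset]).

#[export] Instance totally_proper (I : choiceType) : ProperFilter (@totally I).
Proof.
apply: filter_from_proper; last by move=> A _; exists A => /=.
apply: filter_from_filter; first by exists fset0.
move=> A B _ _; exists (A `|` B)%fset => // D /= H.
by split; apply: fsubset_trans H; rewrite ?fsubsetUl ?fsubsetUr.
Qed.

Definition usum (R : realType) (I : choiceType) (f : I -> Cplx R) : Cplx R :=
  lim ((\sum_(i <- B) f i) @[B --> totally]).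

Lemma esum_ltyP (R : realType) (I : choiceType) (a : I -> R) :
  (forall i, 0 <= a i) ->
  (\esum_(i in [set: I]) (a i)%:E < +oo)%E <->
  exists M, forall B : {fset I}, \sum_(i <- B) a i <= M.
Proof.
move=> a0; split=> [H|[M HM]].
  exists (fine (\esum_(i in [set: I]) (a i)%:E)) => B.
  rewrite -lee_fin fineK; last first.
    by rewrite ge0_fin_numE // esum_ge0 // => i _; rewrite lee_fin.
  apply: ereal_sup_ubound; exists [set` B].
    by split => //; exact: finite_fset.
  by rewrite fsbig_finite ?set_fsetK -?sumEFin //; exact: finite_fset.
apply: (@le_lt_trans _ _ M%:E); last exact: ltry.
apply: ge_ereal_sup => _ [A [finA _] <-].
by rewrite fsbig_finite // sumEFin lee_fin.
Qed.

Lemma unif_net (R : realType) (I : choiceType) (X : choiceType) (a : I -> X -> R) (f : X -> R) :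
  {uniform, (fun B : {fset I} => fun x => \sum_(i <- B) a i x) @ totally --> f} <->
  forall e, 0 < e -> exists A : {fset I}, forall B : {fset I}, (A `<=` B)%fset ->
    forall x, `|f x - \sum_(i <- B) a i x| < e.
Proof.
split=> [H e e0|H P].
  have : nbhs (f : {uniform X -> R}) [set h | forall x, `|f x - h x| < e].
    apply/uniform_nbhs; exists [set xy | ball xy.1 e xy.2]; split.
      by rewrite -entourage_ballE; exists e.
    by move=> h /= K x; exact: K.
  by move=> /H [A _ K]; exists A => B /K.
move=> /uniform_nbhs [E [entE EP]].
move: entE; rewrite -entourage_ballE => -[e /= e0 eE].
have [A K] := H e e0; exists A => // B /= AB; apply: EP => x _; apply: eE.
exact: K.
Qed.

Lemma unif_dominated (R : realType) (I : choiceType) (X : topologicalType)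
    (a b d : I -> X -> R) (M : R) (fa fb : X -> R) :
  0 < M -> (forall i x, 0 <= d i x) -> (forall i x, 0 <= a i x) ->
  (forall i x, 0 <= b i x) ->
  (forall i x, d i x <= M * (a i x + b i x)) ->
  (forall i, continuous (d i)) ->
  {uniform, (fun B : {fset I} => fun x => \sum_(i <- B) a i x) @ totally --> fa} ->
  {uniform, (fun B : {fset I} => fun x => \sum_(i <- B) b i x) @ totally --> fb} ->
  exists2 f : X -> R, continuous f &
  {uniform, (fun B : {fset I} => fun x => \sum_(i <- B) d i x) @ totally --> f}.
Proof.
move=> M0 d0 a0 b0 dab dc /unif_net Ha /unif_net Hb.
pose s (h : I -> X -> R) (B : {fset I}) x := \sum_(i <- B) h i x.
have sD h (A B : {fset I}) x : (A `<=` B)%fset -> s h B x = s h A x + s h (B `\` A)%fset x.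
  move=> AB; rewrite /s (big_fsetID _ (mem A)) /=; congr (_ + _).
    by apply: eq_fbigl => i; rewrite !inE /= andbC; case: (boolP (i \in A)) => //= /(fsubsetP AB).
  by apply: eq_fbigl => i; rewrite !inE /= andbC.
have sdab B x : s d B x <= M * (s a B x + s b B x).
  by rewrite /s -big_split mulr_sumr; apply: ler_sum => i _.
have tail e : 0 < e -> exists A : {fset I}, forall B D : {fset I}, (A `<=` B)%fset -> 
    forall x, s d (B `|` D)%fset x <= s d B x + e.
  move=> e0; have e1 : 0 < e / (4 * M) by rewrite divr_gt0 // mulr_gt0.
  have [A1 HA1] := Ha _ e1; have [A2 HA2] := Hb _ e1.
  exists (A1 `|` A2)%fset => B D; rewrite fsubUset => /andP[A1B A2B] x.
  have A1BD := fsubset_trans A1B (fsubsetUl B D).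
  have A2BD := fsubset_trans A2B (fsubsetUl B D).
  rewrite (sD d B) ?fsubsetUl // lerD2l; apply: (le_trans (sdab _ _)).
  move: (HA1 _ A1B x) (HA1 _ A1BD x) (HA2 _ A2B x) (HA2 _ A2BD x).
  rewrite -!/(s _ _ _) !(sD _ B (B `|` D)%fset) ?fsubsetUl //.
  set u := s a _ _; set v := s a (_ `\` _)%fset _; set w := s b _ _.
  set z := s b (_ `\` _)%fset _.
  rewrite !ltr_norml => /andP[h1 h2] /andP[h3 h4] /andP[h5 h6] /andP[h7 h8].
  have : v + z <= 4 * (e / (4 * M)) by lra.
  move=> /(ler_wpM2l (ltW M0)) /le_trans; apply.
  by rewrite (_ : M * _ = e) //; field; rewrite gt_eqF.
pose f x := sup (range (fun B => s d B x)).
have hs x : has_sup (range (fun B => s d B x)).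
  split; first by exists (s d fset0 x), fset0.
  have [A HA] := tail 1 ltr01; exists (s d A x + 1) => _ [B _ <-].
  apply: le_trans (HA A B (fsubset_refl _) x).
  rewrite [leRHS](sD _ B) ?fsubsetUr // lerDl; exact: sumr_ge0.
have Hf : {uniform, (fun B : {fset I} => fun x => \sum_(i <- B) d i x) @ totally --> f}.
  apply/unif_net => e e0; have [A HA] := tail (e / 2) (divr_gt0 e0 (ltr0n _ 2)).
  exists A => B AB x; rewrite -/(s d B x).
  have h1 : s d B x <= f x by apply: (sup_upper_bound (hs x)); exists B.
  have h2 : f x <= s d B x + e / 2.
    apply: ge_sup; first by exists (s d fset0 x), fset0.
    move=> _ [D _ <-]; apply: le_trans (HA B D AB x).
    by rewrite [leRHS](sD _ D) ?fsubsetUr // lerDl; exact: sumr_ge0.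
  by rewrite ger0_norm ?subr_ge0 //; lra.
exists f => //; apply: uniform_limit_continuous Hf; exists fset0 => // B _ /=.
elim: (B : seq I) => [|i r IH] x.
  by rewrite (_ : (fun _ => _) = cst 0); [exact: cst_continuous|apply/funext => y; rewrite big_nil].
rewrite (_ : (fun _ => _) = (d i \+ (fun y => \sum_(j <- r) d j y))); last first.
  by apply/funext => y; rewrite big_cons.
by apply: continuousD; [exact: dc|exact: IH].
Qed.

(* Only the values [act a] with [a \in osg] are meaningful. *)
Record ore_action (G : groupType) (X : topologicalType) := OreAction {
  osg : set G;
  act :> G -> X -> X;
  osg1 : osg 1%g;
  osgM : forall a b, osg a -> osg b -> osg (a * b)%g;
  osg_ore : forall g, exists a b, [/\ osg a, osg b & g = (a * b^-1)%g];
  act_continuous : forall a, osg a -> continuous (act a);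
  act_inj : forall a, osg a -> injective (act a);
  act_comp : forall a b, osg a -> osg b -> act a \o act b = act (b * a)%g;
  act1 : act 1%g = id
}.

Section OreAction.
Context (G : groupType) (X : topologicalType) (theta : ore_action G X).

Definition open_images := forall a, osg theta a -> open (range (theta a)).

Definition Qset (x : X) : set G :=
  [set g | exists a b y, [/\ osg theta a, osg theta b, g = (a * b^-1)%g &
                             theta a x = theta b y]].

Definition udef (x : X) (g : G) : set X :=
  [set y | forall a b, osg theta a -> osg theta b -> g = (a * b^-1)%g ->
           theta a x = theta b y].

(* u(x, g) when [Qset x g], see [uact_def] and [uact_uniq]; otherwise [x]. *)
Definition uact (x : X) (g : G) : X := xget x (udef x g).

Lemma udef_uniq x g y z : udef x g y -> udef x g z -> y = z.
Proof.
move=> Hy Hz; have [a [b [Pa Pb gE]]] := osg_ore theta g.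
by apply: (act_inj Pb); rewrite -(Hy a b) // -(Hz a b).
Qed.

Lemma udef_intro x a b y : osg theta a -> osg theta b ->
  theta a x = theta b y -> udef x (a * b^-1)%g y.
Proof.
move=> Pa Pb E c d Pc Pd gE.
have [p [q [Pp Pq bdE]]] := osg_ore theta (b^-1 * d)%g.
have bp_dq : (b * p = d * q)%g.
  move: bdE => /(congr1 (fun z => b * z * q)%g); rewrite !mulgA mulgV mul1g.
  by rewrite -!mulgA mulVg mulg1 => ->.
have ap_cq : (a * p = c * q)%g.
  have -> : (p = b^-1 * d * q)%g by rewrite bdE -mulgA mulVg mulg1.
  by rewrite !mulgA gE -[(c * d^-1 * d)%g]mulgA mulVg mulg1.
apply: (act_inj Pq).
have H r s v : osg theta r -> osg theta s ->
    theta s (theta r v) = theta (r * s)%g v.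
  by move=> Pr Ps; rewrite -(act_comp Ps Pr).
by rewrite H // H // -ap_cq -bp_dq -!H // E.
Qed.

Lemma uact_def x g : Qset x g -> udef x g (uact x g).
Proof.
move=> [a [b [y [Pa Pb -> E]]]]; apply: xgetPex.
by exists y; exact: udef_intro.
Qed.

Lemma uact_uniq x g y : udef x g y -> uact x g = y.
Proof.
by move=> H; apply: (@udef_uniq x g) => //; apply: xgetPex; exists y.
Qed.

Lemma Qset_udef x g y : udef x g y -> Qset x g.
Proof.
move=> H; have [a [b [Pa Pb gE]]] := osg_ore theta g.
by exists a, b, y; split => //; exact: H.
Qed.

Lemma udefM x y z g h : udef x g y -> udef y h z -> udef x (g * h)%g z.
Proof.
move=> Hg Hh; have [a [b [Pa Pb gE]]] := osg_ore theta g.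
have [c [d [Pc Pd hE]]] := osg_ore theta h.
have [p [q [Pp Pq bcE]]] := osg_ore theta (b^-1 * c)%g.
have -> : (g * h = a * p * (d * q)^-1)%g.
  rewrite gE hE invgM !mulgA; congr (_ * _)%g.
  by rewrite -[(a * p * _)%g]mulgA -bcE !mulgA.
have bp_cq : (b * p = c * q)%g.
  move: bcE => /(congr1 (fun z => b * z * q)%g); rewrite !mulgA mulgV mul1g.
  by rewrite -!mulgA mulVg mulg1 => ->.
have H r s v : osg theta r -> osg theta s ->
    theta s (theta r v) = theta (r * s)%g v.
  by move=> Pr Ps; rewrite -(act_comp Ps Pr).
apply: udef_intro; [exact: osgM|exact: osgM|].
by rewrite -!H // (Hg a b) // H // bp_cq -H // (Hh c d).
Qed.

Lemma udefV x y g : udef x g y -> udef y g^-1%g x.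
Proof.
move=> Hg; have [a [b [Pa Pb gE]]] := osg_ore theta g.
have -> : (g^-1 = b * a^-1)%g by rewrite gE invgM invgK.
by apply: udef_intro => //; rewrite (Hg a b).
Qed.

Lemma udef1 x : udef x 1%g x.
Proof.
by rewrite -(mulgV (1 : G)%g); apply: udef_intro => //; exact: osg1.
Qed.

Definition topologically_free :=
  dense [set x | forall g, Qset x g -> g <> 1%g -> x <> uact x g].

End OreAction.

Record groupoid_axioms (T : Type) (rng src inv : T -> T) (mul : T -> T -> T) :
    Prop := GroupoidAxioms {
  gax_rng_rng : forall a, rng (rng a) = rng a;
  gax_src_rng : forall a, src (rng a) = rng a;
  gax_rng_src : forall a, rng (src a) = src a;
  gax_src_src : forall a, src (src a) = src a;
  gax_rngM : forall a b, src a = rng b -> rng (mul a b) = rng a;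
  gax_srcM : forall a b, src a = rng b -> src (mul a b) = src b;
  gax_mulA : forall a b c, src a = rng b -> src b = rng c ->
    mul a (mul b c) = mul (mul a b) c;
  gax_mul1 : forall a, mul a (src a) = a;
  gax_1mul : forall a, mul (rng a) a = a;
  gax_rngV : forall a, rng (inv a) = src a;
  gax_srcV : forall a, src (inv a) = rng a;
  gax_mulV : forall a, mul a (inv a) = rng a;
  gax_Vmul : forall a, mul (inv a) a = src a
}.

(* The product is total, but [gmul a b] is only meaningful when
   [gsrc a = grng b]. Units are arrows, and the topology of the groupoid is
   that of its type of arrows. *)
Record groupoid := Groupoid {
  arrow :> topologicalType;
  grng : arrow -> arrow;
  gsrc : arrow -> arrow;
  ginv : arrow -> arrow;
  gmul : arrow -> arrow -> arrow;
  groupoidP : groupoid_axioms grng gsrc ginv gmul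
}.

Definition groupoid_morphism (K L : groupoid) (F : K -> L) :=
  forall a b : K, gsrc a = grng b ->
    gsrc (F a) = grng (F b) /\ F (gmul a b) = gmul (F a) (F b).

Definition etale_isomorphic (K L : groupoid) :=
  exists (F : K -> L) (F' : L -> K),
    [/\ cancel F F', cancel F' F,
        groupoid_morphism F, groupoid_morphism F' &
        continuous F /\ continuous F'].

Section TransformationGroupoid.
Context (G : groupType) (X : topologicalType) (theta : ore_action G X).

Definition tg_set : set (X * discrete_topology G) :=
  [set z | Qset theta z.1 z.2].

(* A subtype, so it carries the relative topology. *)
Definition tg : topologicalType := tg_set.

Definition tg_pt (a : tg) : X := (\val a).1.
Definition tg_gp (a : tg) : G := (\val a).2.

(* [insubd a z] is [z] when [z] is in [tg_set], which is the case in all of the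
   following uses but [tg_mul a b] for non-composable [a] and [b]. *)
Definition tg_rng (a : tg) : tg := insubd a (tg_pt a, 1%g : G).
Definition tg_src (a : tg) : tg :=
  insubd a (uact theta (tg_pt a) (tg_gp a), 1%g : G).
Definition tg_inv (a : tg) : tg :=
  insubd a (uact theta (tg_pt a) (tg_gp a), (tg_gp a)^-1%g).
Definition tg_mul (a b : tg) : tg :=
  insubd a (tg_pt a, (tg_gp a * tg_gp b)%g).


Lemma tgP (a : tg) : udef theta (tg_pt a) (tg_gp a) (uact theta (tg_pt a) (tg_gp a)).
Proof. by apply: uact_def; exact: (set_mem (valP a)). Qed.
Arguments tgP : clear implicits.

Lemma tg_ext (a b : tg) : tg_pt a = tg_pt b -> tg_gp a = tg_gp b -> a = b.
Proof.
move=> E1 E2; apply: val_inj.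
by rewrite [LHS]surjective_pairing [RHS]surjective_pairing; congr pair.
Qed.

Lemma tg_insub (a : tg) x (g : G) y : udef theta x g y ->
  tg_pt (insubd a (x, g)) = x /\ tg_gp (insubd a (x, g)) = g.
Proof.
move=> H; have K : (x, g : discrete_topology G) \in tg_set.
  by apply/mem_set; exact: Qset_udef H.
by rewrite /tg_pt /tg_gp insubdK.
Qed.

Lemma tg_rngE a : tg_pt (tg_rng a) = tg_pt a /\ tg_gp (tg_rng a) = 1%g.
Proof. exact: tg_insub (udef1 _). Qed.

Lemma tg_srcE a :
  tg_pt (tg_src a) = uact theta (tg_pt a) (tg_gp a) /\ tg_gp (tg_src a) = 1%g.
Proof. exact: tg_insub (udef1 _). Qed.

Lemma tg_invE a : tg_pt (tg_inv a) = uact theta (tg_pt a) (tg_gp a) /\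
  tg_gp (tg_inv a) = (tg_gp a)^-1%g.
Proof. exact: tg_insub (udefV (tgP a)). Qed.

Lemma tg_composable a b : tg_src a = tg_rng b ->
  tg_pt b = uact theta (tg_pt a) (tg_gp a).
Proof.
by move=> E; rewrite -(tg_srcE a).1 E (tg_rngE b).1.
Qed.

Lemma tg_mulP a b : tg_src a = tg_rng b ->
  udef theta (tg_pt a) (tg_gp a * tg_gp b)%g (uact theta (tg_pt b) (tg_gp b)).
Proof.
move=> E; apply: udefM (tgP b).
by rewrite (tg_composable E); exact: tgP.
Qed.

Lemma tg_mulE a b : tg_src a = tg_rng b ->
  tg_pt (tg_mul a b) = tg_pt a /\ tg_gp (tg_mul a b) = (tg_gp a * tg_gp b)%g.
Proof. move=> E; exact: tg_insub (tg_mulP E). Qed.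

Lemma uact1 x : uact theta x 1%g = x.
Proof. exact/uact_uniq/udef1. Qed.

Lemma tg_unit_ext (a b : tg) : tg_gp a = 1%g -> tg_gp b = 1%g ->
  tg_pt a = tg_pt b -> a = b.
Proof. by move=> Ha Hb E; apply: tg_ext; rewrite // Ha Hb. Qed.

Lemma tg_axioms : groupoid_axioms tg_rng tg_src tg_inv tg_mul.
Proof.
have R1 a := (tg_rngE a).1; have R2 a := (tg_rngE a).2.
have S1 a := (tg_srcE a).1; have S2 a := (tg_srcE a).2.
have V1 a := (tg_invE a).1; have V2 a := (tg_invE a).2.
have M1 a b (E : tg_src a = tg_rng b) := (tg_mulE E).1.
have M2 a b (E : tg_src a = tg_rng b) := (tg_mulE E).2.
have uV a : uact theta (uact theta (tg_pt a) (tg_gp a)) (tg_gp a)^-1%g = tg_pt a.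
  exact/uact_uniq/udefV/tgP.
have uM a b : tg_src a = tg_rng b ->
    uact theta (tg_pt a) (tg_gp a * tg_gp b)%g = uact theta (tg_pt b) (tg_gp b).
  by move=> E; apply/uact_uniq/tg_mulP.
have sV a : tg_src a = tg_rng (tg_inv a).
  by apply: tg_unit_ext; rewrite ?R1 ?R2 ?S1 ?S2 ?V1 ?V2.
have Vs a : tg_src (tg_inv a) = tg_rng a.
  by apply: tg_unit_ext; rewrite ?R1 ?R2 ?S1 ?S2 ?V1 ?V2.
have rs a : tg_rng (tg_src a) = tg_src a.
  by apply: tg_unit_ext; rewrite ?R1 ?R2 ?S1 ?S2.
have sr a : tg_src (tg_rng a) = tg_rng a.
  by apply: tg_unit_ext; rewrite ?R1 ?R2 ?S1 ?S2 ?R1 ?R2 ?uact1.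
have rM a b : tg_src a = tg_rng b -> tg_rng (tg_mul a b) = tg_rng a.
  by move=> E; apply: tg_unit_ext; rewrite ?R1 ?R2 ?M1.
have sM a b : tg_src a = tg_rng b -> tg_src (tg_mul a b) = tg_src b.
  by move=> E; apply: tg_unit_ext; rewrite ?S1 ?S2 ?M1 ?M2 // uM.
split => //.
- by move=> a; apply: tg_unit_ext; rewrite ?R1 ?R2.
- by move=> a; apply: tg_unit_ext; rewrite ?S1 ?S2 ?S1 ?S2 ?uact1.
- move=> a b c Eab Ebc.
  have E1 : tg_src a = tg_rng (tg_mul b c) by rewrite rM.
  have E2 : tg_src (tg_mul a b) = tg_rng c by rewrite sM.
  by apply: tg_ext; rewrite ?M1 ?M2 ?M1 ?M2 // mulgA.
- move=> a; have E : tg_src a = tg_rng (tg_src a) by rewrite rs.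
  by apply: tg_ext; rewrite ?M1 ?M2 // S2 mulg1.
- move=> a; have E : tg_src (tg_rng a) = tg_rng a by rewrite sr.
  by apply: tg_ext; rewrite ?M1 ?M2 // ?R1 // R2 mul1g.
- by move=> a; apply: tg_ext; rewrite ?M1 ?M2 ?R1 ?R2 ?V2 ?mulgV.
- by move=> a; apply: tg_ext; rewrite ?M1 ?M2 ?S1 ?S2 ?V1 ?V2 ?mulVg.
Qed.

Definition transformation_groupoid : groupoid := Groupoid tg_axioms.

End TransformationGroupoid.

(* The data of a right Hilbert module over the continuous functions on
   [hm_base]: the inner product is conjugate-linear on the left, and
   [hm_ip xi eta k] is the value of <xi, eta> at [k]. A Hilbert space is the
   case where [hm_base] is a point. *)
Record hilbert_module (R : realType) := HilbertModule {
  hm_sort :> lmodType (Cplx R);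
  hm_base : Type;
  hm_ip : hm_sort -> hm_sort -> hm_base -> Cplx R
}.

Section Operators.
Context (R : realType) (V : hilbert_module R).

Definition hm_norm (xi : V) : R :=
  Num.sqrt (sup (range (fun k => complex.Re (hm_ip xi xi k)))).

Definition adjoint_pair (S T : V -> V) :=
  forall xi eta, hm_ip (S xi) eta = hm_ip xi (T eta).

Definition adjointable : set (V -> V) :=
  [set S | exists T, adjoint_pair S T].

(* Closure of [B] among the adjointable operators, for the operator norm. *)
Definition op_closure (B : set (V -> V)) : set (V -> V) :=
  adjointable `&` [set T | forall e : R, 0 < e -> exists2 S, B S &
    forall xi, hm_norm (T xi - S xi) <= e * hm_norm xi].

Record cstar_subalgebra (B : set (V -> V)) : Prop := CstarSubalgebra {
  cstar_adjointable : B `<=` adjointable;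
  cstar0 : B 0;
  cstarD : forall S T, B S -> B T -> B (S + T);
  cstarZ : forall (c : Cplx R) S, B S -> B (c *: S);
  cstarM : forall S T, B S -> B T -> B (S \o T);
  cstar_adjoint : forall S T, B S -> adjoint_pair S T -> B T;
  cstar_closed : op_closure B `<=` B
}.

Definition cstar_gen (B : set (V -> V)) : set (V -> V) :=
  smallest cstar_subalgebra B.

End Operators.

Record cstar_isomorphism (R : realType) (V W : hilbert_module R)
    (A : set (V -> V)) (B : set (W -> W)) (Phi : (V -> V) -> (W -> W)) : Prop :=
  CstarIsomorphism {
  ciso_bij : set_bij A B Phi;
  cisoD : forall S T, A S -> A T -> Phi (S + T) = Phi S + Phi T;
  cisoZ : forall (c : Cplx R) S, A S -> Phi (c *: S) = c *: Phi S;
  cisoM : forall S T, A S -> A T -> Phi (S \o T) = Phi S \o Phi T;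
  ciso_adjoint : forall S T, A S -> A T -> adjoint_pair S T ->
    adjoint_pair (Phi S) (Phi T)
}.

Section Ltwo.
Context (R : realType) (I : choiceType).

Definition l2_pred : {pred I -> Cplx R} := mem
  [set xi : I -> Cplx R | (\esum_(i in [set: I]) ((cmod (xi i) ^+ 2)%:E) < +oo)%E].

Lemma l2_submod : submod_closed l2_pred.
Proof.
have P (xi : I -> Cplx R) : (\esum_(i in [set: I]) (cmod (xi i) ^+ 2)%:E < +oo)%E <->
    exists M, forall B : {fset I}, \sum_(i <- B) cmod (xi i) ^+ 2 <= M.
  by apply: (@esum_ltyP R I (fun i => cmod (xi i) ^+ 2)) => i; exact: sqr_ge0.
split=> [|c xi eta]; rewrite !inE /=.
  apply/(P 0); exists 0 => B; rewrite big1 // => i _.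
  by rewrite cmod2E /= !expr0n addr0.
move=> /(P xi)[M1 H1] /(P eta)[M2 H2]; apply/(P (c *: xi + eta)).
exists (2 * (1 + cmod c ^+ 2) * (M1 + M2)) => B.
have K0 : 0 <= 2 * (1 + cmod c ^+ 2) by rewrite mulr_ge0 // addr_ge0 // sqr_ge0.
apply: (@le_trans _ _ (2 * (1 + cmod c ^+ 2) *
    (\sum_(i <- B) cmod (xi i) ^+ 2 + \sum_(i <- B) cmod (eta i) ^+ 2))).
  by rewrite -big_split mulr_sumr; apply: ler_sum => i _; exact: cmod2_lin.
by apply: ler_wpM2l => //; apply: lerD.
Qed.

HB.instance Definition _ :=
  GRing.isSubmodClosed.Build (Cplx R) (I -> Cplx R) l2_pred l2_submod.

Record l2 := L2 { l2_val :> I -> Cplx R; _ : l2_val \in l2_pred }.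
HB.instance Definition _ := [isSub for l2_val].
HB.instance Definition _ := [Choice of l2 by <:].
HB.instance Definition _ := [SubChoice_isSubLmodule of l2 by <:].

Definition l2_module : hilbert_module R :=
  @HilbertModule R l2 unit
    (fun xi eta _ => usum (fun i => (xi i)^* * eta i)).

End Ltwo.

Section ReducedCstar.
Context (R : realType) (K : groupoid).

Definition Cc (f : K -> Cplx R) :=
  continuous f /\ compact (closure [set a | f a <> 0]).

(* The direct sum of the regular representations on the l2(s^-1(x)), with
   x a unit, acts on l2(K), since K is the disjoint union of the s^-1(x).
   [regular_op f T] says that T is the image of f, i.e. that T xi is the
   convolution of f and xi. The sum has finite support when K is etale
   and f is in [Cc]. *)
Definition regular_op (f : K -> Cplx R) (T : l2_module R K -> l2_module R K) :=
  forall (xi : l2 R K) (c : K), (T xi : l2 R K) c =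
    \sum_(a \in [set a : K | grng a = grng c]) f a * xi (gmul (ginv a) c).

Definition reduced_cstar : set (l2_module R K -> l2_module R K) :=
  op_closure [set T | exists2 f, Cc f & regular_op f T].

(* The functions supported on the unit space. *)
Definition reduced_diag : set (l2_module R K -> l2_module R K) :=
  [set T | exists f, [/\ Cc f, (forall a, grng a <> a -> f a = 0) &
                         regular_op f T]].

End ReducedCstar.

Arguments reduced_cstar R K : clear implicits.
Arguments reduced_diag R K : clear implicits.

Section PartialCrossedProduct.
Context (R : realType) (G : groupType) (X : topologicalType).
Context (theta : ore_action G X).

Definition pdom (g : G) : set X := [set x | Qset theta x g].

(* On functions vanishing off [pdom g^-1] this is the partial action; on the
   other ones, it is the partial action after restriction to [pdom g^-1]. *)
Definition hat_action (g : G) (f : X -> Cplx R) (x : X) : Cplx R :=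
  if x \in pdom g then f (uact theta x g) else 0.

Definition pcp_pred : {pred G -> X -> Cplx R} := mem
  [set xi : G -> X -> Cplx R |
    [/\ forall g, continuous (xi g),
        forall g x, ~ pdom g x -> xi g x = 0 &
        exists2 f : X -> R, continuous f &
          {uniform, (fun B : {fset G} => fun x =>
             \sum_(g <- B) cmod (xi g x) ^+ 2) @ totally --> f}]].

Lemma pcp_submod : submod_closed pcp_pred.
Proof.
split=> [|c xi eta]; rewrite !inE /=.
  split => //; first by move=> g; exact: cst_continuous.
  exists (cst 0); first exact: cst_continuous.
  apply/unif_net => e e0; exists fset0 => B _ x; rewrite big1 ?subrr ?normr0 // => i _.
  by rewrite [LHS](@cmod2E R 0) /= !expr0n addr0.
move=> [xc x0 [f1 f1c H1]] [ec e0 [f2 f2c H2]]; 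
have C g : continuous (c *: xi g + eta g).
  move=> x; apply: cvgD; last exact: ec.
  by apply: cvgZl_tmp; exact: xc.
split=> //; first by move=> g x Q; rewrite /= !fctE x0 // e0 // scaler0 addr0.
apply: (@unif_dominated R G X (fun g x => cmod (xi g x) ^+ 2)
  (fun g x => cmod (eta g x) ^+ 2) (fun g x => cmod (c * xi g x + eta g x) ^+ 2)
  (2 * (1 + cmod c ^+ 2)) f1 f2) => //.
- by rewrite mulr_gt0 // ltr_pwDl // sqr_ge0.
- by move=> *; exact: sqr_ge0.
- by move=> *; exact: sqr_ge0.
- by move=> *; exact: sqr_ge0.
- by move=> g x; exact: cmod2_lin.
- move=> g x; have H : {for x, continuous (fun x => cmod ((c *: xi g + eta g) x))}.
    by apply: continuous_comp; [exact: C|exact: cmod_continuous].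
  exact: (cvgM H H).
Qed.

HB.instance Definition _ := GRing.isSubmodClosed.Build (Cplx R)
  (G -> X -> Cplx R) pcp_pred pcp_submod.

Record pcp := Pcp { pcp_val :> G -> X -> Cplx R; _ : pcp_val \in pcp_pred }.
HB.instance Definition _ := [isSub for pcp_val].
HB.instance Definition _ := [Choice of pcp by <:].
HB.instance Definition _ := [SubChoice_isSubLmodule of pcp by <:].

Definition pcp_module : hilbert_module R :=
  @HilbertModule R pcp X
    (fun xi eta x => usum (fun g => (xi g x)^* * eta g x)).

Definition tau_op (f : X -> Cplx R) (T : pcp_module -> pcp_module) :=
  forall (xi : pcp) g x, (T xi : pcp) g x = hat_action g f x * xi g x.

Definition v_op (h : G) (T : pcp_module -> pcp_module) :=
  forall (xi : pcp) g x, (T xi : pcp) g x =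
    if x \in pdom g `&` pdom (g * h)%g then xi (g * h)%g x else 0.

Definition crossed_diag : set (pcp_module -> pcp_module) :=
  [set T | exists2 f : X -> Cplx R, continuous f & tau_op f T].

Definition crossed_product : set (pcp_module -> pcp_module) :=
  cstar_gen (crossed_diag `|` [set T | exists h, v_op h T]).

End PartialCrossedProduct.

Arguments crossed_diag R {G X} theta.
Arguments crossed_product R {G X} theta.

Definition continuously_orbit_equivalent (G H : groupType)
    (X Y : topologicalType) (theta : ore_action G X) (rho : ore_action H Y) :=
  exists (phi : X -> Y) (psi : Y -> X)
    (a : tg theta -> discrete_topology H) (b : tg rho -> discrete_topology G),
  [/\ [/\ cancel phi psi, cancel psi phi, continuous phi & continuous psi],
      continuous a /\ continuous b,
      forall z : tg theta,
        Qset rho (phi (tg_pt z)) (a z) /\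
        phi (uact theta (tg_pt z) (tg_gp z)) = uact rho (phi (tg_pt z)) (a z) &
      forall w : tg rho,
        Qset theta (psi (tg_pt w)) (b w) /\
        psi (uact rho (tg_pt w) (tg_gp w)) = uact theta (psi (tg_pt w)) (b w)].

(* Main.v *)
Require Import Defs.
From HB Require Import structures.
From mathcomp Require Import all_boot all_order all_algebra finmap complex.
From mathcomp Require Import all_classical all_reals all_analysis ring lra.

(** The etale isomorphism (ii) is the hub: it implies (i), (iii) and (iv) by
    transport of structure, and each of (i), (iii), (iv) implies it back through
    a weak, local form of orbit equivalence, [local_orbit_equivalent]: there is a
    homeomorphism [phi] of [X] onto [Y] such that near each point the partial
    homeomorphism of each element of [G] is carried by [phi] to the one of some
    element of [H], and conversely.

    Topological freeness upgrades this local form to (ii).  Two elements of [H]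
    that act in the same way near a point differ by an element that fixes an
    open set pointwise, so they are equal ([topologically_free_uniq]).  The
    element of [H] attached to a point and an element of [G] is therefore unique,
    locally constant and multiplicative: it is a cocycle, and it is inverted by
    the cocycle of [phi^-1] ([local_cocycle_half]).  Together with [phi], a pair
    of mutually inverse cocycles is the same as an isomorphism of the
    transformation groupoids, which always gives an orbit equivalence.

    From (iii) or (iv) to the local form there is one argument for both algebras,
    written for a [diagonal_model]: the functions on [X] as diagonal operators
    [D f], and the partial isometries [N g] with [N g D f = D (f o u(., g)) N g].
    An isomorphism [Phi] that preserves the diagonal restricts to an isomorphism
    of the algebras of continuous functions, hence comes from a homeomorphism
    ([algebra_relation_map]).  The operator [T = Phi (N g^-1)] intertwines
    functions along the transported partial homeomorphism of [g].  Now an element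
    of either algebra has continuous coefficients indexed by the arrows of the
    groupoid, and the relation [T D c = D c' T] forces [c x = c' (u(x, k))]
    whenever the coefficient of [T] attached to [(x, k)] is nonzero.  Such
    a [k] exists because [T^* T] is the indicator function of a set that contains
    [x], and by continuity the same [k] serves near [x]: there the transported map
    is [u(., k)].

    Both models are made concrete.  The coefficients of the reduced algebra are
    values at basis vectors of [l2] of the groupoid; they are limits, uniformly in
    the arrow, of the coefficients of convolution operators, and the latter are
    finite sums of operators [D f o N g] because a compact set of arrows meets only
    finitely many copies of the domains ([convolution]).  In the Hilbert module of
    the crossed product the coefficients of [T] are the components of the image of
    the basis vector at the identity, so they are continuous by definition.

    For the transport, an isomorphism of groupoids induces a unitary between the
    modules.  On [l2] it carries convolution operators to convolution operators.
    On the module of the crossed product it carries [N g] to a finite sum of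
    operators [D w o N k], where [w] is the indicator function of the clopen set on
    which the cocycle takes the value [k] at [g]; compactness makes the sum
    finite ([conj_crs_N]). *)

Set Implicit Arguments.
Unset Strict Implicit.
Unset Printing Implicit Defensive.

Import Order.TTheory GRing.Theory Num.Theory.
Import numFieldNormedType.Exports.

Local Open Scope classical_set_scope.
Local Open Scope ring_scope.

(** * Unconditional sums of complex numbers *)

Section Modulus.
Context (R : realType).
Implicit Types z w : Cplx R.

Lemma normr_cmod z : `|z| = (cmod z)%:C%C.
Proof. by rewrite normc_def; case: z. Qed.

Lemma cmod_ge0 z : 0 <= cmod z.
Proof. by case: z => a b; exact: sqrtr_ge0. Qed.

Lemma cmod0 : cmod (0 : Cplx R) = 0.
Proof. exact: ComplexField.Normc.normc0. Qed.

Lemma cmod_real (x : R) : 0 <= x -> cmod (x%:C%C : Cplx R) = x.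
Proof. by move=> x0; rewrite /cmod /= expr0n addr0 sqrtr_sqr ger0_norm. Qed.

Lemma cmod1 : cmod (1 : Cplx R) = 1.
Proof. exact: ComplexField.Normc.normc1. Qed.

Lemma cmodM z w : cmod (z * w) = cmod z * cmod w.
Proof. exact: ComplexField.Normc.normcM. Qed.

Lemma cmodD z w : cmod (z + w) <= cmod z + cmod w.
Proof. exact: le_normcD. Qed.

Lemma cmodB z w : cmod (z - w) = cmod (w - z).
Proof. by rewrite -opprB; exact: normcN. Qed.

Lemma cmod_conj z : cmod z^* = cmod z.
Proof.
have := norm_conjC z; rewrite !normr_cmod => /eqP.
by rewrite eq_complex /= => /andP[/eqP].
Qed.

Lemma cmod_eq0 z : cmod z = 0 -> z = 0.
Proof. exact: ComplexField.Normc.eq0_normc. Qed.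

Lemma conjM_cmod z : z^* * z = (cmod z ^+ 2)%:C%C.
Proof. by rewrite mulrC -normCK normr_cmod -!rmorphXn. Qed.

Lemma Re_le_cmod z : `|complex.Re z| <= cmod z.
Proof.
by rewrite -(@ler_pXn2r _ 2) ?nnegrE ?cmod_ge0 // real_normK ?num_real //
  cmod2E lerDl sqr_ge0.
Qed.

Lemma Im_le_cmod z : `|complex.Im z| <= cmod z.
Proof.
by rewrite -(@ler_pXn2r _ 2) ?nnegrE ?cmod_ge0 // real_normK ?num_real //
  cmod2E lerDr sqr_ge0.
Qed.

(** The topology of the complex numbers in terms of the real-valued modulus. *)
Lemma cvg_cmodP (J : Type) (F : set_system J) (FF : Filter F)
    (f : J -> Cplx R) (l : Cplx R) :
  f @ F --> l <-> forall e : R, 0 < e -> \forall j \near F, cmod (l - f j) < e.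
Proof.
rewrite -[f @ F]/(f j @[j --> F]).
split=> [/(@cvgrPdist_lt _ _ _ F FF) H e e0|H].
  have e0' : 0 < (e%:C%C : Cplx R) by rewrite ltcR.
  by apply: filterS (H _ e0') => j; rewrite normr_cmod ltcR.
apply/(@cvgrPdist_lt _ _ _ F FF) => -[e e'] e0.
have [e0' e'0] : 0 < e /\ e' = 0.
  by move: e0; rewrite ltcE /= => /andP[/eqP -> ->].
by apply: filterS (H _ e0') => j; rewrite normr_cmod e'0 -ltcR.
Qed.

End Modulus.

Section UnconditionalSums.
Context (R : realType).

Definition has_usum (I : choiceType) (f : I -> Cplx R) (l : Cplx R) :=
  \sum_(i <- B) f i @[B --> totally] --> l.

Lemma has_usumP (I : choiceType) (f : I -> Cplx R) (l : Cplx R) :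
  has_usum f l <-> forall e : R, 0 < e -> exists A : {fset I},
    forall B, (A `<=` B)%fset -> cmod (l - \sum_(i <- B) f i) < e.
Proof.
split=> [/cvg_cmodP H e e0|H].
  by have [A _ HA] := H e e0; exists A => B AB; exact: HA.
apply/cvg_cmodP => e e0; have [A HA] := H e e0.
by exists A => // B AB; exact: HA.
Qed.

Lemma usumE (I : choiceType) (f : I -> Cplx R) l : has_usum f l -> usum f = l.
Proof. by move=> H; apply: cvg_lim => //; exact: norm_hausdorff. Qed.

Lemma has_usumD (I : choiceType) (f g : I -> Cplx R) l m :
  has_usum f l -> has_usum g m -> has_usum (fun i => f i + g i) (l + m).
Proof.
move=> /has_usumP Hf /has_usumP Hg; apply/has_usumP => e e0.
have [A HA] := Hf _ (divr_gt0 e0 (ltr0n _ 2)).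
have [B HB] := Hg _ (divr_gt0 e0 (ltr0n _ 2)).
exists (A `|` B)%fset => D; rewrite fsubUset => /andP[/HA hA /HB hB].
rewrite big_split /= opprD addrACA; apply: le_lt_trans (cmodD _ _) _; lra.
Qed.

Lemma has_usumZ (I : choiceType) (c : Cplx R) (f : I -> Cplx R) l :
  has_usum f l -> has_usum (fun i => c * f i) (c * l).
Proof.
move=> /has_usumP Hf; apply/has_usumP => e e0.
have c0 : 0 < 1 + cmod c by rewrite ltr_pwDl // cmod_ge0.
have [A HA] := Hf _ (divr_gt0 e0 c0).
exists A => B /HA; rewrite -mulr_sumr -mulrBr cmodM ltr_pdivlMr //.
move: (cmod_ge0 (l - \sum_(i <- B) f i)).
by move: (cmod _) (cmod c) => u v; nra.
Qed.

Lemma has_usum_conj (I : choiceType) (f : I -> Cplx R) l :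
  has_usum f l -> has_usum (fun i => (f i)^*) l^*.
Proof.
move=> /has_usumP H; apply/has_usumP => e e0; have [A HA] := H e e0.
by exists A => B /HA; rewrite -rmorph_sum -rmorphB /= cmod_conj.
Qed.

Lemma has_usum_finite (I : choiceType) (A : {fset I}) (f : I -> Cplx R) :
  (forall i, i \notin A -> f i = 0) -> has_usum f (\sum_(i <- A) f i).
Proof.
move=> f0; apply/has_usumP => e e0; exists A => B AB.
rewrite (big_fset_incl _ AB) => [|i _ iA]; last exact: f0.
by rewrite subrr cmod0.
Qed.

Lemma usum0 (I : choiceType) (f : I -> Cplx R) :
  (forall i, f i = 0) -> usum f = 0.
Proof.
move=> f0; have /usumE-> : has_usum f (\sum_(i <- fset0) f i).
  by apply: has_usum_finite => i _; exact: f0.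
by rewrite big_seq_fset0.
Qed.

Lemma usum1 (I : choiceType) (j : I) (f : I -> Cplx R) :
  (forall i, i <> j -> f i = 0) -> usum f = f j.
Proof.
move=> f0; have /usumE-> : has_usum f (\sum_(i <- [fset j]%fset) f i).
  by apply: has_usum_finite => i; rewrite inE => /eqP; exact: f0.
by rewrite big_seq_fset1.
Qed.

(** A partial bijection between the supports is enough: the terms that it
    forgets vanish. *)
Lemma has_usum_reindex (I J : choiceType) (s : I -> J) (t : J -> I)
    (f : I -> Cplx R) (g : J -> Cplx R) l :
  (forall i, f i <> 0 -> t (s i) = i /\ g (s i) = f i) ->
  (forall j, g j <> 0 -> s (t j) = j /\ f (t j) = g j) ->
  has_usum f l -> has_usum g l.
Proof.
move=> Hf Hg /has_usumP H; apply/has_usumP => e e0; have [A HA] := H e e0.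
exists [fset s i | i in A]%fset => B AB.
pose B1 := [fset j in B | g j != 0]%fset.
pose D := [fset t j | j in B1]%fset.
have tinj : {in B1 &, injective t}.
  move=> j k; rewrite !inE => /andP[_ /eqP gj] /andP[_ /eqP gk] E.
  by rewrite -(Hg _ gj).1 -(Hg _ gk).1 E.
suff -> : \sum_(j <- B) g j = \sum_(i <- (A `|` D)%fset) f i by apply: HA; exact: fsubsetUl.
have -> : \sum_(j <- B) g j = \sum_(j <- B1) g j.
  apply/esym/big_fset_incl; first by apply/fsubsetP => j; rewrite !inE => /andP[].
  by move=> j jB; rewrite !inE jB /= negbK => /eqP.
have -> : \sum_(i <- (A `|` D)%fset) f i = \sum_(i <- D) f i.
  apply/esym/big_fset_incl; first exact: fsubsetUr.
  move=> i; rewrite in_fsetU => /orP[iA|->//] iD.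
  apply: contrapT => fi; have [ti gi] := Hf _ fi.
  move/negP: iD; apply; apply/imfsetP; exists (s i) => //=.
  rewrite !inE gi; apply/andP; split; last exact/eqP.
  by apply: (fsubsetP AB); apply/imfsetP; exists i.
rewrite [RHS]big_imfset //=; apply: eq_big_seq => j; rewrite !inE => /andP[_ /eqP gj].
by rewrite (Hg _ gj).2.
Qed.

Lemma usum_reindex (I J : choiceType) (s : I -> J) (t : J -> I)
    (f : I -> Cplx R) (g : J -> Cplx R) :
  (forall i, f i <> 0 -> t (s i) = i /\ g (s i) = f i) ->
  (forall j, g j <> 0 -> s (t j) = j /\ f (t j) = g j) ->
  usum f = usum g.
Proof.
move=> Hf Hg.
have E : [set l | has_usum f l] = [set l | has_usum g l].
  apply/seteqP; split => l /=; first exact: (has_usum_reindex Hf Hg).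
  exact: (has_usum_reindex Hg Hf).
by change (get [set l | has_usum f l] = get [set l | has_usum g l]); rewrite E.
Qed.

Lemma real_usum (I : choiceType) (a : I -> R) (M : R) :
  (forall i, 0 <= a i) -> (forall B : {fset I}, \sum_(i <- B) a i <= M) ->
  exists2 s : R, has_usum (fun i => (a i)%:C%C) s%:C%C &
    (forall B : {fset I}, \sum_(i <- B) a i <= s) /\ s <= M.
Proof.
move=> a0 aM; pose E := range (fun B : {fset I} => \sum_(i <- B) a i).
have E0 : E !=set0 by exists (\sum_(i <- fset0) a i), fset0.
have EM : ubound E M by move=> _ [B _ <-].
have sE : has_sup E by split => //; exists M.
have ub (B : {fset I}) : \sum_(i <- B) a i <= sup E.
  by apply: sup_upper_bound => //; exists B.
exists (sup E); last by split => //; exact: ge_sup.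
apply/has_usumP => e e0.
have [_ [A _ <-] HA] := sup_adherent e0 sE.
exists A => B AB; rewrite -rmorph_sum -rmorphB.
rewrite [cmod _](_ : _ = sup E - \sum_(i <- B) a i); last first.
  by apply: cmod_real; rewrite subr_ge0.
have : \sum_(i <- A) a i <= \sum_(i <- B) a i.
  rewrite [leRHS](big_fsetID _ (mem A)) /= (_ : [fset _ in _ | _]%fset = A).
    by rewrite lerDl; apply: sumr_ge0.
  apply/fsetP => i; rewrite !inE /= andbC.
  by case: (boolP (i \in A)) => //= /(fsubsetP AB).
lra.
Qed.

(** Adding the majorant to the real and imaginary parts makes them nonnegative,
    with bounded partial sums. *)
Lemma usummable (I : choiceType) (a : I -> R) (M : R) (f : I -> Cplx R) :
  (forall i, cmod (f i) <= a i) -> (forall B : {fset I}, \sum_(i <- B) a i <= M) ->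
  exists l, has_usum f l.
Proof.
move=> fa aM; have a0 i : 0 <= a i := le_trans (cmod_ge0 _) (fa i).
have [s Hs _] := real_usum a0 aM.
have part (p : I -> R) : (forall i, `|p i| <= a i) ->
    exists l, has_usum (fun i => (p i)%:C%C) l.
  move=> pa; have b0 i : 0 <= p i + a i.
    by have := pa i; rewrite ler_norml => /andP[]; lra.
  have bM (B : {fset I}) : \sum_(i <- B) (p i + a i) <= 2 * M.
    apply: (@le_trans _ _ (\sum_(i <- B) 2 * a i)).
      apply: ler_sum => i _; have := pa i; rewrite ler_norml => /andP[]; lra.
    by rewrite -mulr_sumr ler_pM2l.
  have [t Ht _] := real_usum b0 bM.
  exists (t%:C%C + (-1) * s%:C%C).
  have := has_usumD Ht (has_usumZ (c := -1) Hs).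
  congr (has_usum _ _); apply/funext => i.
  by rewrite rmorphD /= mulN1r addrK.
have [l1 H1] := part (fun i => complex.Re (f i)) (fun i => le_trans (Re_le_cmod _) (fa i)).
have [l2 H2] := part (fun i => complex.Im (f i)) (fun i => le_trans (Im_le_cmod _) (fa i)).
exists (l1 + 'i%C * l2); have := has_usumD H1 (has_usumZ (c := 'i%C) H2).
congr (has_usum _ _); apply/funext => i; case: (f i) => p q.
by simpc.
Qed.

Lemma usummable_l2 (I : choiceType) (M N : R) (f g : I -> Cplx R) :
  (forall B : {fset I}, \sum_(i <- B) cmod (f i) ^+ 2 <= M) ->
  (forall B : {fset I}, \sum_(i <- B) cmod (g i) ^+ 2 <= N) ->
  exists l, has_usum (fun i => (f i)^* * g i) l.
Proof.
move=> fM gN.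
apply: (@usummable _ (fun i => cmod (f i) ^+ 2 + cmod (g i) ^+ 2) (M + N)) => [i|B].
  rewrite cmodM cmod_conj.
  have := sqr_ge0 (cmod (f i) - cmod (g i)); have := cmod_ge0 (f i).
  have := cmod_ge0 (g i); nra.
by rewrite big_split /= lerD.
Qed.

End UnconditionalSums.

(** * The topology of the transformation groupoid *)

Section OreActionAlgebra.
Context (G : groupType) (X : topologicalType) (theta : ore_action G X).

Lemma Qset1 x : Qset theta x 1%g.
Proof. exact: (Qset_udef (@udef1 _ _ theta x)). Qed.

Lemma QsetV x g : Qset theta x g -> Qset theta (uact theta x g) g^-1%g.
Proof. by move=> /uact_def/udefV H; exact: (Qset_udef H). Qed.

Lemma uactK x g : Qset theta x g -> uact theta (uact theta x g) g^-1%g = x.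
Proof. by move=> /uact_def/udefV H; exact: (uact_uniq H). Qed.

Lemma QsetM x g h : Qset theta x g -> Qset theta (uact theta x g) h ->
  Qset theta x (g * h)%g.
Proof. by move=> /uact_def Hg /uact_def Hh; exact: (Qset_udef (udefM Hg Hh)). Qed.

Lemma uactM x g h : Qset theta x g -> Qset theta (uact theta x g) h ->
  uact theta x (g * h)%g = uact theta (uact theta x g) h.
Proof. by move=> /uact_def Hg /uact_def Hh; exact: (uact_uniq (udefM Hg Hh)). Qed.

Lemma QsetVM x g h : Qset theta x g -> Qset theta x h ->
  Qset theta (uact theta x g) (g^-1 * h)%g.
Proof. by move=> Hg Hh; apply: QsetM; [exact: QsetV|rewrite uactK]. Qed.

Lemma uact_out x g : ~ Qset theta x g -> uact theta x g = x.
Proof.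
move=> nQ; rewrite /uact; case: xgetP => // y _ H.
by case: nQ; exact: (Qset_udef H).
Qed.

Lemma QsetP x a b : osg theta a -> osg theta b ->
  Qset theta x (a * b^-1)%g <-> exists y, theta a x = theta b y.
Proof.
move=> Pa Pb; split=> [/uact_def H|[y E]]; last by exists a, b, y.
by exists (uact theta x (a * b^-1)%g); exact: H.
Qed.

End OreActionAlgebra.

Section DomainTopology.
Context (G : groupType) (X : topologicalType) (theta : ore_action G X).
Context (cX : compact [set: X]) (hX : hausdorff_space X).
Context (oth : open_images theta).

Lemma compact_image (b : G) (C : set X) : osg theta b -> closed C ->
  compact (theta b @` C).
Proof.
move=> Pb cC; apply: continuous_compact; last exact: (subclosed_compact cC cX).
by apply: continuous_subspaceT; exact: act_continuous.
Qed.

Lemma pdom_open g : open (pdom theta g).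
Proof.
have [a [b [Pa Pb ->]]] := osg_ore theta g.
rewrite [pdom _ _](_ : _ = theta a @^-1` range (theta b)).
  by apply: open_comp; [move=> *; exact: act_continuous|exact: oth].
apply/seteqP; split => x /=.
  by move=> /(QsetP x Pa Pb)[y ->]; exists y.
by move=> [y _ E]; apply/(QsetP x Pa Pb); exists y.
Qed.

Lemma pdom_closed g : closed (pdom theta g).
Proof.
have [a [b [Pa Pb ->]]] := osg_ore theta g.
rewrite [pdom _ _](_ : _ = theta a @^-1` range (theta b)).
  apply: closed_comp; first by move=> *; exact: act_continuous.
  apply: compact_closed => //; apply: compact_image => //; exact: closedT.
apply/seteqP; split => x /=.
  by move=> /(QsetP x Pa Pb)[y ->]; exists y.
by move=> [y _ E]; apply/(QsetP x Pa Pb); exists y.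
Qed.

Lemma near_pdom x g : Qset theta x g -> \forall x' \near x, Qset theta x' g.
Proof. by move=> Q; apply: open_nbhs_nbhs; split => //; exact: pdom_open. Qed.

Lemma near_npdom x g : ~ Qset theta x g -> \forall x' \near x, ~ Qset theta x' g.
Proof.
move=> Q; apply: (@open_nbhs_nbhs _ _ (~` pdom theta g)); split => //.
by apply: closed_openC; exact: pdom_closed.
Qed.

(** Off the clopen domain of [g] the default value makes the map the identity;
    on it, the map inverts [theta b], which is a closed embedding. *)
Lemma uact_continuous g : continuous (fun x => uact theta x g).
Proof.
move=> x V; have [Qx|nQx] := pselect (Qset theta x g); last first.
  rewrite uact_out // => xV; have : \forall x' \near x, V x' /\ ~ Qset theta x' g.
    by apply: filterI => //; exact: near_npdom.
  by apply: filterS => x' [Vx' nQ]; rewrite /= uact_out.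
rewrite nbhsE => -[W [oW Wx] WV].
have [a [b [Pa Pb gE]]] := osg_ore theta g.
have cI : closed (theta b @` (~` W)).
  by apply: compact_closed => //; apply: compact_image => //; exact: open_closedC.
have H : \forall x' \near x, ~ (theta b @` (~` W)) (theta a x').
  apply: (@act_continuous _ _ theta a Pa x (~` (theta b @` (~` W)))).
  apply: (@open_nbhs_nbhs _ _ (~` (theta b @` (~` W)))); split.
    exact: closed_openC.
  move=> [y nWy E]; apply: nWy.
  rewrite (_ : y = uact theta x g) //.
  by apply: (act_inj Pb); rewrite E (uact_def Qx Pa Pb gE).
have K := near_pdom Qx.
apply: filterS2 H K => x' nI Qx' /=.
apply: WV; apply: contrapT => nW; apply: nI.
by exists (uact theta x' g) => //; rewrite (uact_def Qx' Pa Pb gE).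
Qed.

End DomainTopology.

Section GroupoidTopology.
Context (G : groupType) (X : topologicalType) (theta : ore_action G X).

Definition tg_unit x : tg theta :=
  exist _ (x, 1%g : discrete_topology G) (mem_set (Qset1 theta x)).

(** Total in [x] and [g], so that functions of arrows become functions of two
    arguments; outside of the groupoid the value is a unit. *)
Definition tg_of x (g : G) : tg theta := insubd (tg_unit x) (x, g).

Lemma tg_of_pt x g : tg_pt (tg_of x g) = x.
Proof.
have [Q|nQ] := pselect (Qset theta x g).
  exact: (tg_insub _ (uact_def Q)).1.
rewrite /tg_of /insubd insubF //; apply/negP => /set_mem; exact: nQ.
Qed.

Lemma tg_of_gp x g : Qset theta x g -> tg_gp (tg_of x g) = g.
Proof. by move=> /uact_def Q; exact: (tg_insub _ Q).2. Qed.

Lemma tgQ (z : tg theta) : Qset theta (tg_pt z) (tg_gp z).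
Proof. exact: (set_mem (valP z)). Qed.

Lemma tg_ofK z : tg_of (tg_pt z) (tg_gp z) = z.
Proof. by apply: tg_ext; rewrite ?tg_of_pt ?tg_of_gp //; exact: tgQ. Qed.

(** The copies of the domains [X_g] are open, and carry the topology of [X]. *)
Lemma near_tg (z : tg theta) (P : tg theta -> Prop) :
  (\forall w \near z, P w) <->
  \forall x \near tg_pt z, forall w, tg_pt w = x -> tg_gp w = tg_gp z -> P w.
Proof.
split.
- move=> [B /= [[W oW <-] Wz] WP].
  have : nbhs (\val z) W by apply: open_nbhs_nbhs.
  move=> [[A C] /= [nA nC] AC]; apply: filterS nA => x Ax w wx wz.
  apply: WP => /=; apply: AC => /=; split; first by rewrite -[(\val w).1]/(tg_pt w) wx.
  move: nC => /nbhs_singleton; rewrite -[(\val w).2]/(tg_gp w) wz; exact.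
- move=> HP.
  pose U := [set x | forall w, tg_pt w = x -> tg_gp w = tg_gp z -> P w].
  have nW : nbhs (\val z) (U `*` [set tg_gp z : discrete_topology G]).
    by exists (U, [set tg_gp z : discrete_topology G]) => //; split => //;
      exact: discrete_set1.
  have nz : nbhs z (val @^-1` (U `*` [set tg_gp z : discrete_topology G])).
    exact: (@initial_continuous _ _ val z _ nW).
  apply: filterS nz.
  by move=> w [/= Uw wz]; exact: Uw.
Qed.

Lemma tg_pt_continuous : continuous (@tg_pt G X theta).
Proof.
move=> z V zV; apply/(near_tg z) ; apply: filterS zV => x Vx w wx _.
by rewrite /= wx.
Qed.

Lemma tg_of_continuous (Z : topologicalType) (z : Z) (f : Z -> X) (k : Z -> G) :
  {for z, continuous f} -> (\forall z' \near z, k z' = k z /\ Qset theta (f z') (k z')) ->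
  {for z, continuous (fun z => tg_of (f z) (k z))}.
Proof.
move=> cf ck V /near_tg; rewrite tg_of_pt => /cf /= fV.
have fV' : \forall z' \near z, forall w : tg theta, tg_pt w = f z' ->
  tg_gp w = tg_gp (tg_of (f z) (k z)) -> V w by exact: fV.
suff : \forall z' \near z, V (tg_of (f z') (k z')) by [].
have [_ Qz] := nbhs_singleton ck.
apply: filterS2 fV' ck => z' Vz' [kE Q].
by apply: Vz'; rewrite ?tg_of_pt // !tg_of_gp.
Qed.

End GroupoidTopology.

(** * Groupoid isomorphisms and continuous orbit equivalence *)

Section GroupoidMorphisms.
Variables (K L : groupoid) (F : K -> L).
Hypothesis mF : groupoid_morphism F.

Let AK := groupoidP K.
Let AL := groupoidP L.

(** As in a group, multiply by the inverse. *)
Lemma groupoid_idem (e : L) : gsrc e = grng e -> gmul e e = e -> grng e = e.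
Proof.
move=> se ee.
have E : gmul (ginv e) (gmul e e) = gmul (gmul (ginv e) e) e.
  by apply: (gax_mulA AL) => //; exact: (gax_srcV AL).
move: E; rewrite ee (gax_Vmul AL) {2}se (gax_1mul AL) => <-.
exact: (gax_rng_src AL).
Qed.

Lemma morphism_unit e : grng e = e -> grng (F e) = F e.
Proof.
move=> re; have se : gsrc e = e by rewrite -{1}re (gax_src_rng AK).
have ee : gmul e e = e by rewrite -{2}se (gax_mul1 AK).
have [s1] := mF (etrans se (esym re)); rewrite ee => m1.
exact: groupoid_idem.
Qed.

Lemma morphism_src a : gsrc (F a) = F (gsrc a).
Proof.
have [-> _] := mF (esym (gax_rng_src AK a)).
exact: morphism_unit (gax_rng_src AK a).
Qed.

Lemma morphism_rng a : grng (F a) = F (grng a).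
Proof.
have [<- _] := mF (gax_src_rng AK a).
rewrite -(morphism_unit (gax_rng_rng AK a)); exact: (gax_src_rng AL).
Qed.

Lemma morphism_inv a : F (ginv a) = ginv (F a).
Proof.
have [s1 m1] := mF (gax_srcV AK a).
have [s2 _] := mF (esym (gax_rngV AK a)).
rewrite -[LHS](gax_mul1 AL) s1 -(gax_mulV AL) (gax_mulA AL) //.
  by rewrite -m1 (gax_Vmul AK) -morphism_src -(gax_rngV AL) (gax_1mul AL).
by rewrite (gax_rngV AL).
Qed.

End GroupoidMorphisms.

(** An isomorphism between transformation groupoids in coordinates: [phi] on the
    units, and the locally constant cocycle [a] on the group elements.  The
    first and second halves of an isomorphism and its inverse are the same
    statement with the roles of the two actions exchanged. *)
Record cocycle_half (G H : groupType) (X Y : topologicalType)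
    (theta : ore_action G X) (rho : ore_action H Y)
    (phi : X -> Y) (psi : Y -> X) (a : X -> G -> H) (b : Y -> H -> G) : Prop :=
  CocycleHalf {
  ch_can : cancel phi psi;
  ch_cont : continuous phi;
  ch_Q : forall x g, Qset theta x g -> Qset rho (phi x) (a x g);
  ch_u : forall x g, Qset theta x g ->
    phi (uact theta x g) = uact rho (phi x) (a x g);
  ch_b : forall x g, Qset theta x g -> b (phi x) (a x g) = g;
  ch_near : forall x g, Qset theta x g ->
    \forall x' \near x, Qset theta x' g -> a x' g = a x g;
  ch_M : forall x g h, Qset theta x g -> Qset theta (uact theta x g) h ->
    a x (g * h)%g = (a x g * a (uact theta x g) h)%g
}.

Definition cocycle_equivalent (G H : groupType) (X Y : topologicalType)
    (theta : ore_action G X) (rho : ore_action H Y) :=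
  exists phi psi a b, cocycle_half theta rho phi psi a b /\
    cocycle_half rho theta psi phi b a.

Section TransformationGroupoidUnits.
Context (G : groupType) (X : topologicalType) (theta : ore_action G X).
Implicit Types z w : tg theta.

Lemma tg_rng_of z : tg_rng z = tg_of theta (tg_pt z) 1%g.
Proof.
apply: tg_ext; rewrite ?(tg_rngE z).1 ?(tg_rngE z).2 ?tg_of_pt // tg_of_gp //.
exact: Qset1.
Qed.

Lemma tg_src_of z :
  tg_src z = tg_of theta (uact theta (tg_pt z) (tg_gp z)) 1%g.
Proof.
apply: tg_ext; rewrite ?(tg_srcE z).1 ?(tg_srcE z).2 ?tg_of_pt // tg_of_gp //.
exact: Qset1.
Qed.

Lemma tg_mul_of z w : tg_src z = tg_rng w ->
  tg_mul z w = tg_of theta (tg_pt z) (tg_gp z * tg_gp w)%g.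
Proof.
move=> E; apply: tg_ext; rewrite ?(tg_mulE E).1 ?(tg_mulE E).2 ?tg_of_pt //.
rewrite tg_of_gp //; exact: (Qset_udef (tg_mulP E)).
Qed.

End TransformationGroupoidUnits.

Section IsomorphismToCocycle.
Variables (G H : groupType) (X Y : topologicalType).
Variables (theta : ore_action G X) (rho : ore_action H Y).

(** On the copy of the domain of [g], an open set of arrows, the group component
    of a continuous map is locally constant. *)
Lemma etale_isomorphism_half
    (F : transformation_groupoid theta -> transformation_groupoid rho)
    (F' : transformation_groupoid rho -> transformation_groupoid theta) :
  cancel F F' -> groupoid_morphism F -> groupoid_morphism F' -> continuous F ->
  cocycle_half theta rho
    (fun x => tg_pt (F (tg_of theta x 1%g))) (fun y => tg_pt (F' (tg_of rho y 1%g)))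
    (fun x g => tg_gp (F (tg_of theta x g))) (fun y h => tg_gp (F' (tg_of rho y h))).
Proof.
move=> FK mF mF' cF.
pose phi x := tg_pt (F (tg_of theta x 1%g)).
have Frng z : tg_rng (F z) = F (tg_rng z) := morphism_rng mF z.
have Fsrc z : tg_src (F z) = F (tg_src z) := morphism_src mF z.
have Fpt z : tg_pt (F z) = phi (tg_pt z).
  by rewrite -(tg_rngE (F z)).1 Frng tg_rng_of.
have Fsrc' z : phi (uact theta (tg_pt z) (tg_gp z)) = uact rho (tg_pt (F z)) (tg_gp (F z)).
  by rewrite -(tg_srcE (F z)).1 Fsrc tg_src_of.
have F1 x : tg_of rho (phi x) 1%g = F (tg_of theta x 1%g).
  have -> : tg_of theta x 1%g = tg_rng (tg_of theta x 1%g).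
    by rewrite tg_rng_of tg_of_pt.
  by rewrite -Frng tg_rng_of.
split.
- by move=> x /=; rewrite -/(phi x) F1 FK tg_of_pt.
- move=> x; apply: (@continuous_comp _ _ _ (fun x => F (tg_of theta x 1%g)) (@tg_pt _ _ _)).
    apply: (@continuous_comp _ _ _ (fun x => tg_of theta x 1%g) F); last exact: cF.
    apply: (@tg_of_continuous _ _ theta _ x id (fun=> 1%g)); first exact: cvg_id.
    by apply: nearW => x' ; split => //; exact: Qset1.
  exact: tg_pt_continuous.
- move=> x g Q; have := tgQ (F (tg_of theta x g)).
  by rewrite Fpt tg_of_pt.
- move=> x g Q; have := Fsrc' (tg_of theta x g).
  by rewrite Fpt tg_of_pt tg_of_gp.
- move=> x g Q /=.
  have -> : tg_of rho (tg_pt (F (tg_of theta x 1%g))) (tg_gp (F (tg_of theta x g))) = F (tg_of theta x g).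
    by rewrite -/(phi x) -[RHS]tg_ofK Fpt tg_of_pt.
  by rewrite FK tg_of_gp.
- move=> x g Q.
  have /cF : \forall w \near F (tg_of theta x g), tg_gp w = tg_gp (F (tg_of theta x g)).
    by apply/near_tg; apply: nearW => y w _ ->.
  move=> /near_tg; rewrite tg_of_pt; apply: filterS => x' Hx' Q'.
  by apply: Hx'; rewrite ?tg_of_pt ?tg_of_gp.
- move=> x g h Qg Qh.
  have E : gsrc (tg_of theta x g : transformation_groupoid theta) =
           grng (tg_of theta (uact theta x g) h : transformation_groupoid theta).
    by rewrite /= tg_src_of tg_rng_of !tg_of_pt tg_of_gp.
  have [E' M] := mF _ _ E.
  move: M; rewrite /= (tg_mul_of E) tg_of_pt !tg_of_gp // => ->.
  by rewrite (tg_mulE E').2.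
Qed.

End IsomorphismToCocycle.

Section CocycleToIsomorphism.
Variables (G H : groupType) (X Y : topologicalType).
Variables (theta : ore_action G X) (rho : ore_action H Y).
Variables (phi : X -> Y) (psi : Y -> X) (a : X -> G -> H) (b : Y -> H -> G).
Hypothesis half : cocycle_half theta rho phi psi a b.

Definition cocycle_map (z : tg theta) : tg rho :=
  tg_of rho (phi (tg_pt z)) (a (tg_pt z) (tg_gp z)).

Lemma cocycle_map_gp z : tg_gp (cocycle_map z) = a (tg_pt z) (tg_gp z).
Proof. by rewrite tg_of_gp //; apply: (ch_Q half); exact: tgQ. Qed.

Lemma cocycle_map_morphism :
  @groupoid_morphism (transformation_groupoid theta) (transformation_groupoid rho)
    cocycle_map.
Proof.
move=> z w E; have E' : tg_src (cocycle_map z) = tg_rng (cocycle_map w).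
  rewrite tg_src_of tg_rng_of !tg_of_pt cocycle_map_gp -(ch_u half); last exact: tgQ.
  by rewrite -(tg_composable E).
split => //=; rewrite (tg_mul_of E') !cocycle_map_gp tg_of_pt.
rewrite /cocycle_map (tg_mulE E).1 (tg_mulE E).2.
have Qw := tgQ w; have ptw := tg_composable E.
by rewrite (ch_M half) -?ptw //; exact: tgQ.
Qed.

Lemma cocycle_map_continuous : continuous cocycle_map.
Proof.
move=> z; apply: (@tg_of_continuous _ _ rho _ z (fun z => phi (tg_pt z))
  (fun z => a (tg_pt z) (tg_gp z))).
  apply: continuous_comp; first exact: tg_pt_continuous.
  exact: (ch_cont half).
apply/near_tg; apply: filterS (ch_near half (tgQ z)) => x' Hx' w wx wz.
split; last by apply: (ch_Q half); exact: tgQ.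
by rewrite wx wz Hx' // -wx -wz; exact: tgQ.
Qed.

Lemma cocycle_mapK : cancel cocycle_map
  (fun w => tg_of theta (psi (tg_pt w)) (b (tg_pt w) (tg_gp w))).
Proof.
move=> z; rewrite cocycle_map_gp /cocycle_map tg_of_pt (ch_can half).
by rewrite (ch_b half) ?tg_ofK //; exact: tgQ.
Qed.

End CocycleToIsomorphism.

Section CocycleConsequences.
Variables (G H : groupType) (X Y : topologicalType).
Variables (theta : ore_action G X) (rho : ore_action H Y).

Lemma cocycle_etale_isomorphic : cocycle_equivalent theta rho ->
  etale_isomorphic (transformation_groupoid theta) (transformation_groupoid rho).
Proof.
move=> [phi [psi [a [b [h1 h2]]]]].
exists (@cocycle_map _ _ _ _ theta rho phi a), (@cocycle_map _ _ _ _ rho theta psi b); split.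
- exact: (cocycle_mapK h1).
- exact: (cocycle_mapK h2).
- exact: (cocycle_map_morphism h1).
- exact: (cocycle_map_morphism h2).
- by split; [exact: (cocycle_map_continuous h1)|exact: (cocycle_map_continuous h2)].
Qed.

Lemma etale_isomorphic_cocycle :
  etale_isomorphic (transformation_groupoid theta) (transformation_groupoid rho) ->
  cocycle_equivalent theta rho.
Proof.
move=> [F [F' [FK FK' mF mF' [cF cF']]]].
exists (fun x => tg_pt (F (tg_of theta x 1%g))), (fun y => tg_pt (F' (tg_of rho y 1%g))),
  (fun x g => tg_gp (F (tg_of theta x g))), (fun y h => tg_gp (F' (tg_of rho y h))).
by split; exact: etale_isomorphism_half.
Qed.

Lemma cocycle_orbit_equivalent : cocycle_equivalent theta rho ->
  continuously_orbit_equivalent theta rho.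
Proof.
move=> [phi [psi [a [b [h1 h2]]]]].
exists phi, psi, (fun z => a (tg_pt z) (tg_gp z)), (fun w => b (tg_pt w) (tg_gp w)).
have ctn (G' H' : groupType) (X' Y' : topologicalType) (th : ore_action G' X')
    (rh : ore_action H' Y') ph ps c d : cocycle_half th rh ph ps c d ->
  continuous ((fun z => c (tg_pt z) (tg_gp z)) : tg th -> discrete_topology H').
  move=> h z V /nbhs_singleton Vz; apply/near_tg.
  apply: filterS (ch_near h (tgQ z)) => x' Hx' w wx wz.
  by rewrite /= wx wz Hx' // -wx -wz; exact: tgQ.
split.
- split; [exact: ch_can h1|exact: ch_can h2|exact: ch_cont h1|exact: ch_cont h2].
- by split; [exact: (ctn _ _ _ _ _ _ _ _ _ _ h1)|exact: (ctn _ _ _ _ _ _ _ _ _ _ h2)].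
- by move=> z; split; [apply: (ch_Q h1)|apply: (ch_u h1)]; exact: tgQ.
- by move=> z; split; [apply: (ch_Q h2)|apply: (ch_u h2)]; exact: tgQ.
Qed.

End CocycleConsequences.

(** What an orbit equivalence leaves when the continuity of the cocycle is
    expressed by local constancy, and no relation between the choices of the
    group elements is recorded. *)
Definition locally_covers (G H : groupType) (X Y : topologicalType)
    (theta : ore_action G X) (rho : ore_action H Y) (phi : X -> Y) :=
  forall x g, Qset theta x g -> exists h, \forall x' \near x,
    Qset rho (phi x') h /\ phi (uact theta x' g) = uact rho (phi x') h.

Definition local_orbit_equivalent (G H : groupType) (X Y : topologicalType)
    (theta : ore_action G X) (rho : ore_action H Y) :=
  exists (phi : X -> Y) (psi : Y -> X),
    [/\ cancel phi psi, cancel psi phi, continuous phi & continuous psi] /\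
    (locally_covers theta rho phi /\ locally_covers rho theta psi).

Section Rigidity.
Variables (G : groupType) (X : topologicalType) (theta : ore_action G X).

(** Two group elements that act in the same way near a point differ by an
    element that fixes an open set, hence a point with trivial isotropy. *)
Lemma topologically_free_uniq (x : X) g h : topologically_free theta ->
  (\forall x' \near x, [/\ Qset theta x' g, Qset theta x' h &
    uact theta x' g = uact theta x' h]) -> g = h.
Proof.
move=> tf; rewrite /prop_near1 nbhsE => -[U [oU Ux] UP].
have [y [Uy free]] := tf U (ex_intro _ x Ux) oU.
have [Qg Qh E] := UP _ Uy.
have Q : Qset theta y (g * h^-1)%g by apply: QsetM => //; rewrite E; exact: QsetV.
apply: contrapT => gh; apply: (free _ Q).
  by move=> gh1; apply: gh; rewrite -[LHS]mulg1 -(mulVg h) mulgA gh1 mul1g.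
by rewrite uactM // E ?uactK //; exact: QsetV.
Qed.

End Rigidity.

Section LocalToCocycle.
Variables (G H : groupType) (X Y : topologicalType).
Variables (theta : ore_action G X) (rho : ore_action H Y).

Definition covering_element (phi : X -> Y) (x : X) g : H :=
  xget 1%g [set h | \forall x' \near x,
    Qset rho (phi x') h /\ phi (uact theta x' g) = uact rho (phi x') h].

Lemma near_covering_element (phi : X -> Y) (x : X) g : locally_covers theta rho phi ->
  Qset theta x g -> \forall x' \near x,
    Qset rho (phi x') (covering_element phi x g) /\
    phi (uact theta x' g) = uact rho (phi x') (covering_element phi x g).
Proof. by move=> lc /lc[h Hh]; rewrite /covering_element; case: xgetP => [//|/(_ h)]. Qed.

End LocalToCocycle.

Section LocalToHalf.
Variables (G H : groupType) (X Y : topologicalType).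
Variables (theta : ore_action G X) (rho : ore_action H Y).
Variables (phi : X -> Y) (psi : Y -> X).
Hypotheses (cX : compact [set: X]) (hX : hausdorff_space X).
Hypothesis (oth : open_images theta).
Hypotheses (phiK : cancel phi psi) (psiK : cancel psi phi).
Hypotheses (cphi : continuous phi) (cpsi : continuous psi).
Hypotheses (lphi : locally_covers theta rho phi) (lpsi : locally_covers rho theta psi).
Hypotheses (tft : topologically_free theta) (tfr : topologically_free rho).

Lemma covering_element_uniq (x : X) g h : Qset theta x g ->
  (\forall x' \near x, Qset rho (phi x') h /\
     phi (uact theta x' g) = uact rho (phi x') h) ->
  covering_element theta rho phi x g = h.
Proof.
move=> Q Hh; have Hk := near_covering_element lphi Q.
apply: (@topologically_free_uniq _ _ rho (phi x)) => //.
have K (V : set X) : nbhs x V -> nbhs (phi x) (psi @^-1` V).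
  by rewrite -{1}(phiK x); exact: cpsi.
have Kk := K _ Hk; have Kh := K _ Hh.
apply: filterS2 Kk Kh => y /=; rewrite psiK => -[Q1 E1] [Q2 E2].
by split => //; rewrite -E1 -E2.
Qed.

(** Each identity compares two elements that act in the same way near the point:
    for the inverse, [g] and the element attached to the one attached to [g]; for
    the cocycle identity, the element attached to [g h] and the product. *)
Lemma local_cocycle_half : cocycle_half theta rho phi psi
  (covering_element theta rho phi) (covering_element rho theta psi).
Proof.
have near1 x g (Q : Qset theta x g) := near_covering_element lphi Q.
split => //.
- by move=> x g /near1/nbhs_singleton[].
- by move=> x g /near1/nbhs_singleton[].
- move=> x g Q; have [Q1 E1] := nbhs_singleton (near1 _ _ Q).
  apply: (@topologically_free_uniq _ _ theta x) => //.
  set k := covering_element theta rho phi x g in Q1 E1 *.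
  set g' := covering_element rho theta psi (phi x) k.
  have H2 : \forall x' \near x, Qset theta (psi (phi x')) g' /\
      psi (uact rho (phi x') k) = uact theta (psi (phi x')) g'.
    exact: (cphi (near_covering_element lpsi Q1)).
  have H3 := near1 _ _ Q; have H4 := near_pdom oth Q.
  apply: filterS3 H2 H3 H4 => x' [].
  by rewrite phiK => Q2 E2 [Q3 E3] Q4; split => //; rewrite -E2 -E3 phiK.
- move=> x g Q; have := near_join (near1 _ _ Q); apply: filterS => x' Hx' Q'.
  exact: covering_element_uniq.
- move=> x g h Qg Qh; apply: covering_element_uniq; first exact: QsetM.
  have cu := @uact_continuous _ _ theta cX hX oth g x.
  have H1 := near1 _ _ Qg; have H2 := near_pdom oth Qg.
  have H3 : nbhs x _ := cu _ (near1 _ _ Qh).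
  have H4 : nbhs x _ := cu _ (near_pdom oth Qh).
  have H12 : \forall x' \near x, (Qset rho (phi x') (covering_element theta rho phi x g) /\
     phi (uact theta x' g) = uact rho (phi x') (covering_element theta rho phi x g)) /\
      Qset theta x' g by apply: filterS2 H1 H2.
  apply: filterS3 H12 H3 H4 => x' /= [[Q1 E1] Q3] [].
  rewrite E1 => Q2 E2 Q4; split; first exact: QsetM.
  by rewrite (uactM Q3 Q4) E2 uactM.
Qed.

End LocalToHalf.

Section LocalEquivalence.
Variables (G H : groupType) (X Y : topologicalType).
Variables (theta : ore_action G X) (rho : ore_action H Y).
Hypotheses (cX : compact [set: X]) (hX : hausdorff_space X) (oth : open_images theta).
Hypotheses (cY : compact [set: Y]) (hY : hausdorff_space Y) (orh : open_images rho).

Lemma local_orbit_equivalent_cocycle :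
  topologically_free theta -> topologically_free rho ->
  local_orbit_equivalent theta rho -> cocycle_equivalent theta rho.
Proof.
move=> tft tfr [phi [psi [[phiK psiK cphi cpsi] [lphi lpsi]]]].
exists phi, psi, (covering_element theta rho phi), (covering_element rho theta psi).
by split; apply: local_cocycle_half.
Qed.

Lemma orbit_equivalent_local : continuously_orbit_equivalent theta rho ->
  local_orbit_equivalent theta rho.
Proof.
move=> [phi [psi [a [b [[phiK psiK cphi cpsi] [ca cb] Ha Hb]]]]].
have lc (G' H' : groupType) (X' Y' : topologicalType) (th : ore_action G' X')
    (rh : ore_action H' Y') (ph : X' -> Y') (c : tg th -> discrete_topology H') :
    open_images th -> continuous c ->
    (forall z, Qset rh (ph (tg_pt z)) (c z) /\
      ph (uact th (tg_pt z) (tg_gp z)) = uact rh (ph (tg_pt z)) (c z)) ->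
    locally_covers th rh ph.
  move=> oth' cc Hc x g Q; exists (c (tg_of th x g)).
  have /cc : \forall h \near (c (tg_of th x g) : discrete_topology H'), h = c (tg_of th x g).
    exact: discrete_set1.
  move=> /near_tg; rewrite tg_of_pt tg_of_gp // => Hn.
  apply: filterS2 (near_pdom oth' Q) Hn => x' Q' Hx'.
  have [] := Hc (tg_of th x' g); rewrite Hx' ?tg_of_pt ?tg_of_gp //.
by exists phi, psi; split => //; split; [apply: (lc _ _ _ _ _ _ _ a)|apply: (lc _ _ _ _ _ _ _ b)].
Qed.

End LocalEquivalence.

(** * Characters of algebras of continuous functions *)

Section ComplexContinuity.
Context (R : realType) (X : topologicalType).
Implicit Types f g : X -> Cplx R.

Lemma continuous_cmodP f : continuous f <->
  forall x (e : R), 0 < e -> \forall x' \near x, cmod (f x - f x') < e.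
Proof.
by split=> H x; [apply/cvg_cmodP; exact: H|apply/cvg_cmodP => e; exact: H].
Qed.

Lemma continuous_near f : (forall x, \forall x' \near x, f x' = f x) -> continuous f.
Proof.
move=> H; apply/continuous_cmodP => x e e0.
by apply: filterS (H x) => x' ->; rewrite subrr cmod0.
Qed.

Lemma continuous_cplx_cst (z : Cplx R) : continuous (fun _ : X => z).
Proof. by apply: continuous_near => x; exact: nearW. Qed.

Lemma continuous_add f g : continuous f -> continuous g ->
  continuous (fun x => f x + g x).
Proof.
move=> /continuous_cmodP cf /continuous_cmodP cg; apply/continuous_cmodP => x e e0.
have e2 : 0 < e / 2 by rewrite divr_gt0.
apply: filterS2 (cf x _ e2) (cg x _ e2) => x' h1 h2.
by rewrite opprD addrACA; apply: le_lt_trans (cmodD _ _) _; lra.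
Qed.

Lemma continuous_mul f g : continuous f -> continuous g ->
  continuous (fun x => f x * g x).
Proof.
move=> /continuous_cmodP cf /continuous_cmodP cg; apply/continuous_cmodP => x e e0.
pose K := 1 + cmod (f x) + cmod (g x).
have f0 := cmod_ge0 (f x); have g0 := cmod_ge0 (g x).
have K0 : 0 < K by rewrite /K; lra.
pose d := Num.min 1 (e / (2 * K)).
have d0 : 0 < d by rewrite lt_min ltr01 divr_gt0 // mulr_gt0.
apply: filterS2 (cf x _ d0) (cg x _ d0) => x' h1 h2.
have -> : f x * g x - f x' * g x' =
  (f x - f x') * g x + (f x * (g x - g x') + - ((f x - f x') * (g x - g x'))).
  by ring.
apply: le_lt_trans (cmodD _ _) _; rewrite cmodM.
apply: (@le_lt_trans _ _ (cmod (f x - f x') * cmod (g x) +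
  (cmod (f x) * cmod (g x - g x') + cmod (f x - f x') * cmod (g x - g x')))).
  rewrite lerD2l; apply: le_trans (cmodD _ _) _; rewrite !cmodM lerD2l.
  by rewrite -cmodM -[- _]add0r cmodB subr0.
have d1 : d <= 1 by rewrite ge_min lexx.
have : d <= e / (2 * K) by rewrite ge_min lexx orbT.
rewrite ler_pdivlMr ?mulr_gt0 // => d2.
have u0 := cmod_ge0 (f x - f x'); have v0 := cmod_ge0 (g x - g x').
have k1 := ler_wpM2r g0 (ltW h1); have k2 := ler_wpM2l f0 (ltW h2).
have k3 := ler_pM u0 v0 (ltW h1) (le_trans (ltW h2) d1).
move: d2; rewrite /K; lra.
Qed.

Lemma continuous_scale (c : Cplx R) f : continuous f -> continuous (fun x => c * f x).
Proof. by move=> cf; exact (continuous_mul (@continuous_cplx_cst c) cf). Qed.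

Lemma continuous_conj f : continuous f -> continuous (fun x => (f x)^*).
Proof.
move=> /continuous_cmodP cf; apply/continuous_cmodP => x e e0.
by apply: filterS (cf x _ e0) => x'; rewrite -rmorphB /= cmod_conj.
Qed.

Lemma continuous_real (q : X -> R) : continuous q ->
  continuous (fun x => (q x)%:C%C : Cplx R).
Proof.
move=> cq; apply/continuous_cmodP => x e e0.
have /cvgrPdist_lt/(_ e e0) := cq x.
apply: filterS => x'; congr (_ < _).
by rewrite -rmorphB /cmod /= expr0n addr0 sqrtr_sqr.
Qed.

Lemma continuous_cmod2 f : continuous f -> continuous (fun x => cmod (f x) ^+ 2).
Proof.
move=> cf x; have H : {for x, continuous (fun x => cmod (f x))}.
  by apply: continuous_comp; [exact: cf|exact: cmod_continuous].
exact: (cvgM H H).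
Qed.

End ComplexContinuity.

Section Characters.
Context (R : realType) (X : topologicalType).
Context (cX : compact [set: X]) (hX : hausdorff_space X).

Lemma urysohn_point (x : X) (U : set X) : nbhs x U ->
  exists f : X -> Cplx R, [/\ continuous f, f x = 1 & forall x', ~ U x' -> f x' = 0].
Proof.
rewrite nbhsE => -[W [oW Wx] WU].
have sep : uniform_separator (~` W) [set x].
  apply: normal_uniform_separator; first exact: compact_normal.
  - exact: open_closedC.
  - apply: accessible_closed_set1; exact: hausdorff_accessible.
  - by apply/seteqP; split => // y [/= nW yx]; apply: nW; rewrite yx.
exists (fun x' => (Urysohn (R := R) (~` W) [set x] x')%:C%C); split.
- by apply: continuous_real; exact: Urysohn_continuous.
- have -> // : Urysohn (R := R) (~` W) [set x] x = 1.
  by apply: (Urysohn_sub1 sep); exists x.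
- move=> x' nU; have -> // : Urysohn (R := R) (~` W) [set x] x' = 0.
  by apply: (Urysohn_sub0 sep); exists x' => //= Wx'; apply: nU; exact: WU.
Qed.

Lemma continuous_separate (x y : X) :
  (forall f : X -> Cplx R, continuous f -> f x = f y) -> x = y.
Proof.
move=> H; apply: contrapT => xy; have : nbhs x (~` [set y]).
  apply: open_nbhs_nbhs; split => //; apply: closed_openC.
  by apply: accessible_closed_set1; exact: hausdorff_accessible.
move=> /urysohn_point[f [cf fx fy]]; have := H f cf.
by rewrite fx fy; [move/eqP; rewrite oner_eq0|apply].
Qed.

(** If no point evaluation agrees with [chi], then the kernel of [chi] contains
    nonnegative functions that do not vanish at any given point.  Their sums
    are directed upwards, so that by compactness one of them is positive
    everywhere, hence invertible. *)
Lemma character_eval (chi : (X -> Cplx R) -> Cplx R) :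
  (forall f g : X -> Cplx R, continuous f -> continuous g ->
     chi (fun x => f x + g x) = chi f + chi g) ->
  (forall f g : X -> Cplx R, continuous f -> continuous g ->
     chi (fun x => f x * g x) = chi f * chi g) ->
  (forall c, chi (fun=> c) = c) ->
  exists x, forall f : X -> Cplx R, continuous f -> chi f = f x.
Proof.
move=> chiD chiM chi1; apply: contrapT => none.
pose I := [set q : X -> R | [/\ continuous q, forall x, 0 <= q x &
  chi (fun x => (q x)%:C%C) = 0]].
have ID p q : I p -> I q -> I (fun x => p x + q x).
  move=> [cp p0 kp] [cq q0 kq]; split.
  - by move=> x; apply: cvgD; [exact: cp|exact: cq].
  - by move=> x; rewrite addr_ge0.
  - have := chiD _ _ (continuous_real cp) (continuous_real cq).
    rewrite kp kq addr0 => <-; congr chi; apply/funext => x.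
    by rewrite rmorphD.
have pos x : exists2 q, I q & 0 < q x.
  have [f [cf fx]] : exists f : X -> Cplx R, continuous f /\ chi f <> f x.
    apply: contrapT => H; apply: none; exists x => f cf.
    by apply: contrapT => fx; apply: H; exists f.
  pose g y := f y + - chi f.
  have cg : continuous g by exact (continuous_add cf (@continuous_cplx_cst _ _ _)).
  have kg : chi g = 0.
    by rewrite (chiD _ _ cf (@continuous_cplx_cst _ _ _)) chi1 subrr.
  exists (fun y => cmod (g y) ^+ 2).
    split; [exact: continuous_cmod2|by move=> y; exact: sqr_ge0|].
    have := chiM _ _ (continuous_conj cg) cg; rewrite kg mulr0 => <-.
    by congr chi; apply/funext => y; rewrite conjM_cmod.
  rewrite lt_neqAle sqr_ge0 andbT eq_sym; apply/eqP => /eqP.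
  by rewrite sqrf_eq0 => /eqP/cmod_eq0/eqP; rewrite subr_eq0 => /eqP/esym.
have I0 : I (fun=> 0).
  by split; [exact: cst_continuous|move=> x|exact: chi1].
pose F := filter_from I (fun q => [set p | I p /\ forall x, q x <= p x]).
have FF : Filter F.
  apply: filter_from_filter; first by exists (fun=> 0).
  move=> p q Ip Iq; exists (fun x => p x + q x); first exact: ID.
  move=> r [Ir rpq]; have [_ p0 _] := Ip; have [_ q0 _] := Iq.
  by split; split => // x; apply: le_trans (rpq x); rewrite ?lerDl ?lerDr.
have /compact_near_coveringP cov := cX.
have [|q0 Iq0 /(_ q0)] := cov _ F (fun p x => 0 < p x) FF.
  move=> x _; have [q Iq qx] := pos x.
  exists ([set x' | 0 < q x'], [set p | I p /\ forall x, q x <= p x]) => /=.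
    split; last by exists q.
    have [cq _ _] := Iq; have := cq x; move=> /cvgr_gt; exact.
  by move=> [y p] /= [qy [_ qp]]; exact: lt_le_trans (qp y).
move=> H; have qpos x : 0 < q0 x by apply: H.
have [cq _ kq] := Iq0.
have cqV : continuous (fun x => (q0 x)^-1).
  by move=> x; apply: cvgV; [rewrite gt_eqF|exact: cq].
have := chiM _ _ (continuous_real cq) (continuous_real cqV).
rewrite kq mul0r (_ : (fun x => _) = fun=> 1).
  by rewrite chi1 => /eqP; rewrite oner_eq0.
apply/funext => x; rewrite -rmorphM /= mulfV ?gt_eqF //.
Qed.

End Characters.

Section AlgebraMaps.
Context (R : realType) (X Y : topologicalType).
Context (cX : compact [set: X]) (hX : hausdorff_space X).

(** [E f c] reads: [c] is the image of [f].  A relation is convenient because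
    its converse has the same form. *)
Record algebra_relation (E : (X -> Cplx R) -> (Y -> Cplx R) -> Prop) : Prop :=
  AlgebraRelation {
  ar_continuous : forall f c, E f c -> continuous f /\ continuous c;
  ar_total : forall f : X -> Cplx R, continuous f -> exists c, E f c;
  ar_functional : forall f c d, E f c -> E f d -> c = d;
  ar_add : forall f g c d, E f c -> E g d ->
    E (fun x => f x + g x) (fun y => c y + d y);
  ar_mul : forall f g c d, E f c -> E g d ->
    E (fun x => f x * g x) (fun y => c y * d y);
  ar_cst : forall z : Cplx R, E (fun=> z) (fun=> z)
}.

(** The images at a point [y] form a character, which is the evaluation at the
    point [psi y].  Functions that separate a point from a closed set show that
    [psi] is continuous. *)
Lemma algebra_relation_map E : algebra_relation E ->
  exists2 psi : Y -> X, continuous psi & forall f c, E f c -> forall y, c y = f (psi y).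
Proof.
move=> ar.
have /choice[psi Hpsi] : forall y, exists x, forall f c, E f c -> c y = f x.
  move=> y; pose chi f := xget (fun=> 0) (E f) y.
  have chiE f c : E f c -> chi f = c y.
    move=> Ef; rewrite /chi; case: xgetP => [d _ Ed|/(_ c) //].
    by rewrite (ar_functional ar Ef Ed).
  have [||z|x Hx] := @character_eval R X cX chi.
  - move=> f g /(ar_total ar)[c Ec] /(ar_total ar)[d Ed].
    by rewrite (chiE _ _ Ec) (chiE _ _ Ed) (chiE _ _ (ar_add ar Ec Ed)).
  - move=> f g /(ar_total ar)[c Ec] /(ar_total ar)[d Ed].
    by rewrite (chiE _ _ Ec) (chiE _ _ Ed) (chiE _ _ (ar_mul ar Ec Ed)).
  - by rewrite (chiE _ _ (ar_cst ar z)).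
  - by exists x => f c Ec; rewrite -(chiE _ _ Ec) Hx //; exact: (ar_continuous ar Ec).1.
exists psi; last by move=> f c Ec y; exact: Hpsi.
move=> y V /(urysohn_point R cX hX)[f [cf fy fV]].
have [c Ec] := ar_total ar cf.
have cy : c y = 1 by rewrite (Hpsi _ _ _ Ec).
have /continuous_cmodP/(_ y 1 ltr01) := (ar_continuous ar Ec).2.
apply: filterS => y' /=; rewrite cy (Hpsi _ _ _ Ec) => H.
apply: contrapT => nV; by move: H; rewrite fV // subr0 cmod1 ltxx.
Qed.

End AlgebraMaps.

(** * Recovering the action from its algebra and the diagonal *)

Section HatAction.
Context (R : realType) (G : groupType) (X : topologicalType).
Context (theta : ore_action G X).
Implicit Types f : X -> Cplx R.

Lemma hat_actionE g f x : Qset theta x g -> hat_action theta g f x = f (uact theta x g).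
Proof. by move=> Q; rewrite /hat_action ifT //; exact/mem_set. Qed.

Lemma hat_action_out g f x : ~ Qset theta x g -> hat_action theta g f x = 0.
Proof. by move=> Q; rewrite /hat_action ifF //; apply/negP => /set_mem. Qed.

Lemma hat_action1 f x : hat_action theta 1%g f x = f x.
Proof. by rewrite hat_actionE ?uact1 //; exact: Qset1. Qed.

(** The domain of [g] is clopen, so that the extension by zero is continuous. *)
Lemma continuous_hat_action (cX : compact [set: X]) (hX : hausdorff_space X)
  (oth : open_images theta) g f :
  continuous f -> continuous (hat_action theta g f).
Proof.
move=> /continuous_cmodP cf; apply/continuous_cmodP => x e e0.
have [Q|nQ] := pselect (Qset theta x g).
  have H := near_pdom oth Q.
  have K := uact_continuous cX hX oth (cf (uact theta x g) e e0).
  by apply: filterS2 H K => x' Q' /=; rewrite !hat_actionE.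
have H := near_npdom cX hX nQ; apply: filterS H => x' nQ'.
by rewrite !hat_action_out // subrr cmod0.
Qed.

End HatAction.

(** The data shared by the groupoid algebra and the crossed product: [D] embeds
    the functions on the unit space as the diagonal [Dg], [N g] is the partial
    isometry implementing the partial homeomorphism of [g].  The last field is
    the only one that looks inside of the operators: where [S \o T] is a nonzero
    function, some coefficient of [T] is nonzero, and it stays nonzero nearby;
    an intertwining relation between functions can then be read on the partial
    homeomorphism of the group element of that coefficient. *)
Record diagonal_model (R : realType) (G : groupType) (X : topologicalType)
    (theta : ore_action G X) (V : hilbert_module R) (A Dg : set (V -> V))
    (D : (X -> Cplx R) -> V -> V) (N : G -> V -> V) : Prop := DiagonalModel {
  dm_diag : Dg = [set D f | f in [set f : X -> Cplx R | continuous f]];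
  dm_D : forall f : X -> Cplx R, continuous f -> A (D f);
  dm_add : forall f g : X -> Cplx R, continuous f -> continuous g ->
    D (fun x => f x + g x) = D f + D g;
  dm_mul : forall f g : X -> Cplx R, continuous f -> continuous g ->
    D (fun x => f x * g x) = D f \o D g;
  dm_scale : forall (c : Cplx R) (f : X -> Cplx R), continuous f ->
    D (fun x => c * f x) = c *: D f;
  dm_inj : forall f g : X -> Cplx R, continuous f -> continuous g ->
    D f = D g -> f = g;
  dm_comp : forall S T, A S -> A T -> A (S \o T);
  dm_N : forall g, A (N g);
  dm_NN : forall g, N g^-1%g \o N g = D (hat_action theta g^-1%g (fun=> 1));
  dm_ND : forall g (f : X -> Cplx R), continuous f ->
    N g \o D f = D (hat_action theta g f) \o N g;
  dm_slice : forall S T (p : X -> Cplx R) x, A T -> A S -> S \o T = D p ->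
    continuous p -> p x <> 0 ->
    exists k, \forall x' \near x, Qset theta x' k /\
      forall c c' : X -> Cplx R, continuous c -> continuous c' ->
        T \o D c = D c' \o T -> c x' = c' (uact theta x' k)
}.

Lemma dm_Dg (R : realType) (G : groupType) (X : topologicalType)
    (theta : ore_action G X) (V : hilbert_module R) (A Dg : set (V -> V))
    (D : (X -> Cplx R) -> V -> V) (N : G -> V -> V) :
  diagonal_model theta A Dg D N ->
  forall f : X -> Cplx R, continuous f -> Dg (D f).
Proof. by move=> m f cf; rewrite (dm_diag m); exists f. Qed.

(** The algebraic side of an isomorphism of C*-algebras, which passes to the
    inverse map by injectivity. *)
Record diagonal_iso (R : realType) (V W : hilbert_module R) (A Dg : set (V -> V))
    (B Eg : set (W -> W)) (Phi : (V -> V) -> (W -> W)) : Prop := DiagonalIso {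
  di_bij : set_bij A B Phi;
  di_diag : Phi @` Dg = Eg;
  di_D : forall S T, Dg S -> Dg T -> Phi (S + T) = Phi S + Phi T;
  di_Z : forall (c : Cplx R) S, Dg S -> Phi (c *: S) = c *: Phi S;
  di_M : forall S T, A S -> A T -> Phi (S \o T) = Phi S \o Phi T
}.

Section DiagonalRelation.
Variables (R : realType) (G H : groupType) (X Y : topologicalType).
Variables (theta : ore_action G X) (rho : ore_action H Y).
Variables (V W : hilbert_module R) (A Dg : set (V -> V)) (B Eg : set (W -> W)).
Variables (D : (X -> Cplx R) -> V -> V) (N : G -> V -> V).
Variables (E : (Y -> Cplx R) -> W -> W) (M : H -> W -> W).
Hypotheses (mA : diagonal_model theta A Dg D N) (mB : diagonal_model rho B Eg E M).
Variable Phi : (V -> V) -> (W -> W).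
Hypothesis isoPhi : diagonal_iso A Dg B Eg Phi.

Definition diag_rel (f : X -> Cplx R) (c : Y -> Cplx R) :=
  [/\ continuous f, continuous c & Phi (D f) = E c].

Lemma iso_inj S T : A S -> A T -> Phi S = Phi T -> S = T.
Proof.
have [_ inj _] := di_bij isoPhi.
by move=> AS AT; apply: inj; exact/mem_set.
Qed.

Lemma iso_mem T : A T -> B (Phi T).
Proof. by have [f _ _] := di_bij isoPhi; exact: f. Qed.

Lemma iso_surj S : B S -> exists2 T, A T & Phi T = S.
Proof. by have [_ _ sur] := di_bij isoPhi; move=> /sur[T AT <-]; exists T. Qed.

Lemma diag_rel_total f : continuous f -> exists c, diag_rel f c.
Proof.
move=> cf; have : Eg (Phi (D f)).
  by rewrite -(di_diag isoPhi); exists (D f) => //; rewrite (dm_diag mA); exists f.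
by rewrite (dm_diag mB) => -[c cc Ec]; exists c.
Qed.

Lemma diag_rel_surj c : continuous c -> exists f, diag_rel f c.
Proof.
move=> cc; have : Eg (E c) by rewrite (dm_diag mB); exists c.
by rewrite -(di_diag isoPhi) (dm_diag mA) => -[_ [f cf <-] Ec]; exists f.
Qed.

Lemma diag_rel_functional f c d : diag_rel f c -> diag_rel f d -> c = d.
Proof.
move=> [_ cc E1] [_ cd E2]; apply: (dm_inj mB) => //.
by rewrite -E1 E2.
Qed.

Lemma diag_rel_injective f g c : diag_rel f c -> diag_rel g c -> f = g.
Proof.
move=> [cf _ E1] [cg _ E2]; apply: (dm_inj mA) => //.
by apply: iso_inj; rewrite ?E1 ?E2 //; exact: (dm_D mA).
Qed.

Lemma diag_rel_add f g c d : diag_rel f c -> diag_rel g d ->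
  diag_rel (fun x => f x + g x) (fun y => c y + d y).
Proof.
move=> [cf cc E1] [cg cd E2]; split; [exact: continuous_add|exact: continuous_add|].
rewrite (dm_add mA) // (dm_add mB) // (di_D isoPhi) ?E1 ?E2 //; exact: (dm_Dg mA).
Qed.

Lemma diag_rel_mul f g c d : diag_rel f c -> diag_rel g d ->
  diag_rel (fun x => f x * g x) (fun y => c y * d y).
Proof.
move=> [cf cc E1] [cg cd E2]; split; [exact: continuous_mul|exact: continuous_mul|].
rewrite (dm_mul mA) // (dm_mul mB) // (di_M isoPhi) ?E1 ?E2 //; exact: (dm_D mA).
Qed.

(** The constant 1 goes to a unit of the image algebra, which contains 1. *)
Lemma diag_rel_cst z : diag_rel (fun=> z) (fun=> z).
Proof.
have c1 := @continuous_cplx_cst R X 1; have d1 := @continuous_cplx_cst R Y 1.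
have [e He] := diag_rel_surj d1.
have [c Hc] := diag_rel_total c1.
have H1 : diag_rel (fun=> 1) (fun=> 1).
  have := diag_rel_mul Hc He.
  have -> : (fun x => 1 * e x) = e by apply/funext => x; rewrite mul1r.
  have -> : (fun y => c y * 1) = c by apply/funext => y; rewrite mulr1.
  by move=> /(diag_rel_functional He) E1; rewrite -E1 in Hc.
have [_ _ E1] := H1; split; [exact: continuous_cplx_cst|exact: continuous_cplx_cst|].
have -> : (fun=> z) = (fun x : X => z * 1) by apply/funext => x; rewrite mulr1.
have -> : (fun=> z) = (fun y : Y => z * 1) by apply/funext => x; rewrite mulr1.
rewrite (dm_scale mA z c1) (dm_scale mB z d1) (di_Z isoPhi) ?E1 //.
exact: (dm_Dg mA c1).
Qed.

Lemma diag_rel_algebra : algebra_relation diag_rel.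
Proof.
split.
- by move=> f c [].
- exact: diag_rel_total.
- exact: diag_rel_functional.
- exact: diag_rel_add.
- exact: diag_rel_mul.
- exact: diag_rel_cst.
Qed.

Lemma diag_rel_algebraV : algebra_relation (fun c f => diag_rel f c).
Proof.
split.
- by move=> c f [].
- exact: diag_rel_surj.
- by move=> c f g; exact: diag_rel_injective.
- by move=> c d f g; exact: diag_rel_add.
- by move=> c d f g; exact: diag_rel_mul.
- exact: diag_rel_cst.
Qed.

Context (cX : compact [set: X]) (hX : hausdorff_space X) (oth : open_images theta).
Context (cY : compact [set: Y]) (hY : hausdorff_space Y) (orh : open_images rho).

Lemma diag_homeomorphism : exists (phi : X -> Y) (psi : Y -> X),
  [/\ cancel phi psi, cancel psi phi, continuous phi & continuous psi] /\
  forall f c, diag_rel f c ->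
    (forall y, c y = f (psi y)) /\ (forall x, f x = c (phi x)).
Proof.
have [psi cpsi Hpsi] := algebra_relation_map cX hX diag_rel_algebra.
have [phi cphi Hphi] := algebra_relation_map cY hY diag_rel_algebraV.
exists phi, psi; split; last by move=> f c H1; split; [exact: Hpsi|exact: Hphi].
split => //.
- move=> x; apply: (@continuous_separate R _ cX hX) => f /diag_rel_total[c fc].
  by rewrite -(Hpsi _ _ fc) -(Hphi _ _ fc).
- move=> y; apply: (@continuous_separate R _ cY hY) => c /diag_rel_surj[f fc].
  by rewrite -(Hphi _ _ fc) -(Hpsi _ _ fc).
Qed.

(** Slicing the image of the partial isometry of [g^-1], which intertwines the
    functions on [Y] along the transported partial homeomorphism of [g]. *)
Lemma diag_locally_covers (phi : X -> Y) (psi : Y -> X) :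
  cancel phi psi -> cancel psi phi -> continuous phi ->
  (forall f c, diag_rel f c ->
    (forall y, c y = f (psi y)) /\ (forall x, f x = c (phi x))) ->
  locally_covers theta rho phi.
Proof.
move=> phiK psiK cphi Hrel x g Q.
have hc h (f : X -> Cplx R) : continuous f -> continuous (hat_action theta h f).
  exact: continuous_hat_action.
have c1 := @continuous_cplx_cst R X 1.
have AN h := dm_N mA h.
have [p Hp] := diag_rel_total (hc g _ c1).
have [_ cp Ep] := Hp.
have STp : Phi (N g) \o Phi (N g^-1%g) = E p.
  by rewrite -(di_M isoPhi) // -Ep -{1}(invgK g) (dm_NN mA) invgK.
have px : p (phi x) <> 0.
  rewrite (Hrel _ _ Hp).1 phiK hat_actionE //; apply/eqP; exact: oner_neq0.
have [k Hk] := dm_slice mB (iso_mem (AN g^-1%g)) (iso_mem (AN g)) STp cp px.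
exists k; have Hk' := cphi _ _ Hk; apply: filterS2 (near_pdom oth Q) Hk' => x' Q' [Qk HT].
split => //.
(* The intertwining relation of [T] with [f], read by the slice. *)
have key (f : X -> Cplx R) : continuous f -> f x' = hat_action theta g^-1%g f (psi (uact rho (phi x') k)).
  move=> cf; have [c fc] := diag_rel_total cf.
  have [c' fc'] := diag_rel_total (hc g^-1%g _ cf).
  have [_ cc Ec] := fc; have [_ cc' Ec'] := fc'.
  have AD (h : X -> Cplx R) : continuous h -> A (D h) by exact: (dm_D mA).
  have K1 : Phi (N g^-1%g) \o E c = E c' \o Phi (N g^-1%g).
    have M1 := di_M isoPhi (AN g^-1%g) (AD _ cf).
    have M2 := di_M isoPhi (AD _ (hc g^-1%g _ cf)) (AN g^-1%g).
    by rewrite -Ec -Ec' -M1 -M2 (dm_ND mA).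
  have [E1 _] := Hrel _ _ fc'; have [_ E2] := Hrel _ _ fc.
  by rewrite -E1 E2; exact: (HT c c' cc cc' K1).
(* The constant function 1 locates the point in the domain of [g^-1]. *)
have Qw : Qset theta (psi (uact rho (phi x') k)) g^-1%g.
  apply: contrapT => nQ; have := key _ c1; rewrite hat_action_out //.
  by move/eqP; rewrite oner_eq0.
have xw : x' = uact theta (psi (uact rho (phi x') k)) g^-1%g.
  apply: (@continuous_separate R _ cX hX) => f cf.
  by rewrite (key f cf) hat_actionE.
rewrite {1}xw -{2}(invgK g) uactK // psiK.
Qed.

End DiagonalRelation.

Section Reconstruction.
Variables (R : realType) (G H : groupType) (X Y : topologicalType).
Variables (theta : ore_action G X) (rho : ore_action H Y).
Variables (V W : hilbert_module R) (A Dg : set (V -> V)) (B Eg : set (W -> W)).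
Variables (D : (X -> Cplx R) -> V -> V) (N : G -> V -> V).
Variables (E : (Y -> Cplx R) -> W -> W) (M : H -> W -> W).
Hypotheses (mA : diagonal_model theta A Dg D N) (mB : diagonal_model rho B Eg E M).
Context (cX : compact [set: X]) (hX : hausdorff_space X) (oth : open_images theta).
Context (cY : compact [set: Y]) (hY : hausdorff_space Y) (orh : open_images rho).

Lemma cstar_diagonal_iso Phi : cstar_isomorphism A B Phi -> Phi @` Dg = Eg ->
  diagonal_iso A Dg B Eg Phi.
Proof.
move=> iP dP; have sub T : Dg T -> A T.
  by rewrite (dm_diag mA) => -[f cf <-]; exact: (dm_D mA).
split => //; first exact: (ciso_bij iP).
- by move=> S T /sub AS /sub AT; exact: (cisoD iP).
- by move=> c S /sub AS; exact: (cisoZ iP).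
- exact: (cisoM iP).
Qed.

Lemma diagonal_iso_inverse Phi : diagonal_iso A Dg B Eg Phi ->
  exists Psi, diagonal_iso B Eg A Dg Psi /\
    (forall T, A T -> Psi (Phi T) = T) /\ (forall S, B S -> Phi (Psi S) = S).
Proof.
move=> iP.
have /choice[Psi PsiP] : forall S : W -> W, exists T : V -> V,
    B S -> A T /\ Phi T = S.
  move=> S; have [/(iso_surj iP)[T AT PT]|nB] := pselect (B S); first by exists T.
  by exists id.
have subA T : Dg T -> A T.
  by rewrite (dm_diag mA) => -[f cf <-]; exact: (dm_D mA).
have subB T : Eg T -> B T.
  by rewrite (dm_diag mB) => -[f cf <-]; exact: (dm_D mB).
have PsiE T S : A T -> Phi T = S -> Psi S = T.
  move=> AT PT; have BS : B S by rewrite -PT; exact: (iso_mem iP).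
  have [AP PP] := PsiP _ BS; apply: (iso_inj iP) => //; by rewrite PP.
have PsiD S : Eg S -> Dg (Psi S).
  rewrite -(di_diag iP) => -[T DT PT]; by rewrite (PsiE T) //; exact: subA.
have DD S T : Dg S -> Dg T -> Dg (S + T).
  rewrite (dm_diag mA) => -[f cf <-] [g cg <-].
  rewrite -(dm_add mA cf cg) -(dm_diag mA).
  exact: (dm_Dg mA (continuous_add cf cg)).
have DZ (c : Cplx R) S : Dg S -> Dg (c *: S).
  rewrite (dm_diag mA) => -[f cf <-].
  rewrite -(dm_scale mA c cf) -(dm_diag mA).
  exact: (dm_Dg mA (continuous_scale cf)).
exists Psi; split; last by split; [move=> T AT; exact: PsiE|move=> S /PsiP[]].
split.
- split.
  + by move=> S /PsiP[].
  + move=> S T /set_mem/PsiP[_ E1] /set_mem/PsiP[_ E2] E12.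
    by rewrite -E1 -E2 E12.
  + by move=> T AT; exists (Phi T); [exact: (iso_mem iP)|exact: PsiE].
- apply/seteqP; split => [_ [S ES <-]|T DT]; first exact: PsiD.
  exists (Phi T); first by rewrite -(di_diag iP); exists T.
  by apply: PsiE => //; exact: subA.
- move=> S T ES ET; have [AS PS] := PsiP _ (subB _ ES).
  have [AT PT] := PsiP _ (subB _ ET).
  apply: PsiE; first by apply/subA/DD; exact: PsiD.
  by rewrite (di_D iP) ?PS ?PT //; exact: PsiD.
- move=> c S ES; have [AS PS] := PsiP _ (subB _ ES).
  apply: PsiE; first by apply/subA/DZ; exact: PsiD.
  by rewrite (di_Z iP) ?PS //; exact: PsiD.
- move=> S T BS BT; have [AS PS] := PsiP _ BS; have [AT PT] := PsiP _ BT.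
  apply: PsiE; first exact: (dm_comp mA).
  by rewrite (di_M iP) // PS PT.
Qed.

End Reconstruction.

Section ReconstructionTheorem.
Variables (R : realType) (G H : groupType) (X Y : topologicalType).
Variables (theta : ore_action G X) (rho : ore_action H Y).
Variables (V W : hilbert_module R) (A Dg : set (V -> V)) (B Eg : set (W -> W)).
Variables (D : (X -> Cplx R) -> V -> V) (N : G -> V -> V).
Variables (E : (Y -> Cplx R) -> W -> W) (M : H -> W -> W).
Hypotheses (mA : diagonal_model theta A Dg D N) (mB : diagonal_model rho B Eg E M).
Context (cX : compact [set: X]) (hX : hausdorff_space X) (oth : open_images theta).
Context (cY : compact [set: Y]) (hY : hausdorff_space Y) (orh : open_images rho).

Lemma isomorphism_local_orbit_equivalent :
  (exists Phi, cstar_isomorphism A B Phi /\ Phi @` Dg = Eg) ->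
  local_orbit_equivalent theta rho.
Proof.
move=> [Phi [iP dP]]; have dI := cstar_diagonal_iso mA iP dP.
have [Psi [dI' [PhiK PsiK]]] := diagonal_iso_inverse mA mB dI.
have [phi [psi [[phiK psiK cphi cpsi] Hrel]]] := diag_homeomorphism mA mB dI cX hX cY hY.
exists phi, psi; split => //; split.
  exact: (diag_locally_covers mA mB dI cX hX oth phiK psiK cphi Hrel).
apply: (diag_locally_covers mB mA dI' cY hY orh psiK phiK cpsi) => c f [cc cf Ef].
have [|Hc Hf] := Hrel f c; last by split.
by split => //; rewrite -Ef PsiK //; exact: (dm_D mB).
Qed.

End ReconstructionTheorem.

(** * Square-summable families *)

Section SquareSummable.
Context (R : realType) (I : choiceType).
Local Notation V := (l2_module R I).
Implicit Types xi eta : l2 R I.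

Lemma l2_predP (f : I -> Cplx R) : f \in @l2_pred R I <->
  exists M, forall B : {fset I}, \sum_(i <- B) cmod (f i) ^+ 2 <= M.
Proof.
rewrite -(@esum_ltyP R I (fun i => cmod (f i) ^+ 2)) => [|i]; last exact: sqr_ge0.
by rewrite inE.
Qed.

Lemma l2_bounded xi : exists M, forall B : {fset I}, \sum_(i <- B) cmod (xi i) ^+ 2 <= M.
Proof. by apply/l2_predP; case: xi. Qed.

Definition l2_of (f : I -> Cplx R) : l2 R I := insubd (0 : l2 R I) f.

Lemma l2_ofE f : f \in @l2_pred R I -> l2_val (l2_of f) = f.
Proof. by move=> H; rewrite /l2_of -[LHS]/(val _) insubdK. Qed.

Lemma l2_ext xi eta : (forall i, xi i = eta i) -> xi = eta.
Proof. by move=> H; apply: val_inj; apply/funext. Qed.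

Lemma l2_addE xi eta i : (xi + eta : l2 R I) i = xi i + eta i.
Proof. by []. Qed.

Lemma l2_subE xi eta i : (xi - eta : l2 R I) i = xi i - eta i.
Proof. by []. Qed.

Lemma l2_scaleE (c : Cplx R) xi i : (c *: xi : l2 R I) i = c * xi i.
Proof. by []. Qed.

Lemma l2_sumE (J : Type) (s : seq J) (F : J -> l2 R I) i :
  (\sum_(j <- s) F j : l2 R I) i = \sum_(j <- s) F j i.
Proof. by elim: s => [|j s IH]; rewrite ?big_nil // !big_cons l2_addE IH. Qed.

Lemma l2_dominated (f g : I -> Cplx R) (s : I -> I) (C M : R) : 0 <= C ->
  (forall B : {fset I}, \sum_(i <- B) cmod (f i) ^+ 2 <= M) ->
  (forall i, g i <> 0 -> cmod (g i) <= C * cmod (f (s i))) ->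
  (forall i j, g i <> 0 -> g j <> 0 -> s i = s j -> i = j) ->
  forall B : {fset I}, \sum_(i <- B) cmod (g i) ^+ 2 <= C ^+ 2 * M.
Proof.
move=> C0 fM gf sinj B.
pose B1 := [fset i in B | g i != 0]%fset.
have inB1 i : i \in B1 -> g i <> 0 by rewrite !inE => /andP[_ /eqP].
have -> : \sum_(i <- B) cmod (g i) ^+ 2 = \sum_(i <- B1) cmod (g i) ^+ 2.
  apply/esym/big_fset_incl; first by apply/fsubsetP => i; rewrite !inE => /andP[].
  by move=> i iB; rewrite !inE iB /= negbK => /eqP ->; rewrite cmod0 expr0n.
apply: (@le_trans _ _ (\sum_(i <- B1) C ^+ 2 * cmod (f (s i)) ^+ 2)).
  rewrite big_seq_cond [leRHS]big_seq_cond; apply: ler_sum => i /andP[/inB1 gi _].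
  rewrite -exprMn ler_pXn2r ?nnegrE ?cmod_ge0 ?mulr_ge0 ?cmod_ge0 //.
  exact: gf.
rewrite -mulr_sumr ler_wpM2l ?sqr_ge0 //.
have := fM [fset s i | i in B1]%fset; rewrite big_imfset //.
by move=> i j /inB1 gi /inB1 gj; exact: sinj.
Qed.

Definition l2_delta_fun (j i : I) : Cplx R := if i == j then 1 else 0.

Lemma l2_delta_bound j (B : {fset I}) : \sum_(i <- B) cmod (l2_delta_fun j i) ^+ 2 <= 1.
Proof.
have le1 : \sum_(i <- [fset j]%fset) cmod (l2_delta_fun j i) ^+ 2 <= 1.
  by rewrite big_seq_fset1 /l2_delta_fun eqxx cmod1 expr1n.
apply: le_trans le1.
have -> : \sum_(i <- [fset j]%fset) cmod (l2_delta_fun j i) ^+ 2 =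
    \sum_(i <- (B `|` [fset j])%fset) cmod (l2_delta_fun j i) ^+ 2.
  apply: big_fset_incl; first exact: fsubsetUr.
  move=> i _; rewrite inE => /negbTE ij; by rewrite /l2_delta_fun ij cmod0 expr0n.
rewrite [leRHS](big_fsetID _ (mem B)) /= (_ : [fset _ in _ | _]%fset = B).
  by rewrite lerDl; apply: sumr_ge0 => i _; exact: sqr_ge0.
by apply/fsetP => i; rewrite !inE /= andbC; case: (i \in B).
Qed.

Definition l2_delta j : l2 R I := l2_of (l2_delta_fun j).

Lemma l2_deltaE j i : l2_delta j i = if i == j then 1 else 0.
Proof. by rewrite l2_ofE //; apply/l2_predP; exists 1; exact: l2_delta_bound. Qed.

Lemma l2_ip_sum xi eta : exists l, has_usum (fun i => (xi i)^* * eta i) l.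
Proof.
have [M HM] := l2_bounded xi; have [N HN] := l2_bounded eta.
exact: usummable_l2 HM HN.
Qed.

Lemma l2_ip_delta xi j u : hm_ip (xi : V) (l2_delta j : V) u = (xi j)^*.
Proof.
rewrite -[LHS]/(usum (fun i => (xi i)^* * l2_delta j i)).
rewrite (usum1 (j := j)) => [|i /eqP/negbTE ij]; rewrite l2_deltaE.
  by rewrite eqxx mulr1.
by rewrite ij mulr0.
Qed.

(** The inner products with the basis vectors recover the coordinates, so that
    an adjoint forces linearity. *)
Lemma l2_ip_ext xi eta :
  (forall zeta, hm_ip (xi : V) (zeta : V) = hm_ip (eta : V) (zeta : V)) -> xi = eta.
Proof.
move=> H; apply: l2_ext => i; have := congr1 (@^~ tt) (H (l2_delta i)).
by rewrite !l2_ip_delta => /(can_inj conjCK).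
Qed.

Lemma l2_ipZ (c : Cplx R) xi eta u : hm_ip ((c *: xi : l2 R I) : V) (eta : V) u =
  c^* * hm_ip (xi : V) (eta : V) u.
Proof.
have [l Hl] := l2_ip_sum xi eta.
change (usum (fun i => ((c *: xi : l2 R I) i)^* * eta i) =
  c^* * usum (fun i => (xi i)^* * eta i)).
rewrite (usumE Hl); apply: usumE.
have := has_usumZ (c := c^*) Hl; congr (has_usum _ _); apply/funext => i.
by rewrite l2_scaleE rmorphM mulrA.
Qed.

Lemma l2_adjointZ (S : V -> V) (c : Cplx R) (xi : l2 R I) : adjointable S ->
  S (c *: xi : l2 R I) = c *: S xi.
Proof.
move=> [T ST]; apply: l2_ip_ext => eta; apply/funext => u.
by rewrite ST l2_ipZ l2_ipZ ST.
Qed.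

Lemma l2_norm_sum xi : exists2 s : R, hm_norm (xi : V) = Num.sqrt s &
  (forall B : {fset I}, \sum_(i <- B) cmod (xi i) ^+ 2 <= s) /\
  (forall M, (forall B : {fset I}, \sum_(i <- B) cmod (xi i) ^+ 2 <= M) -> s <= M).
Proof.
have [M HM] := l2_bounded xi.
have [s Hs [ub _]] := real_usum (fun i => sqr_ge0 (cmod (xi i))) HM.
exists s; last split => // M' HM'; last first.
  have [t Ht [_ tM]] := real_usum (fun i => sqr_ge0 (cmod (xi i))) HM'.
  suff -> : s = t by [].
  by have := usumE Hs; rewrite (usumE Ht) => -[].
have E u : hm_ip (xi : V) (xi : V) u = s%:C%C.
  rewrite -[LHS]/(usum (fun i => (xi i)^* * xi i)); apply: usumE.
  by move: Hs; congr (has_usum _ _); apply/funext => i; rewrite conjM_cmod.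
have RE : range (fun k => complex.Re (hm_ip (xi : V) (xi : V) k)) = [set s].
  apply/seteqP; split => [_ [u _ <-]|_ ->]; first by rewrite E.
  by exists tt => //; rewrite E.
by rewrite /hm_norm RE sup1.
Qed.

Lemma hm_norm_ge0 (W : hilbert_module R) (x : W) : 0 <= hm_norm x.
Proof. exact: sqrtr_ge0. Qed.

Lemma l2_norm_ub xi (B : {fset I}) :
  \sum_(i <- B) cmod (xi i) ^+ 2 <= hm_norm (xi : V) ^+ 2.
Proof.
have [s -> [ub _]] := l2_norm_sum xi.
rewrite sqr_sqrtr //; have := ub fset0; by rewrite big_seq_fset0.
Qed.

Lemma l2_norm_le xi (M : R) : 0 <= M ->
  (forall B : {fset I}, \sum_(i <- B) cmod (xi i) ^+ 2 <= M ^+ 2) ->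
  hm_norm (xi : V) <= M.
Proof.
move=> M0 HM; have [s -> [_ lub]] := l2_norm_sum xi.
rewrite -(ger0_norm M0) -sqrtr_sqr; apply: ler_wsqrtr; exact: lub.
Qed.

Lemma l2_coord_le xi i : cmod (xi i) <= hm_norm (xi : V).
Proof.
have := l2_norm_ub xi [fset i]%fset; rewrite big_seq_fset1.
by rewrite ler_pXn2r // nnegrE ?cmod_ge0 ?hm_norm_ge0.
Qed.

Lemma l2_norm_delta j : hm_norm (l2_delta j : V) <= 1.
Proof.
apply: l2_norm_le => // B; rewrite expr1n.
under eq_bigr do rewrite l2_deltaE; exact: (l2_delta_bound j).
Qed.

Lemma l2_norm0 : hm_norm ((0 : l2 R I) : V) = 0.
Proof.
apply/eqP; rewrite eq_le hm_norm_ge0 andbT; apply: l2_norm_le => // B.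
by rewrite big1 ?expr0n // => i _; rewrite cmod0 expr0n.
Qed.

(** The constant 2 is what the parallelogram inequality gives without
    the inequality of Cauchy and Schwarz; estimates up to a constant suffice. *)
Lemma l2_norm_add xi eta :
  hm_norm ((xi + eta : l2 R I) : V) <= 2 * (hm_norm (xi : V) + hm_norm (eta : V)).
Proof.
have x0 := hm_norm_ge0 (xi : V); have e0 := hm_norm_ge0 (eta : V).
apply: l2_norm_le => [|B]; first by rewrite mulr_ge0 // addr_ge0.
apply: (@le_trans _ _ (4 * \sum_(i <- B) cmod (xi i) ^+ 2 + 4 * \sum_(i <- B) cmod (eta i) ^+ 2)).
  rewrite !mulr_sumr -big_split; apply: ler_sum => i _; rewrite l2_addE /=.
  have := cmod2_lin 1 (xi i) (eta i); rewrite mul1r cmod1 expr1n.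
  by move=> /le_trans; apply; rewrite -mulrDr ler_wpM2r ?addr_ge0 ?sqr_ge0 //; lra.
have := l2_norm_ub xi B; have := l2_norm_ub eta B; nra.
Qed.

End SquareSummable.

(** * The reduced algebra of the transformation groupoid *)

Section BoundedFunctions.
Context (R : realType) (X : topologicalType) (cX : compact [set: X]).

Lemma continuous_bounded (f : X -> Cplx R) : continuous f ->
  exists2 C : R, 0 <= C & forall x, cmod (f x) <= C.
Proof.
move=> /continuous_cmodP cf.
have /compact_near_coveringP cov := cX.
have [|M [Mr HM]] := cov R (+oo%R)%classic (fun M x => cmod (f x) <= M) _.
  move=> x _; exists ([set x' | cmod (f x - f x') < 1], [set M | cmod (f x) + 1 < M]).
    by split; [exact: (cf x 1 ltr01)|apply: nbhs_pinfty_gt; exact: num_real].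
  move=> [x' M] [/= h1 h2]; apply: le_trans (ltW h2).
  have := cmodD (f x' - f x) (f x); rewrite subrK cmodB => h; lra.
have H : forall x, cmod (f x) <= `|M| + 1.
  by move=> x; apply: (HM (`|M| + 1)) => //; have := ler_norm M; lra.
by exists (`|M| + 1).
Qed.

End BoundedFunctions.

Section Slide.
Context (G : groupType) (X : topologicalType) (theta : ore_action G X).
Implicit Types z w : tg theta.

(** The product of the inverse of the arrow [(pt z, g)] with [z]. *)
Definition slide (g : G) z : tg theta :=
  tg_of theta (uact theta (tg_pt z) g) (g^-1 * tg_gp z)%g.

Lemma slide_pt g z : tg_pt (slide g z) = uact theta (tg_pt z) g.
Proof. exact: tg_of_pt. Qed.

Lemma slide_gp g z : Qset theta (tg_pt z) g -> tg_gp (slide g z) = (g^-1 * tg_gp z)%g.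
Proof. by move=> Q; rewrite tg_of_gp //; apply: QsetVM => //; exact: tgQ. Qed.

Lemma slideK g z : Qset theta (tg_pt z) g -> slide g^-1%g (slide g z) = z.
Proof.
move=> Q; have Q' : Qset theta (tg_pt (slide g z)) g^-1%g.
  by rewrite slide_pt; exact: QsetV.
apply: tg_ext; first by rewrite !slide_pt uactK.
by rewrite slide_gp // slide_gp // mulgA mulVg mul1g.
Qed.

Lemma slideM g h z : Qset theta (tg_pt z) g -> Qset theta (uact theta (tg_pt z) g) h ->
  slide h (slide g z) = slide (g * h)%g z.
Proof.
move=> Qg Qh; have Q' : Qset theta (tg_pt (slide g z)) h by rewrite slide_pt.
apply: tg_ext; first by rewrite !slide_pt uactM.
by rewrite slide_gp // slide_gp // slide_gp; [rewrite invgM mulgA|exact: QsetM].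
Qed.

Lemma slide1 z : slide 1%g z = z.
Proof.
have Q := Qset1 theta (tg_pt z).
by apply: tg_ext; rewrite ?slide_pt ?slide_gp ?uact1 // invg1 mul1g.
Qed.

Lemma slide_mul (z : tg theta) g : Qset theta (tg_pt z) g ->
  tg_mul (tg_inv (tg_of theta (tg_pt z) g)) z = slide g z.
Proof.
move=> Q; have E : tg_src (tg_inv (tg_of theta (tg_pt z) g)) = tg_rng z.
  by have /= -> := gax_srcV (tg_axioms theta) (tg_of theta (tg_pt z) g);
    rewrite !tg_rng_of tg_of_pt.
apply: tg_ext.
  by rewrite (tg_mulE E).1 (tg_invE _).1 slide_pt tg_of_pt tg_of_gp.
by rewrite (tg_mulE E).2 (tg_invE _).2 slide_gp // tg_of_gp.
Qed.

End Slide.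

Section ReducedOperators.
Context (R : realType) (G : groupType) (X : topologicalType).
Context (theta : ore_action G X).
Context (cX : compact [set: X]) (hX : hausdorff_space X) (oth : open_images theta).
Local Notation K := (transformation_groupoid theta).
Local Notation L := (l2 R K).
Local Notation V := (l2_module R K).
Implicit Types (f : X -> Cplx R) (xi : L) (z : tg theta).

Definition red_D f (xi : V) : V :=
  l2_of (fun z : K => f (tg_pt z) * (xi : L) z).

Definition red_N (g : G) (xi : V) : V :=
  l2_of (fun z : K => if `[< Qset theta (tg_pt z) g >] then (xi : L) (slide g z) else 0).

Lemma red_D_bound f xi (C : R) : 0 <= C -> (forall x, cmod (f x) <= C) ->
  forall B : {fset K}, \sum_(z <- B) cmod (f (tg_pt z) * xi z) ^+ 2 <=
    C ^+ 2 * hm_norm (xi : V) ^+ 2.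
Proof.
move=> C0 fC; apply: (l2_dominated (f := xi) (s := id)) => //.
- exact: l2_norm_ub.
- by move=> z _; rewrite cmodM ler_wpM2r ?cmod_ge0.
Qed.

Lemma red_DE f xi z : continuous f -> (red_D f xi : L) z = f (tg_pt z) * xi z.
Proof.
move=> cf; rewrite l2_ofE //; apply/l2_predP.
have [C C0 fC] := continuous_bounded cX cf.
by exists (C ^+ 2 * hm_norm (xi : V) ^+ 2); exact: red_D_bound.
Qed.

Lemma red_N_bound g xi (B : {fset K}) :
  \sum_(z <- B) cmod (if `[< Qset theta (tg_pt z) g >] then xi (slide g z) else 0) ^+ 2
  <= 1 ^+ 2 * hm_norm (xi : V) ^+ 2.
Proof.
apply: (l2_dominated (f := xi) (s := slide g)) => //.
- exact: l2_norm_ub.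
- by move=> z; case: asboolP => // _ _; rewrite mul1r.
- move=> z w; case: asboolP => // Qz _; case: asboolP => // Qw _ E.
  by rewrite -(slideK Qz) E slideK.
Qed.

Lemma red_NE g xi z : (red_N g xi : L) z =
  if `[< Qset theta (tg_pt z) g >] then xi (slide g z) else 0.
Proof.
rewrite l2_ofE //; apply/l2_predP; exists (1 ^+ 2 * hm_norm (xi : V) ^+ 2).
exact: red_N_bound.
Qed.

Lemma red_N_in g xi z : Qset theta (tg_pt z) g -> (red_N g xi : L) z = xi (slide g z).
Proof. by move=> Q; rewrite red_NE; case: asboolP. Qed.

Lemma red_N_out g xi z : ~ Qset theta (tg_pt z) g -> (red_N g xi : L) z = 0.
Proof. by move=> Q; rewrite red_NE; case: asboolP. Qed.

Lemma red_D_norm f xi (C : R) : continuous f -> 0 <= C -> (forall x, cmod (f x) <= C) ->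
  hm_norm (red_D f xi) <= C * hm_norm (xi : V).
Proof.
move=> cf C0 fC; apply: l2_norm_le => [|B]; first by rewrite mulr_ge0 // hm_norm_ge0.
rewrite exprMn; under eq_bigr do rewrite red_DE //; exact: red_D_bound.
Qed.

Lemma red_N_norm g xi : hm_norm (red_N g xi) <= hm_norm (xi : V).
Proof.
apply: l2_norm_le => [|B]; first exact: hm_norm_ge0.
by under eq_bigr do rewrite red_NE; have := red_N_bound g xi B; rewrite expr1n mul1r.
Qed.

Lemma red_D_adjoint f : continuous f ->
  adjoint_pair (red_D f) (red_D (fun x => (f x)^*)).
Proof.
move=> cf xi eta; apply/funext => u.
change (usum (fun z => ((red_D f xi : L) z)^* * (eta : L) z) =
  usum (fun z => ((xi : L) z)^* * (red_D (fun x => (f x)^*) eta : L) z)).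
congr usum; apply/funext => z.
by rewrite (red_DE _ _ cf) (red_DE _ _ (continuous_conj cf)) rmorphM mulrCA mulrA.
Qed.

Lemma red_N_adjoint g : adjoint_pair (red_N g) (red_N g^-1%g).
Proof.
move=> xi eta; apply/funext => u.
change (usum (fun z => ((red_N g xi : L) z)^* * (eta : L) z) =
  usum (fun z => ((xi : L) z)^* * (red_N g^-1%g eta : L) z)).
have QV z h : Qset theta (tg_pt z) h -> Qset theta (tg_pt (slide h z)) h^-1%g.
  by move=> Q; rewrite slide_pt; exact: QsetV.
apply: (usum_reindex (s := slide g) (t := slide g^-1%g)) => z.
- have [Q|Q] := pselect (Qset theta (tg_pt z) g); last first.
    by rewrite red_N_out // conjC0 mul0r.
  by rewrite red_N_in // (red_N_in _ (QV _ _ Q)) slideK.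
- have [Q|Q] := pselect (Qset theta (tg_pt z) g^-1%g); last first.
    by rewrite red_N_out // mulr0.
  have := QV _ _ Q; have := slideK Q; rewrite invgK => sK Q'.
  by rewrite red_N_in // (red_N_in _ Q') sK.
Qed.

(** The convolution operators of finite sums of functions supported on the
    copies of the domains: [i] ranges over the summands, each of which is
    [F i] on the copy of index [k i]. *)
Definition convolution (T : V -> V) :=
  exists (I : finType) (k : I -> G) (F : I -> X -> Cplx R),
    (forall i, continuous (F i)) /\
    forall xi, T xi = \sum_i (red_D (F i) (red_N (k i) xi) : L).

Lemma convolution_coord (I : finType) (k : I -> G) (F : I -> X -> Cplx R) xi z :
  (forall i, continuous (F i)) ->
  (\sum_i (red_D (F i) (red_N (k i) xi) : L) : L) z =
  \sum_i F i (tg_pt z) * (red_N (k i) xi : L) z.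
Proof. by move=> cF; rewrite l2_sumE; apply: eq_bigr => i _; rewrite red_DE. Qed.

(** The arrows with the same range as [z] are indexed by group elements, and only
    finitely many of these are charged by [f]. *)
Lemma fsbig_range_fibre (B : {fset G}) (f : K -> Cplx R) xi z :
  (forall w, f w <> 0 -> tg_gp w \in B) ->
  \sum_(a \in [set a : K | grng a = grng (z : K)]) f a * xi (gmul (ginv a) z) =
  \sum_(g <- B) (if `[< Qset theta (tg_pt z) g >] then f (tg_of theta (tg_pt z) g) else 0)
     * (red_N g xi : L) z.
Proof.
move=> fB; pose P := [set g | g \in B /\ Qset theta (tg_pt z) g].
pose h g : K := tg_of theta (tg_pt z) g.
pose S a := f a * xi (gmul (ginv a) z).
have hbij : set_bij P [set h g | g in P] h.
  split; [by move=> g Pg; exists g| |by []].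
  move=> g g' /set_mem[_ Q] /set_mem[_ Q'] /(congr1 (@tg_gp _ _ _)).
  by rewrite !tg_of_gp.
rewrite -(fsbig_widen [set h g | g in P]); last 2 first.
- move=> _ [g [_ Q] <-]; change (tg_rng (h g) = tg_rng z).
  by rewrite !tg_rng_of tg_of_pt.
- move=> a [ra na] /=; have [->|fa] := pselect (f a = 0); first by rewrite mul0r.
  have ra' : tg_rng a = tg_rng z := ra.
  have za : tg_pt z = tg_pt a by rewrite -(tg_rngE a).1 ra' (tg_rngE z).1.
  case: na; exists (tg_gp a); last by rewrite /h za tg_ofK.
  by split; [exact: fB|rewrite za; exact: tgQ].
rewrite (reindex_fsbig h P) //.
transitivity (\sum_(g \in [set` B])
  ((if `[< Qset theta (tg_pt z) g >] then f (tg_of theta (tg_pt z) g) else 0)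
     * (red_N g xi : L) z)).
  rewrite [RHS](_ : _ = \sum_(g \in P)
    ((if `[< Qset theta (tg_pt z) g >] then f (tg_of theta (tg_pt z) g) else 0)
     * (red_N g xi : L) z)).
    apply: eq_fsbigr => g /set_mem[_ Q]; rewrite red_N_in //.
    by case: asboolP => // _; rewrite /= slide_mul.
  apply/esym/fsbig_widen; first by move=> g [].
  move=> g [gB nP] /=; case: asboolP => Q; last by rewrite mul0r.
  by case: nP.
by rewrite fsbig_finite ?set_fsetK //; exact: finite_fset.
Qed.

End ReducedOperators.

#[global] Opaque l2_of red_D red_N.

Section ConvolutionOperators.
Context (R : realType) (G : groupType) (X : topologicalType).
Context (theta : ore_action G X).
Context (cX : compact [set: X]) (hX : hausdorff_space X) (oth : open_images theta).
Local Notation K := (transformation_groupoid theta).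
Local Notation L := (l2 R K).
Local Notation V := (l2_module R K).
Implicit Types (xi : L) (z : tg theta).

(** Off the clopen domain of [g] the map is the inclusion of the units. *)
Lemma tg_of_continuousT g : continuous (fun x => tg_of theta x g).
Proof.
move=> x; have [Q|nQ] := pselect (Qset theta x g).
  apply: (@tg_of_continuous _ _ theta _ x id (fun=> g)); first exact: cvg_id.
  by apply: filterS (near_pdom oth Q) => x' Q'.
have out x' : ~ Qset theta x' g -> tg_of theta x' g = tg_of theta x' 1%g.
  move=> nQ'; rewrite /tg_of /insubd insubF; last first.
    by apply/negP => /set_mem; exact: nQ'.
  by apply: tg_ext; rewrite -[RHS]/(_ (tg_of theta x' 1%g)) ?tg_of_pt // tg_of_gp //;
    exact: Qset1.
have c1 : {for x, continuous (fun x => tg_of theta x 1%g)}.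
  apply: (@tg_of_continuous _ _ theta _ x id (fun=> 1%g)); first exact: cvg_id.
  by apply: nearW => x'; split => //; exact: Qset1.
move=> W; rewrite out // => /c1 H; have H' := near_npdom cX hX nQ.
have H1 : \forall x' \near x, W (tg_of theta x' 1%g) by exact: H.
suff : \forall x' \near x, W (tg_of theta x' g) by [].
by apply: filterS2 H1 H' => x' Wx' nQ'; rewrite out.
Qed.

Lemma tg_compact_fibres (s : seq G) : compact [set z : tg theta | tg_gp z \in s].
Proof.
elim: s => [|g s IH].
  rewrite (_ : [set z | _] = set0); first exact: compact0.
  by apply/seteqP; split.
rewrite (_ : [set z | _] = [set tg_of theta x g | x in pdom theta g] `|`
  [set z : tg theta | tg_gp z \in s]).
  apply: compactU => //; apply: continuous_compact.
    by apply: continuous_subspaceT; exact: tg_of_continuousT.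
  by apply: (subclosed_compact _ cX) => //; exact: pdom_closed.
apply/seteqP; split=> [z|z [[x Q <-]|]].
- change (tg_gp z \in g :: s -> ([set tg_of theta x g | x in pdom theta g] `|`
    [set z : tg theta | tg_gp z \in s]) z).
  rewrite inE => /orP[/eqP <-|zs]; last by right.
  by left; exists (tg_pt z); [exact: tgQ|exact: tg_ofK].
- change (is_true (tg_gp (tg_of theta x g) \in g :: s)).
  by rewrite tg_of_gp // mem_head.
- change (tg_gp z \in s -> is_true (tg_gp z \in g :: s)).
  by move=> zs; rewrite inE zs orbT.
Qed.

Lemma tg_gp_near z : \forall w \near z, tg_gp w = tg_gp z.
Proof. by apply/near_tg; apply: nearW => x w _ ->. Qed.

Lemma tg_closed_fibres (s : seq G) : closed [set z : tg theta | tg_gp z \in s].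
Proof.
move=> z /(_ _ (tg_gp_near z)) [w [ws wz]].
change (is_true (tg_gp z \in s)); rewrite -wz; exact: ws.
Qed.

Lemma Cc_fibres (s : seq G) (f : K -> Cplx R) : continuous f ->
  (forall z, f z <> 0 -> tg_gp z \in s) -> Cc f.
Proof.
move=> cf fs; split => //; apply: (subclosed_compact _ (@tg_compact_fibres s)).
  exact: closed_closure.
apply: (@subset_trans _ (closure [set z : tg theta | tg_gp z \in s])).
  by apply: closure_subset => z; exact: fs.
by rewrite -(closure_id _).1 //; exact: tg_closed_fibres.
Qed.

(** The group component is locally constant on the compact support. *)
Lemma Cc_finite_fibres (f : K -> Cplx R) : Cc f ->
  exists B : {fset G}, forall z, f z <> 0 -> tg_gp z \in B.
Proof.
move=> [_ /compact_near_coveringP cov].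
have [|B _ HB] := cov {fset G} totally (fun B z => tg_gp z \in B) _.
  move=> z _; exists ([set w | tg_gp w = tg_gp z], [set B | ([fset tg_gp z] `<=` B)%fset]).
    by split; [exact: (tg_gp_near z)|exists [fset tg_gp z]%fset].
  by move=> [w B] [/= -> /fsubsetP]; apply; rewrite inE.
exists B => z fz; apply: (HB B) => //=; exact: subset_closure.
Qed.

Definition fibre_function (I : finType) (k : I -> G) (F : I -> X -> Cplx R) (z : K) :=
  \sum_i (if tg_gp z == k i then F i (tg_pt z) else 0).

Lemma fibre_functionP (I : finType) (k : I -> G) (F : I -> X -> Cplx R) z :
  fibre_function k F z <> 0 -> exists i, tg_gp z = k i.
Proof.
move=> H; apply: contrapT => nk; apply: H; apply: big1 => i _.
by case: eqP => // E; case: nk; exists i.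
Qed.

Lemma fibre_function_continuous (I : finType) (k : I -> G) (F : I -> X -> Cplx R) :
  (forall i, continuous (F i)) -> continuous (fibre_function k F).
Proof.
move=> cF; suff H s : continuous (fun z : K =>
    \sum_(i <- s) (if tg_gp z == k i then F i (tg_pt z) else 0)) by exact: H.
elim: s => [|i s IH].
  have -> : (fun z : K => \sum_(i <- [::]) (if tg_gp z == k i then F i (tg_pt z) else 0)) =
    (fun=> 0) by apply/funext => z; rewrite big_nil.
  exact: continuous_cplx_cst.
have -> : (fun z : K => \sum_(j <- i :: s) (if tg_gp z == k j then F j (tg_pt z) else 0)) =
    (fun z : K => (if tg_gp z == k i then F i (tg_pt z) else 0) +
      \sum_(j <- s) (if tg_gp z == k j then F j (tg_pt z) else 0)).
  by apply/funext => z; rewrite big_cons.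
apply: continuous_add; last exact: IH.
apply/continuous_cmodP => z e e0.
have H1 := tg_gp_near z; have /continuous_cmodP cFi := cF i.
have H2 : \forall w \near z, cmod (F i (tg_pt z) - F i (tg_pt w)) < e.
  exact: (@tg_pt_continuous _ _ theta z _ (cFi (tg_pt z) e e0)).
apply: filterS2 H1 H2 => w wz Fw.
rewrite wz; case: eqP => // _; by rewrite subrr cmod0.
Qed.

Lemma regular_fibre_function (I : finType) (k : I -> G) (F : I -> X -> Cplx R)
    (T : V -> V) : (forall i, continuous (F i)) ->
  (forall xi, T xi = \sum_i (red_D (F i) (red_N (k i) xi) : L)) ->
  Cc (fibre_function k F) /\ regular_op (fibre_function k F) T.
Proof.
move=> cF ET; pose B := [fset k i | i in I]%fset.
have kB z : fibre_function k F z <> 0 -> tg_gp z \in B.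
  by move=> /fibre_functionP[i ->]; apply/imfsetP; exists i.
split; first by apply: (@Cc_fibres B) => //; exact: fibre_function_continuous.
move=> xi c; rewrite (fsbig_range_fibre _ _ kB) ET convolution_coord //.
transitivity (\sum_i \sum_(g <- B) (if g == k i then
    F i (tg_pt c) * (red_N (k i) xi : L) c else 0)).
  apply: eq_bigr => i _; rewrite (bigD1_seq (k i)) ?fset_uniq //=; last first.
    by apply/imfsetP; exists i.
  by rewrite eqxx big1 ?addr0 // => g /negbTE ->.
rewrite exchange_big /=; apply: eq_bigr => g _; case: asboolP => Q; last first.
  rewrite mul0r big1 // => i _; case: eqP => // gi.
  by rewrite red_N_out ?mulr0 // -gi.
rewrite /fibre_function mulr_suml; apply: eq_bigr => i _.
rewrite tg_of_pt tg_of_gp //; case: eqP => [->//|_]; by rewrite mul0r.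
Qed.

Lemma convolution_of_regular (f : K -> Cplx R) (T : V -> V) : Cc f -> regular_op f T ->
  convolution T.
Proof.
move=> Cf fT; have [B fB] := Cc_finite_fibres Cf; have [cf _] := Cf.
pose F g x := if `[< Qset theta x g >] then f (tg_of theta x g) else 0.
have cF g : continuous (F g).
  apply/continuous_cmodP => x e e0; have [Q|nQ] := pselect (Qset theta x g).
    have /continuous_cmodP cf' := cf.
    have H1 := near_pdom oth Q.
    have H2 : \forall x' \near x, cmod (f (tg_of theta x g) - f (tg_of theta x' g)) < e.
      exact: (tg_of_continuousT (cf' (tg_of theta x g) e e0)).
    apply: filterS2 H1 H2 => x' Q' H; rewrite /F.
    by case: asboolP => // _; case: asboolP.
  have H1 := near_npdom cX hX nQ; apply: filterS H1 => x' nQ'; rewrite /F.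
  by case: asboolP => // _; case: asboolP => // _; rewrite subrr cmod0.
exists B, val, (fun i => F (val i)); split=> [i|xi]; first exact: cF.
apply: l2_ext => z; rewrite fT (fsbig_range_fibre _ _ fB) convolution_coord //.
exact: big_seq_fsetE.
Qed.

Lemma convolution_sub (T : V -> V) (xi eta : L) : convolution T ->
  T (xi - eta : L) = (T xi - T eta : L).
Proof.
move=> [I [k [F [cF ET]]]]; rewrite !ET -sumrB; apply: eq_bigr => i _.
apply: l2_ext => z.
rewrite l2_subE.
have DE (zeta : L) : (red_D (F i) zeta : L) z = F i (tg_pt z) * zeta z.
  exact: red_DE.
rewrite (DE (red_N (k i) (xi - eta : L))).
rewrite (DE (red_N (k i) xi)).
rewrite (DE (red_N (k i) eta)).
rewrite -mulrBr; congr (_ * _).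
rewrite (red_NE (k i) xi).
rewrite (red_NE (k i) eta).
rewrite (red_NE (k i) (xi - eta : L)).
by case: asboolP => _; rewrite ?l2_subE ?subr0.
Qed.

Lemma convolution_DN g (F : X -> Cplx R) : continuous F ->
  convolution (fun xi : V => red_D F (red_N g xi)).
Proof.
move=> cF; exists unit, (fun=> g), (fun=> F); split => // xi.
by rewrite big_const /= card_unit /= addr0.
Qed.

Lemma red_N1 xi : red_N 1%g xi = xi.
Proof. by apply: l2_ext => z; rewrite red_N_in ?slide1 //; exact: Qset1. Qed.

(** The product rule is [(F N g) (E N h) = F (E 1_h o u(., g)) N (g h)], where the
    indicator function of the domain of [h] records that [N g N h] is only a
    restriction of [N (g h)]. *)
Lemma convolution_comp (S T : V -> V) : convolution S -> convolution T ->
  convolution (S \o T).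
Proof.
move=> [I [k [F [cF ES]]]] [J [l [E [cE ET]]]].
have c1 := @continuous_cplx_cst R X 1.
have cH g (f : X -> Cplx R) : continuous f -> continuous (hat_action theta g f).
  exact: continuous_hat_action.
pose P (p : I * J) x := F p.1 x * hat_action theta (k p.1)
  (fun y => E p.2 y * hat_action theta (l p.2) (fun=> 1) y) x.
have cP p : continuous (P p).
  exact: (continuous_mul (cF _) (cH _ _ (continuous_mul (cE _) (cH _ _ c1)))).
exists (I * J)%type, (fun p => (k p.1 * l p.2)%g), P; split => // xi.
apply: l2_ext => z; rewrite convolution_coord // /= ES convolution_coord //.
rewrite -(pair_bigA _ (fun i j => P (i, j) (tg_pt z) *
  (red_N (k i * l j)%g xi : L) z)) /=; apply: eq_bigr => i _.
have [Q|nQ] := pselect (Qset theta (tg_pt z) (k i)); last first.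
  rewrite red_N_out // mulr0 big1 // => j _.
  by rewrite /P hat_action_out // mulr0 mul0r.
rewrite red_N_in // ET convolution_coord // mulr_sumr; apply: eq_bigr => j _.
rewrite /P hat_actionE // -!mulrA slide_pt; congr (_ * (_ * _)).
have [Q'|nQ'] := pselect (Qset theta (uact theta (tg_pt z) (k i)) (l j)).
  rewrite hat_actionE // mul1r red_N_in ?slide_pt // slideM // red_N_in //.
  exact: QsetM.
by rewrite hat_action_out // mul0r red_N_out // slide_pt.
Qed.

Lemma convolution_norm (T : V -> V) : convolution T ->
  exists2 C : R, 0 <= C & forall xi, hm_norm (T xi) <= C * hm_norm (xi : V).
Proof.
move=> [I [k [F [cF ET]]]].
suff [C C0 HC] : exists2 C : R, 0 <= C & forall xi,
    hm_norm ((\sum_(i <- index_enum I) (red_D (F i) (red_N (k i) xi) : L) : L) : V)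
      <= C * hm_norm (xi : V).
  by exists C => // xi; rewrite ET.
elim: (index_enum I) => [|i s [C C0 HC]].
  by exists 0 => // xi; rewrite big_nil mul0r l2_norm0.
have [D D0 HD] := continuous_bounded cX (cF i).
exists (2 * (D + C)) => [|xi]; first by rewrite mulr_ge0 // addr_ge0.
rewrite big_cons; apply: le_trans (l2_norm_add _ _) _.
rewrite -mulrA ler_wpM2l // mulrDl lerD //.
apply: le_trans (red_D_norm cX _ (cF i) D0 HD) _.
by rewrite ler_wpM2l // red_N_norm.
Qed.

End ConvolutionOperators.

Section ReducedModel.
Context (R : realType) (G : groupType) (X : topologicalType).
Context (theta : ore_action G X).
Context (cX : compact [set: X]) (hX : hausdorff_space X) (oth : open_images theta).
Local Notation K := (transformation_groupoid theta).
Local Notation L := (l2 R K).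
Local Notation V := (l2_module R K).
Local Notation A := (reduced_cstar R K).
Local Notation D := (red_D (R := R) (theta := theta)).
Local Notation N := (red_N (R := R) (theta := theta)).
Implicit Types (xi : L) (z : tg theta) (f : X -> Cplx R) (S T : V -> V).

Let DE f xi z (cf : continuous f) : (D f xi : L) z = f (tg_pt z) * xi z.
Proof. exact: red_DE. Qed.

Lemma regular_convolution (T : V -> V) :
  (exists2 f, Cc f & regular_op f T) <-> convolution T.
Proof.
split=> [[f Cf fT]|[I [k [F [cF ET]]]]].
  exact: (convolution_of_regular cX hX oth Cf fT).
have [C1 C2] := regular_fibre_function cX hX oth cF ET.
by exists (fibre_function k F).
Qed.

Lemma reduced_adjointable T : A T -> adjointable T.
Proof. by case. Qed.

Lemma reduced_approx T (e : R) : A T -> 0 < e -> exists2 S, convolution S &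
  forall xi, hm_norm ((T xi : L) - (S xi : L) : V) <= e * hm_norm (xi : V).
Proof. by move=> [_ H] e0; have [S /regular_convolution cS HS] := H e e0; exists S. Qed.

Lemma reduced_intro T : adjointable T ->
  (forall e : R, 0 < e -> exists2 S, convolution S &
    forall xi, hm_norm ((T xi : L) - (S xi : L) : V) <= e * hm_norm (xi : V)) -> A T.
Proof.
move=> aT H; split => // e e0; have [S cS HS] := H e e0; exists S => //.
exact/regular_convolution.
Qed.

Lemma reduced_convolution T : adjointable T -> convolution T -> A T.
Proof.
move=> aT cT; apply: reduced_intro => // e e0; exists T => // xi.
by rewrite subrr l2_norm0 mulr_ge0 ?hm_norm_ge0 // ltW.
Qed.

Lemma reduced_D f : continuous f -> A (D f).
Proof.
move=> cf; apply: reduced_convolution.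
  by exists (D (fun x => (f x)^*)); exact: red_D_adjoint.
have := convolution_DN theta 1%g cf; congr convolution.
by apply/funext => xi; rewrite red_N1.
Qed.

Lemma red_D_one xi : D (fun=> 1) xi = xi.
Proof.
apply: l2_ext => z.
by rewrite (DE xi z (@continuous_cplx_cst R X 1)) mul1r.
Qed.

Lemma reduced_N g : A (N g).
Proof.
apply: reduced_convolution; first by exists (N g^-1%g); exact: red_N_adjoint.
have := convolution_DN theta g (@continuous_cplx_cst R X 1).
by congr convolution; apply/funext => xi; exact: red_D_one.
Qed.

Lemma reduced_bounded T : A T -> exists2 C : R, 0 <= C &
  forall xi, hm_norm (T xi) <= C * hm_norm (xi : V).
Proof.
move=> /reduced_approx/(_ ltr01)[S cS HS].
have [C C0 HC] := convolution_norm cX cS.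
exists (2 * (1 + C)) => [|xi]; first by rewrite mulr_ge0 // addr_ge0.
have := l2_norm_add ((T xi : L) - (S xi : L)) (S xi); rewrite subrK => H.
apply: le_trans H _; rewrite -mulrA ler_wpM2l // mulrDl.
exact: lerD (HS xi) (HC xi).
Qed.

(** The factors are approximated one after the other, since the quality of the
    second approximation depends on the norm of the first approximant. *)
Lemma reduced_comp S T : A S -> A T -> A (S \o T).
Proof.
move=> AS AT; apply: reduced_intro.
  have [S' HS] := reduced_adjointable AS; have [T' HT] := reduced_adjointable AT.
  by exists (T' \o S') => xi eta; exact: etrans (HS (T xi) eta) (HT xi (S' eta)).
move=> e e0; have [C C0 HC] := reduced_bounded AT.
(* Each of the two errors gets [e / 4]; the bound for sums doubles the total. *)
have share (B : R) : 0 <= B -> e / (4 * (B + 1)) * B <= e / 4.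
  move=> B0; rewrite mulrAC ler_pdivrMr; last by rewrite mulr_gt0 // ltr_wpDl.
  rewrite (_ : e / 4 * (4 * (B + 1)) = e * (B + 1)); last by field.
  by rewrite ler_pM2l // lerDl.
have d1 : 0 < e / (4 * (C + 1)) by rewrite divr_gt0 // mulr_gt0 // ltr_wpDl.
have [S1 cS1 HS1] := reduced_approx AS d1.
have [C' C'0 HC'] := convolution_norm cX cS1.
have d2 : 0 < e / (4 * (C' + 1)) by rewrite divr_gt0 // mulr_gt0 // ltr_wpDl.
have [T1 cT1 HT1] := reduced_approx AT d2.
exists (S1 \o T1) => [|xi]; first exact: (convolution_comp cX hX oth).
have E : ((S \o T) xi : L) - ((S1 \o T1) xi : L) =
    ((S (T xi) : L) - (S1 (T xi) : L)) + (S1 ((T xi : L) - (T1 xi : L)) : L).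
  by rewrite (convolution_sub cX (T xi : L) (T1 xi : L) cS1) addrA subrK.
rewrite E; apply: le_trans (l2_norm_add _ _) _.
have h1 := HS1 (T xi : L); have h2 := HC xi.
have h3 := HC' ((T xi : L) - (T1 xi : L)); have h4 := HT1 xi.
have n0 := hm_norm_ge0 (xi : V).
have h5 : hm_norm ((S (T xi) : L) - (S1 (T xi) : L) : V) <= e / 4 * hm_norm (xi : V).
  apply: le_trans h1 _; apply: le_trans (ler_wpM2l (ltW d1) h2) _.
  by rewrite mulrA ler_wpM2r // share.
have h6 : hm_norm (S1 ((T xi : L) - (T1 xi : L) : L)) <= e / 4 * hm_norm (xi : V).
  apply: le_trans h3 _; apply: le_trans (ler_wpM2l C'0 h4) _.
  by rewrite mulrA ler_wpM2r // mulrC share.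
apply: le_trans (ler_wpM2l (ler0n _ 2) (lerD h5 h6)) _.
by move: (hm_norm _) => n; rewrite (_ : 2 * _ = e * n) //; field.
Qed.

Lemma red_D_delta f x : continuous f ->
  D f (l2_delta R (tg_of theta x 1%g : K)) = (f x *: l2_delta R (tg_of theta x 1%g : K) : L).
Proof.
move=> cf; apply: l2_ext => z; rewrite (DE _ z cf) l2_scaleE !l2_deltaE.
by case: eqP => [->|_]; rewrite ?tg_of_pt // !mulr0.
Qed.

(** A function carried by the units convolves as a multiplication operator. *)
Lemma reduced_diagE : reduced_diag R K = [set D f | f in [set f | continuous f]].
Proof.
apply/seteqP; split => [T [f [Cf f1 fT]]|_ [f cf <-]].
- have f1' (z : K) : f z <> 0 -> tg_gp z \in [fset 1%g]%fset.
    move=> fz; rewrite inE; apply/eqP; apply: contrapT => z1; apply: fz.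
    apply: f1 => rz; apply: z1; by rewrite -rz (tg_rngE z).2.
  have [cf _] := Cf.
  have cg : continuous (fun x => f (tg_of theta x 1%g)).
    move=> x; apply: continuous_comp; last exact: cf.
    exact: tg_of_continuousT.
  exists (fun x => f (tg_of theta x 1%g)) => //.
  apply/funext => xi; apply: l2_ext => z; rewrite (DE _ z cg) fT.
  rewrite (fsbig_range_fibre _ _ f1') big_seq_fset1.
  case: asboolP => [_|]; last by case; exact: Qset1.
  by rewrite red_N1.
- pose F (i : unit) := f; pose k (i : unit) := 1%g : G.
  have cF i : continuous (F i) by [].
  have ET (xi : L) : D f xi = \sum_i (D (F i) (N (k i) xi) : L).
    transitivity (\sum_(i : unit) (D f (N 1%g xi) : L)); last by [].
    by rewrite big_const /= card_unit /= addr0 red_N1.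
  have [C1 C2] := regular_fibre_function cX hX oth cF ET.
  exists (fibre_function k F); split => // z nz.
  apply: contrapT => /fibre_functionP[i zi]; apply: nz.
  by apply: tg_ext; rewrite ?(tg_rngE z).1 ?(tg_rngE z).2.
Qed.

Lemma red_N_delta g x z : (N g (l2_delta R (tg_of theta x 1%g : K)) : L) z <> 0 ->
  g = tg_gp z /\ uact theta (tg_pt z) g = x.
Proof.
have [Q|nQ] := pselect (Qset theta (tg_pt z) g); last by rewrite red_N_out.
rewrite red_N_in // l2_deltaE; case: eqP => // E _.
have := congr1 (@tg_gp _ _ _) E; have := congr1 (@tg_pt _ _ _) E.
rewrite slide_pt slide_gp // tg_of_pt tg_of_gp; last exact: Qset1.
move=> ux gz; split => //.
by rewrite -[LHS]mulg1 -gz mulgA mulgV mul1g.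
Qed.

Lemma red_N_delta_one k x : Qset theta x k ->
  (N k^-1%g (l2_delta R (tg_of theta x 1%g : K)) : L)
    (tg_of theta (uact theta x k) k^-1%g) = 1.
Proof.
move=> Q; have QV := QsetV Q.
have E : tg_pt (tg_of theta (uact theta x k) k^-1%g) = uact theta x k by rewrite tg_of_pt.
rewrite red_N_in ?E // l2_deltaE (_ : slide _ _ = tg_of theta x 1%g) ?eqxx //.
apply: tg_ext; first by rewrite slide_pt !tg_of_pt uactK.
by rewrite slide_gp ?E // !tg_of_gp ?mulVg //; exact: Qset1.
Qed.

(** The coefficients of a convolution operator at the inverses of the arrows
    [(x, k)] with [k] fixed are the values of one continuous function. *)
Lemma convolution_coefficient T k : convolution T -> exists2 F : X -> Cplx R,
  continuous F & forall x, Qset theta x k ->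
    (T (l2_delta R (tg_of theta x 1%g : K)) : L)
      (tg_of theta (uact theta x k) k^-1%g) = F (uact theta x k).
Proof.
move=> [I [l [F [cF ET]]]].
exists (fun y => \sum_i (if l i == k^-1%g then F i y else 0)).
  elim: (index_enum I) => [|i s IH].
    have -> : (fun y : X => \sum_(i <- [::]) (if l i == k^-1%g then F i y else 0)) =
      (fun=> 0) by apply/funext => y; rewrite big_nil.
    exact: continuous_cplx_cst.
  have -> : (fun y => \sum_(j <- i :: s) (if l j == k^-1%g then F j y else 0)) =
      (fun y => (if l i == k^-1%g then F i y else 0) +
        \sum_(j <- s) (if l j == k^-1%g then F j y else 0)).
    by apply/funext => y; rewrite big_cons.
  apply: continuous_add; last exact: IH.
  by case: eqP => _; [exact: cF|exact: continuous_cplx_cst].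
move=> x Q; rewrite ET convolution_coord //; apply: eq_bigr => i _; rewrite tg_of_pt.
case: eqP => [->|li]; first by rewrite red_N_delta_one // mulr1.
rewrite [X in _ * X](_ : _ = 0) ?mulr0 //; apply: contrapT => /red_N_delta[gz _].
by apply: li; rewrite gz tg_of_gp //; exact: QsetV.
Qed.

Lemma convolution_delta_src T x z : convolution T ->
  (T (l2_delta R (tg_of theta x 1%g : K)) : L) z <> 0 ->
  uact theta (tg_pt z) (tg_gp z) = x.
Proof.
move=> [I [l [F [cF ET]]]]; rewrite ET convolution_coord // => H.
apply: contrapT => nx; apply: H; apply: big1 => i _.
rewrite [X in _ * X](_ : _ = 0) ?mulr0 //; apply: contrapT => /red_N_delta[gz ux].
by apply: nx; rewrite -gz.
Qed.

Lemma reduced_coord_le T S (e : R) x z :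
  (forall xi, hm_norm ((T xi : L) - (S xi : L) : V) <= e * hm_norm (xi : V)) -> 0 <= e ->
  cmod ((T (l2_delta R (tg_of theta x 1%g : K)) : L) z -
        (S (l2_delta R (tg_of theta x 1%g : K)) : L) z) <= e.
Proof.
move=> H e0; set d := l2_delta _ _.
apply: le_trans (l2_coord_le ((T d : L) - (S d : L)) z) _.
apply: le_trans (H d) _; rewrite -[leRHS]mulr1 ler_wpM2l //; exact: l2_norm_delta.
Qed.

Lemma reduced_delta_src T x z : A T ->
  (T (l2_delta R (tg_of theta x 1%g : K)) : L) z <> 0 ->
  uact theta (tg_pt z) (tg_gp z) = x.
Proof.
move=> AT Tz; pose d := l2_delta R (tg_of theta x 1%g : K).
have e0 : 0 < cmod ((T d : L) z) / 2.
  rewrite divr_gt0 // lt_neqAle cmod_ge0 andbT eq_sym; apply/eqP.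
  by move/cmod_eq0.
have [S cS HS] := reduced_approx AT e0.
apply: (convolution_delta_src cS) => Sz.
have h := reduced_coord_le x z HS (ltW e0); rewrite Sz subr0 in h.
have : cmod ((T d : L) z) <= cmod ((T d : L) z) / 2 by exact: h.
move: e0; move: (cmod _) => c; lra.
Qed.

(** A coefficient of [T] that is nonzero at the inverse of [(x, k)] is nonzero
    at the inverses of the neighbouring arrows, by uniform approximation of [T]
    by convolution operators. *)
Lemma reduced_near_coefficient T x k : A T -> Qset theta x k ->
  (T (l2_delta R (tg_of theta x 1%g : K)) : L) (tg_of theta (uact theta x k) k^-1%g) <> 0 ->
  \forall x' \near x, (T (l2_delta R (tg_of theta x' 1%g : K)) : L)
    (tg_of theta (uact theta x' k) k^-1%g) <> 0.
Proof.
move=> AT Q c0.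
pose c := (T (l2_delta R (tg_of theta x 1%g : K)) : L)
  (tg_of theta (uact theta x k) k^-1%g).
have e0 : 0 < cmod c / 4.
  rewrite divr_gt0 // lt_neqAle cmod_ge0 andbT eq_sym; apply/eqP => /cmod_eq0.
  exact: c0.
have [S cS HS] := reduced_approx AT e0.
have [F cF HF] := convolution_coefficient k cS.
have K1 : \forall x' \near x, cmod (F (uact theta x k) - F (uact theta x' k)) < cmod c / 4.
  have /continuous_cmodP cF' := cF.
  exact: (uact_continuous cX hX oth (cF' (uact theta x k) _ e0)).
apply: filterS2 (near_pdom oth Q) K1 => x' Q' Fx' Tx'.
have h1 : cmod (c - F (uact theta x k)) <= cmod c / 4.
  rewrite -(HF x Q).
  exact: (reduced_coord_le x (tg_of theta (uact theta x k) k^-1%g) HS (ltW e0)).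
have h2 : cmod (F (uact theta x' k)) <= cmod c / 4.
  rewrite -(HF x' Q').
  have := reduced_coord_le x' (tg_of theta (uact theta x' k) k^-1%g) HS (ltW e0).
  by rewrite Tx' cmodB subr0.
have := cmodD (c - F (uact theta x k)) (F (uact theta x k)); rewrite subrK.
have := cmodD (F (uact theta x k) - F (uact theta x' k)) (F (uact theta x' k)).
rewrite subrK; lra.
Qed.

(** The vector [T delta_x] is nonzero because [S] maps it to [p x] times the basis
    vector, and it is carried by the arrows with source [x]. *)
Lemma reduced_slice S T (p : X -> Cplx R) x : A T -> A S -> S \o T = D p ->
  continuous p -> p x <> 0 ->
  exists k, \forall x' \near x, Qset theta x' k /\
    forall c c' : X -> Cplx R, continuous c -> continuous c' ->
      T \o D c = D c' \o T -> c x' = c' (uact theta x' k).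
Proof.
move=> AT AS STp cp px; pose d x' := l2_delta R (tg_of theta x' 1%g : K).
have Tdx : exists z, (T (d x) : L) z <> 0.
  apply: contrapT => none; apply: px.
  have T0 : (T (d x) : L) = 0.
    by apply: l2_ext => z; apply: contrapT => nz; apply: none; exists z.
  have S0 : S (0 : L) = (0 : L).
    by have := l2_adjointZ 0 (0 : L) (reduced_adjointable AS); rewrite scale0r => ->;
      rewrite scale0r.
  have := congr1 (fun W => (W (d x) : L) (tg_of theta x 1%g)) STp.
  rewrite /= T0 S0 (DE _ _ cp) tg_of_pt l2_deltaE eqxx mulr1 => <-.
  by [].
have [z Tz] := Tdx; have src := reduced_delta_src AT Tz.
have Qz := tgQ z; exists (tg_gp z)^-1%g.
have Qx : Qset theta x (tg_gp z)^-1%g by rewrite -src; exact: QsetV.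
have ux : uact theta x (tg_gp z)^-1%g = tg_pt z by rewrite -src uactK.
have Tz' : (T (d x) : L) (tg_of theta (uact theta x (tg_gp z)^-1%g) (tg_gp z)^-1^-1%g) <> 0.
  by rewrite ux invgK tg_ofK.
have H1 := near_pdom oth Qx; have H2 := reduced_near_coefficient AT Qx Tz'.
apply: filterS2 H1 H2 => x' Q' Tx'; split => // c c' cc cc' E.
pose w : K := tg_of theta (uact theta x' (tg_gp z)^-1%g) (tg_gp z)^-1^-1%g.
have E1 : ((T \o D c) (d x') : L) w = c x' * (T (d x') : L) w.
  rewrite -[LHS]/((T (D c (d x')) : L) w) (red_D_delta x' cc).
  by rewrite (l2_adjointZ (c x') (d x') (reduced_adjointable AT)).
have E2 : ((D c' \o T) (d x') : L) w = c' (uact theta x' (tg_gp z)^-1%g) * (T (d x') : L) w.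
  rewrite -[LHS]/((D c' (T (d x')) : L) w) (DE (T (d x')) w cc').
  by rewrite [tg_pt w]tg_of_pt.
apply: (mulIf (x := (T (d x') : L) w)); first exact/eqP.
by rewrite -E1 E E2.
Qed.

Lemma reduced_model : diagonal_model theta A (reduced_diag R K) D N.
Proof.
split.
- exact: reduced_diagE.
- exact: reduced_D.
- move=> f g cf cg; apply/funext => xi; apply: l2_ext => z.
  rewrite (DE xi z (continuous_add cf cg)).
  by rewrite -[RHS]/((D f xi : L) z + (D g xi : L) z) (DE xi z cf) (DE xi z cg) mulrDl.
- move=> f g cf cg; apply/funext => xi; apply: l2_ext => z.
  rewrite (DE xi z (continuous_mul cf cg)) /comp (DE (D g xi) z cf) (DE xi z cg).
  by rewrite mulrA.
- move=> c f cf; apply/funext => xi; apply: l2_ext => z.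
  rewrite (DE xi z (continuous_scale cf)).
  by rewrite -[RHS]/(c * (D f xi : L) z) (DE xi z cf) mulrA.
- move=> f g cf cg E; apply/funext => x.
  pose u : K := tg_of theta x 1%g; pose d := l2_delta R u.
  have du : d u = 1 by rewrite l2_deltaE eqxx.
  have pu : tg_pt u = x by exact: tg_of_pt.
  have Ed h : continuous h -> (D h d : L) u = h x.
    by move=> ch; rewrite (DE d u ch) du pu mulr1.
  by rewrite -(Ed f cf) E (Ed g cg).
- exact: reduced_comp.
- exact: reduced_N.
- move=> g; have c1 := @continuous_cplx_cst R X 1.
  have ch := continuous_hat_action cX hX oth (g := g^-1%g) c1.
  apply/funext => xi; apply: l2_ext => z; rewrite (DE xi z ch) /comp.
  have [Q|nQ] := pselect (Qset theta (tg_pt z) g^-1%g); last first.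
    by rewrite red_N_out // hat_action_out // mul0r.
  have Q' := QsetV Q; have sK := slideK Q.
  rewrite -slide_pt invgK in Q'; rewrite invgK in sK.
  by rewrite (red_N_in (N g xi) Q) (red_N_in xi Q') sK hat_actionE // mul1r.
- move=> g f cf; have ch := continuous_hat_action cX hX oth (g := g) cf.
  apply/funext => xi; apply: l2_ext => z; rewrite /comp (DE (N g xi) z ch).
  have [Q|nQ] := pselect (Qset theta (tg_pt z) g); last first.
    by rewrite red_N_out // hat_action_out // mul0r.
  rewrite (red_N_in (D f xi) Q) (red_N_in xi Q) (DE xi (slide g z) cf) slide_pt.
  by rewrite hat_actionE.
- exact: reduced_slice.
Qed.

End ReducedModel.

(** * The partial crossed product *)

Lemma conj_swap (C : numClosedFieldType) (z w : C) : (z^* * w)^* = w^* * z.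
Proof. by rewrite rmorphM /= conjCK mulrC. Qed.

Section CrossedModule.
Context (R : realType) (G : groupType) (X : topologicalType).
Context (theta : ore_action G X).
Local Notation L := (pcp R theta).
Local Notation V := (pcp_module R theta).
Implicit Types (xi eta : L).

Lemma pcp_predP (f : G -> X -> Cplx R) : f \in @pcp_pred R G X theta <->
  [/\ forall g, continuous (f g), forall g x, ~ Qset theta x g -> f g x = 0 &
    exists2 s : X -> R, continuous s &
      {uniform, (fun B : {fset G} => fun x => \sum_(g <- B) cmod (f g x) ^+ 2)
         @ totally --> s}].
Proof. by rewrite inE. Qed.

Lemma pcp_valP xi : pcp_val xi \in @pcp_pred R G X theta.
Proof. by case: xi. Qed.

Lemma pcp_continuous xi g : continuous (xi g).
Proof. by have /pcp_predP[H _ _] := pcp_valP xi; exact: H. Qed.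

Lemma pcp_out xi g x : ~ Qset theta x g -> xi g x = 0.
Proof. by have /pcp_predP[_ H _] := pcp_valP xi; exact: H. Qed.

Lemma pcp_uniform xi : exists2 s : X -> R, continuous s &
  {uniform, (fun B : {fset G} => fun x => \sum_(g <- B) cmod (xi g x) ^+ 2)
     @ totally --> s}.
Proof. by have /pcp_predP[] := pcp_valP xi. Qed.

Lemma pcp_bounded xi x : exists M, forall B : {fset G}, \sum_(g <- B) cmod (xi g x) ^+ 2 <= M.
Proof.
have [s _ /unif_net/(_ 1 ltr01)[A HA]] := pcp_uniform xi.
exists (s x + 1) => B.
apply: (@le_trans _ _ (\sum_(g <- (A `|` B)%fset) cmod (xi g x) ^+ 2)).
  rewrite [leRHS](big_fsetID _ (mem B)) /= (_ : [fset _ in _ | _]%fset = B).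
    by rewrite lerDl; apply: sumr_ge0 => g _; exact: sqr_ge0.
  by apply/fsetP => g; rewrite !inE /= andbC; case: (g \in B); rewrite ?orbT.
have := HA (A `|` B)%fset (fsubsetUl A B) x; rewrite ltr_norml => /andP[]; lra.
Qed.

Definition pcp_of (f : G -> X -> Cplx R) : L := insubd (0 : L) f.

Lemma pcp_ofE f : f \in @pcp_pred R G X theta -> pcp_val (pcp_of f) = f.
Proof. by move=> H; rewrite /pcp_of -[LHS]/(val _) insubdK. Qed.

Lemma pcp_ext xi eta : (forall g x, xi g x = eta g x) -> xi = eta.
Proof.
by move=> H; apply: val_inj; apply/funext => g; apply/funext => x; exact: H.
Qed.

Lemma pcp_addE xi eta g x : (xi + eta : L) g x = xi g x + eta g x.
Proof. by []. Qed.

Lemma pcp_scaleE (c : Cplx R) xi g x : (c *: xi : L) g x = c * xi g x.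
Proof. by []. Qed.

Lemma pcp_sumE (J : Type) (s : seq J) (F : J -> L) g x :
  (\sum_(j <- s) F j : L) g x = \sum_(j <- s) F j g x.
Proof. by elim: s => [|j s IH]; rewrite ?big_nil // !big_cons pcp_addE IH. Qed.

Lemma pcp_ipE xi eta x :
  hm_ip (xi : V) (eta : V) x = usum (fun g => (xi g x)^* * eta g x).
Proof. by []. Qed.

Lemma pcp_ip_sum xi eta x :
  has_usum (fun g => (xi g x)^* * eta g x) (hm_ip (xi : V) (eta : V) x).
Proof.
have [M HM] := pcp_bounded xi x; have [N HN] := pcp_bounded eta x.
by have [l Hl] := usummable_l2 HM HN; rewrite pcp_ipE (usumE Hl).
Qed.

Lemma pcp_ip_conj xi eta x :
  hm_ip (eta : V) (xi : V) x = (hm_ip (xi : V) (eta : V) x)^*.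
Proof.
rewrite [LHS]pcp_ipE; apply: usumE; have := has_usum_conj (@pcp_ip_sum xi eta x).
congr (has_usum _ _); apply/funext => g.
exact: conj_swap.
Qed.

Lemma pcp_ipDr xi eta zeta x : hm_ip (xi : V) ((eta + zeta : L) : V) x =
  hm_ip (xi : V) (eta : V) x + hm_ip (xi : V) (zeta : V) x.
Proof.
rewrite [LHS]pcp_ipE; apply: usumE.
have := has_usumD (@pcp_ip_sum xi eta x) (@pcp_ip_sum xi zeta x).
by congr (has_usum _ _); apply/funext => g; rewrite pcp_addE mulrDr.
Qed.

Lemma pcp_ipDl xi eta zeta x : hm_ip ((eta + zeta : L) : V) (xi : V) x =
  hm_ip (eta : V) (xi : V) x + hm_ip (zeta : V) (xi : V) x.
Proof. by rewrite pcp_ip_conj pcp_ipDr rmorphD /= -!pcp_ip_conj. Qed.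

Lemma pcp_ipZr (c : Cplx R) xi eta x : hm_ip (xi : V) ((c *: eta : L) : V) x =
  c * hm_ip (xi : V) (eta : V) x.
Proof.
rewrite [LHS]pcp_ipE; apply: usumE.
have := has_usumZ (c := c) (@pcp_ip_sum xi eta x).
by congr (has_usum _ _); apply/funext => g; rewrite pcp_scaleE mulrCA.
Qed.

Lemma pcp_ipZl (c : Cplx R) xi eta x : hm_ip ((c *: eta : L) : V) (xi : V) x =
  c^* * hm_ip (eta : V) (xi : V) x.
Proof. by rewrite pcp_ip_conj pcp_ipZr rmorphM /= -!pcp_ip_conj. Qed.

Lemma pcp_ip0 xi x : hm_ip (xi : V) ((0 : L) : V) x = 0.
Proof. by rewrite pcp_ipE usum0 // => g; rewrite mulr0. Qed.

Lemma pcp_adjoint_sym (S T : V -> V) : adjoint_pair S T -> adjoint_pair T S.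
Proof.
move=> ST xi eta; apply/funext => x.
by rewrite pcp_ip_conj -(congr1 (@^~ x) (ST eta xi)) -pcp_ip_conj.
Qed.

(** In particular the intersection that defines the algebra generated by a set of
    adjointable operators ranges over a nonempty family. *)
Lemma adjointable_cstar : cstar_subalgebra (@adjointable R V).
Proof.
split => //.
- exists 0 => xi eta; apply/funext => x.
  by rewrite [LHS]pcp_ip_conj [LHS](congr1 _ (pcp_ip0 eta x)) conjC0 [RHS]pcp_ip0.
- move=> S T [S' HS] [T' HT]; exists (S' + T') => xi eta; apply/funext => x.
  have HSx := congr1 (@^~ x) (HS xi eta); have HTx := congr1 (@^~ x) (HT xi eta).
  by rewrite [LHS]pcp_ipDl [RHS]pcp_ipDr HSx HTx.
- move=> c S [S' HS]; exists (c^* *: S') => xi eta; apply/funext => x.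
  have HSx := congr1 (@^~ x) (HS xi eta).
  by rewrite [LHS]pcp_ipZl [RHS]pcp_ipZr HSx.
- move=> S T [S' HS] [T' HT]; exists (T' \o S') => xi eta.
  exact: etrans (HS (T xi) eta) (HT xi (S' eta)).
- by move=> S T _ ST; exists S; exact: pcp_adjoint_sym.
- by move=> T [].
Qed.

Lemma cstar_gen_subalgebra (B : set (V -> V)) : B `<=` @adjointable R V ->
  cstar_subalgebra (cstar_gen B).
Proof.
move=> BA; split.
- by move=> T HT; apply: HT; split => //; exact: adjointable_cstar.
- by move=> C [cC BC]; exact: cstar0 cC.
- by move=> S T HS HT C CC; have [cC BC] := CC;
    exact: cstarD cC _ _ (HS _ CC) (HT _ CC).
- by move=> c S HS C CC; have [cC BC] := CC; exact: cstarZ cC _ _ (HS _ CC).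
- by move=> S T HS HT C CC; have [cC BC] := CC;
    exact: cstarM cC _ _ (HS _ CC) (HT _ CC).
- by move=> S T HS ST C CC; have [cC BC] := CC; exact: cstar_adjoint cC _ _ (HS _ CC) ST.
- move=> T [aT HT] C CC; have [cC BC] := CC; apply: (cstar_closed cC); split => // e e0.
  by have [S HS HST] := HT e e0; exists S => //; exact: HS.
Qed.

End CrossedModule.

Section CrossedOperators.
Context (R : realType) (G : groupType) (X : topologicalType).
Context (theta : ore_action G X).
Context (cX : compact [set: X]) (hX : hausdorff_space X) (oth : open_images theta).
Local Notation L := (pcp R theta).
Local Notation V := (pcp_module R theta).
Implicit Types (xi eta : L) (f : X -> Cplx R).

Definition crs_D f (xi : V) : V := pcp_of theta (fun g x => hat_action theta g f x * (xi : L) g x).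

Definition crs_N (h : G) (xi : V) : V := pcp_of theta
  (fun g x => if `[< Qset theta x g >] then (xi : L) (g * h)%g x else 0).

Definition crs_delta (k : G) : L := pcp_of theta
  (fun g x => if g == k then hat_action theta k (fun=> 1) x else 0).

Lemma crs_DE f xi g x : continuous f -> (crs_D f xi : L) g x = hat_action theta g f x * xi g x.
Proof.
move=> cf; rewrite pcp_ofE //; apply/pcp_predP.
have cg g' : continuous (fun x => hat_action theta g' f x * xi g' x).
  by apply: continuous_mul; [exact: continuous_hat_action|exact: pcp_continuous].
split=> [//|g' x' Q|]; first by rewrite pcp_out // mulr0.
have [s cs Hs] := pcp_uniform xi.
have [C C0 fC] := continuous_bounded cX cf.
apply: (@unif_dominated R G X (fun g x => cmod (xi g x) ^+ 2)
  (fun g x => cmod (xi g x) ^+ 2)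
  (fun g x => cmod (hat_action theta g f x * xi g x) ^+ 2) (C ^+ 2 + 1) s s) => //.
- by rewrite ltr_wpDl // sqr_ge0.
- by move=> *; exact: sqr_ge0.
- by move=> *; exact: sqr_ge0.
- by move=> *; exact: sqr_ge0.
- move=> g' x'; rewrite cmodM exprMn.
  have hC : cmod (hat_action theta g' f x') ^+ 2 <= C ^+ 2.
    rewrite ler_pXn2r ?nnegrE ?cmod_ge0 // /hat_action; case: ifP => _ //.
    by rewrite cmod0.
  have a0 := sqr_ge0 (cmod (xi g' x')).
  have := ler_wpM2r a0 hC; have := sqr_ge0 C; nra.
- by move=> g'; apply: continuous_cmod2; exact: cg.
Qed.

Lemma crs_NE h xi g x : (crs_N h xi : L) g x =
  if `[< Qset theta x g >] then xi (g * h)%g x else 0.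
Proof.
rewrite pcp_ofE //; apply/pcp_predP.
have cg g' : continuous (fun x => if `[< Qset theta x g' >] then xi (g' * h)%g x else 0).
  have -> : (fun x => if `[< Qset theta x g' >] then xi (g' * h)%g x else 0) =
      (fun x => hat_action theta g' (fun=> 1) x * xi (g' * h)%g x).
    apply/funext => x'; case: asboolP => Q; first by rewrite hat_actionE // mul1r.
    by rewrite hat_action_out // mul0r.
  apply: continuous_mul; last exact: pcp_continuous.
  apply: continuous_hat_action => //; exact: continuous_cplx_cst.
split=> [//|g' x' Q|]; first by case: asboolP.
have [s cs /unif_net Hs] := pcp_uniform xi.
have Hs' : {uniform, (fun B : {fset G} => fun x => \sum_(g <- B) cmod (xi (g * h)%g x) ^+ 2)
    @ totally --> s}.
  apply/unif_net => e e0; have [A HA] := Hs e e0.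
  exists [fset (g * h^-1)%g | g in A]%fset => B AB x'.
  have AB' : (A `<=` [fset (g * h)%g | g in B])%fset.
    apply/fsubsetP => g' gA; apply/imfsetP; exists (g' * h^-1)%g.
      by apply: (fsubsetP AB); apply/imfsetP; exists g'.
    by rewrite -mulgA mulVg mulg1.
  have := HA _ AB' x'; rewrite big_imfset; first exact.
  by move=> g1 g2 _ _ /mulIg.
apply: (@unif_dominated R G X (fun g x => cmod (xi (g * h)%g x) ^+ 2)
  (fun g x => cmod (xi (g * h)%g x) ^+ 2)
  (fun g x => cmod (if `[< Qset theta x g >] then xi (g * h)%g x else 0) ^+ 2) 1 s s) => //.
- by move=> *; exact: sqr_ge0.
- by move=> *; exact: sqr_ge0.
- by move=> *; exact: sqr_ge0.
- move=> g' x'; have a0 := sqr_ge0 (cmod (xi (g' * h)%g x')).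
  by case: asboolP => _; rewrite ?cmod0 ?expr0n /=; lra.
- by move=> g'; apply: continuous_cmod2; exact: cg.
Qed.

Lemma crs_deltaE k g x : crs_delta k g x =
  if g == k then hat_action theta k (fun=> 1) x else 0.
Proof.
rewrite pcp_ofE //; apply/pcp_predP.
pose d g' x' : Cplx R := if g' == k then hat_action theta k (fun=> 1) x' else 0.
have cd : forall g', continuous (d g').
  move=> g'; rewrite /d; case: eqP => _; last exact: continuous_cplx_cst.
  by apply: continuous_hat_action => //; exact: continuous_cplx_cst.
split=> [g'|g' x' Q|]; first exact: cd.
  by case: eqP => // gk; rewrite hat_action_out // -gk.
exists (fun x => cmod (d k x) ^+ 2); first by apply: continuous_cmod2; exact: cd.
apply/unif_net => e e0; exists [fset k]%fset => B kB x'.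
rewrite -(big_fset_incl _ kB) => [|g' _]; last first.
  by rewrite inE => /negbTE ->; rewrite cmod0 expr0n.
by rewrite big_seq_fset1 subrr normr0.
Qed.

End CrossedOperators.

#[global] Opaque pcp_of crs_D crs_N crs_delta.

Section CrossedModel.
Context (R : realType) (G : groupType) (X : topologicalType).
Context (theta : ore_action G X).
Context (cX : compact [set: X]) (hX : hausdorff_space X) (oth : open_images theta).
Local Notation L := (pcp R theta).
Local Notation V := (pcp_module R theta).
Local Notation A := (crossed_product R theta).
Local Notation D := (@crs_D R G X theta).
Local Notation N := (@crs_N R G X theta).
Local Notation delta := (@crs_delta R G X theta).
Implicit Types (xi eta : L) (f : X -> Cplx R) (S T : V -> V).

Let DE f xi g x (cf : continuous f) : (D f xi : L) g x = hat_action theta g f x * xi g x.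
Proof. exact: crs_DE. Qed.

Let NE h xi g x : (N h xi : L) g x = if `[< Qset theta x g >] then xi (g * h)%g x else 0.
Proof. exact: crs_NE. Qed.

Lemma crs_N_in h xi g x : Qset theta x g -> (N h xi : L) g x = xi (g * h)%g x.
Proof. by move=> Q; rewrite NE; case: asboolP. Qed.

Lemma crs_N_out h xi g x : ~ Qset theta x g -> (N h xi : L) g x = 0.
Proof. by move=> Q; rewrite NE; case: asboolP. Qed.

Lemma tau_opP f T : continuous f -> tau_op f T <-> T = D f.
Proof.
move=> cf; split=> [HT|-> xi g x]; last exact: DE.
apply/funext => xi; apply: pcp_ext => g x.
by rewrite (DE xi g x cf); exact: HT.
Qed.

Lemma v_opP h T : v_op h T <-> T = N h.
Proof.
have E xi g x : (if x \in pdom theta g `&` pdom theta (g * h)%g then xi (g * h)%g x else 0)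
    = (N h xi : L) g x.
  rewrite NE; case: asboolP => Q; last by rewrite ifF //; apply/negP => /set_mem[].
  have [Q'|nQ'] := pselect (Qset theta x (g * h)%g).
    by rewrite ifT //; apply/mem_set.
  by rewrite (pcp_out xi nQ'); case: ifP.
split=> [HT|-> xi g x]; last by rewrite E.
apply/funext => xi; apply: pcp_ext => g x; rewrite -E; exact: HT.
Qed.

Lemma crs_D_adjoint f : continuous f -> adjoint_pair (D f) (D (fun x => (f x)^*)).
Proof.
move=> cf xi eta; apply/funext => x; rewrite [LHS]pcp_ipE [RHS]pcp_ipE.
congr usum; apply/funext => g.
rewrite (DE xi g x cf) (DE eta g x (continuous_conj cf)).
have [Q|nQ] := pselect (Qset theta x g); last first.
  by rewrite (pcp_out xi nQ) (pcp_out eta nQ) !mulr0.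
by rewrite !hat_actionE // rmorphM mulrCA mulrA.
Qed.

(** The indicator functions of the domains disappear from the inner products,
    because the components of a vector vanish off the domains. *)
Lemma crs_N_adjoint h : adjoint_pair (N h) (N h^-1%g).
Proof.
move=> xi eta; apply/funext => x; rewrite [LHS]pcp_ipE [RHS]pcp_ipE.
apply: (usum_reindex (s := fun g => (g * h)%g) (t := fun g => (g * h^-1)%g)) => g.
- have [Q|nQ] := pselect (Qset theta x g); last by rewrite (pcp_out eta nQ) mulr0.
  have gK : (g * h * h^-1 = g)%g by rewrite -mulgA mulgV mulg1.
  rewrite (crs_N_in h xi Q) => nz; split => //.
  have [Q'|nQ'] := pselect (Qset theta x (g * h)%g).
    by rewrite (crs_N_in h^-1%g eta Q') gK.
  by case: nz; rewrite (pcp_out xi nQ') conjC0 mul0r.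
- have [Q|nQ] := pselect (Qset theta x g); last by rewrite (pcp_out xi nQ) conjC0 mul0r.
  have gK : (g * h^-1 * h = g)%g by rewrite -mulgA mulVg mulg1.
  rewrite (crs_N_in h^-1%g eta Q) => nz; split => //.
  have [Q'|nQ'] := pselect (Qset theta x (g * h^-1)%g).
    by rewrite (crs_N_in h xi Q') gK.
  by case: nz; rewrite (pcp_out eta nQ') mulr0.
Qed.

Lemma crossed_diagE : crossed_diag R theta = [set D f | f in [set f | continuous f]].
Proof.
apply/seteqP; split => [T [f cf /(tau_opP T cf) ->]|_ [f cf <-]]; first by exists f.
by exists f => //; apply/tau_opP.
Qed.

Lemma crossed_subalgebra : cstar_subalgebra A.
Proof.
apply: cstar_gen_subalgebra => T [[f cf /(tau_opP T cf) ->]|[h /v_opP ->]].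
  by exists (D (fun x => (f x)^*)); exact: crs_D_adjoint.
by exists (N h^-1%g); exact: crs_N_adjoint.
Qed.

Lemma crossed_adjointable T : A T -> adjointable T.
Proof. exact: (cstar_adjointable crossed_subalgebra). Qed.

Lemma crossed_D f : continuous f -> A (D f).
Proof.
move=> cf C [_ BC]; apply: BC; left; exists f => //; exact/tau_opP.
Qed.

Lemma crossed_N h : A (N h).
Proof. by move=> C [_ BC]; apply: BC; right; exists h; exact/v_opP. Qed.

Lemma crs_delta_ip k xi x : hm_ip (xi : V) (delta k : V) x = (xi k x)^*.
Proof.
rewrite [LHS]pcp_ipE (usum1 (j := k)) => [|g /eqP/negbTE gk].
  rewrite crs_deltaE // eqxx.
  have [Q|nQ] := pselect (Qset theta x k); last by rewrite (pcp_out xi nQ) conjC0 mul0r.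
  by rewrite hat_actionE // mulr1.
by rewrite crs_deltaE // gk mulr0.
Qed.

Lemma crs_D_delta f : continuous f -> forall g x,
  (D f (delta 1%g) : L) g x = f x * delta 1%g g x.
Proof.
move=> cf g x; rewrite (DE (delta 1%g) g x cf) crs_deltaE //.
by case: eqP => [->|_]; rewrite ?mulr0 // !hat_action1.
Qed.

(** Adjointable operators are linear over the functions on [X], and [D f] acts on
    the basis vector at the identity as the multiplication by [f]. *)
Lemma adjointable_D_delta T f k x : adjointable T -> continuous f ->
  (T (D f (delta 1%g)) : L) k x = f x * (T (delta 1%g) : L) k x.
Proof.
move=> [S TS] cf; apply: (can_inj conjCK); rewrite rmorphM.
have C1 := crs_delta_ip k (T (D f (delta 1%g))) x.
have C2 := crs_delta_ip k (T (delta 1%g)) x.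
have E1 := congr1 (@^~ x) (TS (D f (delta 1%g)) (delta k)).
have E2 := congr1 (@^~ x) (TS (delta 1%g) (delta k)).
rewrite -[X in X = _]C1 -[X in _ = _ * X]C2 [LHS]E1 [X in _ = _ * X]E2.
have H := has_usumZ (c := (f x)^*)
  (@pcp_ip_sum R G X theta (delta 1%g) (S (delta k)) x).
rewrite [LHS]pcp_ipE; apply: usumE; move: H; congr (has_usum _ _).
by apply/funext => g; rewrite (crs_D_delta cf) rmorphM mulrA.
Qed.

(** The components of [T] applied to the basis vector at the identity are
    continuous; at [x] they do not all vanish, since [S] has an adjoint and maps
    the image under [T] to a vector whose component at the identity is [p x]. *)
Lemma crossed_slice S T (p : X -> Cplx R) x : A T -> A S -> S \o T = D p ->
  continuous p -> p x <> 0 ->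
  exists k, \forall x' \near x, Qset theta x' k /\
    forall c c' : X -> Cplx R, continuous c -> continuous c' ->
      T \o D c = D c' \o T -> c x' = c' (uact theta x' k).
Proof.
move=> AT AS STp cp px; pose eta : L := T (delta 1%g).
have [k nz] : exists k, eta k x <> 0.
  apply: contrapT => none; apply: px.
  have [S' SS'] := crossed_adjointable AS.
  have E := congr1 (@^~ x) (SS' eta (delta 1%g)).
  have C1 := crs_delta_ip 1%g (S eta) x.
  have C2 : hm_ip (eta : V) (S' (delta 1%g)) x = 0.
    rewrite [LHS]pcp_ipE usum0 // => g.
    rewrite (_ : eta g x = 0) ?conjC0 ?mul0r //.
    by apply: contrapT => nz; apply: none; exists g.
  have E1 : (S eta : L) 1%g x = p x.
    rewrite -[S eta]/((S \o T) (delta 1%g)) STp crs_D_delta // crs_deltaE // eqxx.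
    by rewrite hat_action1 mulr1.
  by rewrite -E1 -[LHS]conjCK -C1 [X in X^* = _]E C2 conjC0.
have Qx : Qset theta x k by apply: contrapT => nQ; apply: nz; exact: pcp_out.
exists k; have H1 := near_pdom oth Qx.
have e0 : 0 < cmod (eta k x).
  by rewrite lt_neqAle cmod_ge0 andbT eq_sym; apply/eqP => /cmod_eq0.
have H2 : \forall x' \near x, cmod (eta k x - eta k x') < cmod (eta k x).
  have /continuous_cmodP H := @pcp_continuous R G X theta eta k; exact: H.
apply: filterS2 H1 H2 => x' Q' nz'; split => // c c' cc cc' E.
have E1 := adjointable_D_delta k x' (crossed_adjointable AT) cc.
have E2 := DE eta k x' cc'; rewrite hat_actionE // in E2.
have E3 := congr1 (fun W => (W (delta 1%g) : L) k x') E.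
apply: (mulIf (x := eta k x')).
  by apply: contraTneq nz' => ->; rewrite subr0 ltxx.
by rewrite -E2 -[LHS]E1; exact: E3.
Qed.

Lemma crossed_model : diagonal_model theta A (crossed_diag R theta) D N.
Proof.
have hD g (f f' : X -> Cplx R) x : hat_action theta g (fun x => f x + f' x) x =
    hat_action theta g f x + hat_action theta g f' x.
  have [Q|nQ] := pselect (Qset theta x g); first by rewrite !hat_actionE.
  by rewrite !hat_action_out // addr0.
have hM g (f f' : X -> Cplx R) x : hat_action theta g (fun x => f x * f' x) x =
    hat_action theta g f x * hat_action theta g f' x.
  have [Q|nQ] := pselect (Qset theta x g); first by rewrite !hat_actionE.
  by rewrite !hat_action_out // mulr0.
have hZ g (c : Cplx R) f x : hat_action theta g (fun x => c * f x) x =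
    c * hat_action theta g f x.
  have [Q|nQ] := pselect (Qset theta x g); first by rewrite !hat_actionE.
  by rewrite !hat_action_out // mulr0.
split.
- exact: crossed_diagE.
- exact: crossed_D.
- move=> f f' cf cf'; apply/funext => xi; apply: pcp_ext => g x.
  rewrite (DE xi g x (continuous_add cf cf')) hD mulrDl.
  by rewrite -[RHS]/((D f xi : L) g x + (D f' xi : L) g x) (DE xi g x cf) (DE xi g x cf').
- move=> f f' cf cf'; apply/funext => xi; apply: pcp_ext => g x.
  rewrite (DE xi g x (continuous_mul cf cf')) hM.
  by rewrite -[RHS]/((D f (D f' xi) : L) g x) (DE (D f' xi) g x cf) (DE xi g x cf') mulrA.
- move=> c f cf; apply/funext => xi; apply: pcp_ext => g x.
  rewrite (DE xi g x (continuous_scale cf)) hZ.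
  by rewrite -[RHS]/(c * (D f xi : L) g x) (DE xi g x cf) mulrA.
- move=> f f' cf cf' E; apply/funext => x.
  have Ed f'' : continuous f'' -> (D f'' (delta 1%g) : L) 1%g x = f'' x.
    by move=> cf''; rewrite crs_D_delta // crs_deltaE // eqxx hat_action1 mulr1.
  by rewrite -(Ed f cf) E (Ed f' cf').
- by move=> S T AS AT; exact: (cstarM crossed_subalgebra).
- exact: crossed_N.
- move=> h; have ch := continuous_hat_action cX hX oth (g := h^-1%g) (@continuous_cplx_cst R X 1).
  apply/funext => xi; apply: pcp_ext => g x; rewrite (DE xi g x ch) /comp.
  have [Q|nQ] := pselect (Qset theta x g); last first.
    by rewrite (crs_N_out _ _ nQ) hat_action_out // mul0r.
  rewrite (crs_N_in h^-1%g (N h xi) Q) hat_actionE //.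
  have [Q'|nQ'] := pselect (Qset theta x (g * h^-1)%g).
    rewrite (crs_N_in h xi Q') -mulgA mulVg mulg1 hat_actionE ?mul1r //.
    have := QsetVM Q Q'; by rewrite mulgA mulVg mul1g.
  rewrite (crs_N_out h xi nQ') hat_action_out ?mul0r // => Q''.
  by apply: nQ'; exact: QsetM.
- move=> h f cf; have ch := continuous_hat_action cX hX oth (g := h) cf.
  apply/funext => xi; apply: pcp_ext => g x; rewrite /comp (DE (N h xi) g x ch).
  have [Q|nQ] := pselect (Qset theta x g); last first.
    by rewrite (crs_N_out _ _ nQ) hat_action_out // mul0r.
  rewrite (crs_N_in h (D f xi) Q) (crs_N_in h xi Q) (DE xi (g * h)%g x cf) (hat_actionE _ Q).
  have [Q'|nQ'] := pselect (Qset theta x (g * h)%g); last first.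
    by rewrite (pcp_out xi nQ') !mulr0.
  have Qu : Qset theta (uact theta x g) h.
    by have := QsetVM Q Q'; rewrite mulgA mulVg mul1g.
  by rewrite (hat_actionE _ Q') (hat_actionE _ Qu) uactM.
- exact: crossed_slice.
Qed.

End CrossedModel.

(** * Isomorphisms implemented by unitaries *)

(** The bases of the two Hilbert modules may differ: [beta] is the induced map
    between them. *)
Record unitary (R : realType) (V W : hilbert_module R) (U : V -> W) (U' : W -> V)
    (beta : hm_base W -> hm_base V) : Prop := Unitary {
  un_can : cancel U U';
  un_canV : cancel U' U;
  un_add : forall x y, U (x + y) = U x + U y;
  un_scale : forall (c : Cplx R) x, U (c *: x) = c *: U x;
  un_ip : forall x y k, hm_ip (U x) (U y) k = hm_ip x y (beta k);
  un_surj : forall k, exists k', beta k' = k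
}.

Section UnitaryConjugation.
Variables (R : realType) (V W : hilbert_module R) (U : V -> W) (U' : W -> V).
Variables (beta : hm_base W -> hm_base V).
Hypothesis un : unitary U U' beta.

Definition conj_op (T : V -> V) : W -> W := U \o T \o U'.

Lemma un_sub x y : U (x - y) = U x - U y.
Proof. by rewrite (un_add un) -[- y]scaleN1r (un_scale un) scaleN1r. Qed.

Lemma un_norm x : hm_norm (U x) = hm_norm x.
Proof.
rewrite /hm_norm; congr (Num.sqrt (sup _)).
apply/seteqP; split => [_ [k _ <-]|_ [k _ <-]].
  by exists (beta k) => //; rewrite (un_ip un).
by have [k' <-] := un_surj un k; exists k' => //; rewrite (un_ip un).
Qed.

Lemma conj_op_adjoint S T : adjoint_pair S T -> adjoint_pair (conj_op S) (conj_op T).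
Proof.
move=> ST xi eta; apply/funext => k; rewrite /conj_op /comp.
rewrite -{1}(un_canV un eta) -{2}(un_canV un xi) !(un_ip un).
by rewrite ST.
Qed.

Lemma conj_op_closure (B : set (V -> V)) (C : set (W -> W)) :
  (forall T, B T -> C (conj_op T)) -> forall T, op_closure B T -> op_closure C (conj_op T).
Proof.
move=> BC T [[S TS] HT]; split; first by exists (conj_op S); exact: conj_op_adjoint.
move=> e e0; have [S' BS' HS'] := HT e e0; exists (conj_op S'); first exact: BC.
move=> xi; rewrite /conj_op /comp -un_sub un_norm.
by apply: le_trans (HS' _) _; rewrite -[in leRHS](un_canV un xi) un_norm.
Qed.

Lemma conj_op_isomorphism (A Dg : set (V -> V)) (B Eg : set (W -> W)) :
  (forall T, A T -> B (conj_op T)) -> (forall S, B S -> A (U' \o S \o U)) ->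
  (forall T, Dg T -> Eg (conj_op T)) -> (forall S, Eg S -> Dg (U' \o S \o U)) ->
  exists Phi, cstar_isomorphism A B Phi /\ Phi @` Dg = Eg.
Proof.
move=> AB BA DE ED; exists conj_op.
have conjK S : conj_op (U' \o S \o U) = S.
  by apply/funext => w; rewrite /conj_op /comp !(un_canV un).
split; last first.
  apply/seteqP; split => [_ [T DT <-]|S ES]; first exact: DE.
  by exists (U' \o S \o U); [exact: ED|exact: conjK].
split.
- split; first by move=> T AT; exact: AB.
    move=> S T _ _ E; apply/funext => v.
    by have := congr1 (fun P => U' (P (U v))) E; rewrite /conj_op /comp !(un_can un).
  by move=> S BS; exists (U' \o S \o U); [exact: BA|exact: conjK].
- move=> S T _ _; apply/funext => w; exact: (un_add un).
- move=> c S _; apply/funext => w; exact: (un_scale un).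
- by move=> S T _ _; apply/funext => w; rewrite /conj_op /comp (un_can un).
- by move=> S T _ _; exact: conj_op_adjoint.
Qed.

End UnitaryConjugation.

(** * Transport of the reduced algebra *)

Section L2Transport.
Variables (R : realType) (I J : choiceType) (s : I -> J) (t : J -> I).
Hypotheses (sK : cancel s t) (tK : cancel t s).

Definition l2_push (xi : l2_module R I) : l2_module R J :=
  l2_of (fun j => (xi : l2 R I) (t j)).

Lemma l2_pushE (xi : l2 R I) j : (l2_push xi : l2 R J) j = xi (t j).
Proof.
rewrite l2_ofE //; apply/l2_predP; have [M HM] := l2_bounded xi.
exists M => B; have := HM [fset t j | j in B]%fset; rewrite big_imfset //.
by move=> i i' _ _; exact: (can_inj tK).
Qed.

End L2Transport.

Section L2Unitary.
Variables (R : realType) (I J : choiceType) (s : I -> J) (t : J -> I).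
Hypotheses (sK : cancel s t) (tK : cancel t s).

Lemma l2_push_unitary : unitary (l2_push (R := R) t) (l2_push (R := R) s) id.
Proof.
split.
- by move=> xi; apply: l2_ext => i; rewrite (l2_pushE sK) (l2_pushE tK) sK.
- by move=> xi; apply: l2_ext => j; rewrite (l2_pushE tK) (l2_pushE sK) tK.
- move=> xi eta; apply: l2_ext => j; rewrite (l2_pushE tK).
  rewrite -[RHS]/((l2_push t xi : l2 R J) j + (l2_push t eta : l2 R J) j).
  by rewrite !(l2_pushE tK).
- move=> c xi; apply: l2_ext => j; rewrite (l2_pushE tK).
  by rewrite -[RHS]/(c * (l2_push t xi : l2 R J) j) (l2_pushE tK).
- move=> xi eta k.
  change (usum (fun j => ((l2_push t xi : l2 R J) j)^* * (l2_push t eta : l2 R J) j) =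
    usum (fun i => ((xi : l2 R I) i)^* * (eta : l2 R I) i)).
  apply/esym/(usum_reindex (s := s) (t := t)) => [i|j] _.
    by rewrite !(l2_pushE tK) !sK.
  by rewrite !(l2_pushE tK) tK.
- by move=> k; exists k.
Qed.

End L2Unitary.

Section ReducedTransport.
Variables (R : realType) (K L : groupoid) (F : K -> L) (F' : L -> K).
Hypotheses (FK : cancel F F') (FK' : cancel F' F).
Hypotheses (mF : groupoid_morphism F) (mF' : groupoid_morphism F').
Hypotheses (cF : continuous F) (cF' : continuous F').

Lemma Cc_transport (f : K -> Cplx R) : Cc f -> Cc (f \o F').
Proof.
move=> [cf Kf]; split.
  by move=> b; apply: continuous_comp; [exact: cF'|exact: cf].
have cI : compact (F @` closure [set a | f a <> 0]).
  by apply: continuous_compact => //; apply: continuous_subspaceT.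
apply: (subclosed_compact _ cI); first exact: closed_closure.
move=> b Hb; exists (F' b); last exact: FK'.
move=> W /cF' /Hb[b' [fb' Wb']].
by exists (F' b').
Qed.

Lemma regular_op_transport (f : K -> Cplx R) (T : l2_module R K -> l2_module R K) :
  regular_op f T -> regular_op (f \o F') (conj_op (l2_push F') (l2_push F) T).
Proof.
move=> fT xi c; rewrite /conj_op /comp (l2_pushE FK') fT.
rewrite (reindex_fsbig F' [set b : L | grng b = grng c] [set a : K | grng a = grng (F' c)]).
  apply: eq_fsbigr => b /set_mem rb; rewrite (l2_pushE FK); congr (_ * xi _).
  have rb' : grng (F' b) = grng (F' c) by rewrite !(morphism_rng mF') rb.
  have E : gsrc (ginv (F' b)) = grng (F' c).
    by rewrite (gax_srcV (groupoidP K)).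
  by have [_ ->] := mF E; rewrite (morphism_inv mF) !FK'.
split.
- by move=> b rb; rewrite /= !(morphism_rng mF') rb.
- by move=> b b' _ _; exact: (can_inj FK').
- move=> a ra; exists (F a); last exact: FK.
  have ra' : grng a = grng (F' c) := ra.
  by rewrite /= (morphism_rng mF) ra' -(morphism_rng mF) FK'.
Qed.

Lemma reduced_cstar_transport (T : l2_module R K -> l2_module R K) :
  reduced_cstar R K T -> reduced_cstar R L (conj_op (l2_push F') (l2_push F) T).
Proof.
apply: (conj_op_closure (l2_push_unitary R FK FK')) => S [f Cf fS].
by exists (f \o F'); [exact: Cc_transport|exact: regular_op_transport].
Qed.

Lemma reduced_diag_transport (T : l2_module R K -> l2_module R K) :
  reduced_diag R K T -> reduced_diag R L (conj_op (l2_push F') (l2_push F) T).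
Proof.
move=> [f [Cf f1 fT]]; exists (f \o F'); split.
- exact: Cc_transport.
- move=> b rb; apply: f1 => rFb; apply: rb; apply: (can_inj FK').
  by rewrite -(morphism_rng mF').
- exact: regular_op_transport.
Qed.

End ReducedTransport.

Lemma etale_isomorphic_reduced (R : realType) (K L : groupoid) :
  etale_isomorphic K L -> exists Phi,
    cstar_isomorphism (reduced_cstar R K) (reduced_cstar R L) Phi /\
    Phi @` reduced_diag R K = reduced_diag R L.
Proof.
move=> [F [F' [FK FK' mF mF' [cF cF']]]].
apply: (conj_op_isomorphism (l2_push_unitary R FK FK')) => T HT.
- exact: (reduced_cstar_transport FK FK' mF mF' cF cF').
- exact: (reduced_cstar_transport FK' FK mF' mF cF' cF).
- exact: (reduced_diag_transport FK FK' mF mF' cF cF').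
- exact: (reduced_diag_transport FK' FK mF' mF cF' cF).
Qed.

(** * Transport of the partial crossed product *)

(** The operators whose conjugate is in [C] form a C*-subalgebra. *)
Lemma cstar_gen_transport (R : realType) (G H : groupType) (X Y : topologicalType)
    (theta : ore_action G X) (rho : ore_action H Y)
    (U : pcp_module R theta -> pcp_module R rho) U' beta
    (B : set (pcp_module R theta -> pcp_module R theta))
    (C : set (pcp_module R rho -> pcp_module R rho)) :
  unitary U U' beta -> B `<=` @adjointable R (pcp_module R theta) ->
  cstar_subalgebra C -> (forall T, B T -> C (conj_op U U' T)) ->
  forall T, cstar_gen B T -> C (conj_op U U' T).
Proof.
move=> un Badj cC BC T HT.
pose P := [set T | adjointable T /\ C (conj_op U U' T)].
suff [] : P T by [].
have cA := adjointable_cstar R theta.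
have U0 : U 0 = 0 by rewrite -[X in U X](scale0r 0) (un_scale un) scale0r.
apply: HT; split; last by move=> S BS; split; [exact: Badj|exact: BC].
split.
- by move=> S [].
- split; first exact: cstar0.
  by rewrite (_ : conj_op U U' 0 = 0); [exact: cstar0|apply/funext => w; exact: U0].
- move=> S S' [aS CS] [aS' CS']; split; first exact: cstarD.
  rewrite (_ : conj_op U U' (S + S') = conj_op U U' S + conj_op U U' S').
    exact: cstarD.
  by apply/funext => w; exact: (un_add un).
- move=> c S [aS CS]; split; first exact: cstarZ.
  rewrite (_ : conj_op U U' (c *: S) = c *: conj_op U U' S); first exact: cstarZ.
  by apply/funext => w; exact: (un_scale un).
- move=> S S' [aS CS] [aS' CS']; split; first exact: cstarM.
  rewrite (_ : conj_op U U' (S \o S') = conj_op U U' S \o conj_op U U' S').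
    exact: cstarM.
  by apply/funext => w; rewrite /conj_op /comp (un_can un).
- move=> S S' [aS CS] SS'; split; first exact: cstar_adjoint cA _ _ aS SS'.
  exact: cstar_adjoint cC _ _ CS (conj_op_adjoint un SS').
- move=> S [aS HS]; split => //; apply: (cstar_closed cC).
  apply: (conj_op_closure un (B := P)) => [S' []//|].
  by split.
Qed.

Section CocycleFiniteness.
Variables (G H : groupType) (X Y : topologicalType).
Variables (theta : ore_action G X) (rho : ore_action H Y).
Variables (phi : X -> Y) (psi : Y -> X) (a : X -> G -> H) (b : Y -> H -> G).
Hypotheses (cX : compact [set: X]) (hX : hausdorff_space X) (oth : open_images theta).
Hypothesis half : cocycle_half theta rho phi psi a b.

(** On the compact domain of [g] a locally constant map takes finitely many
    values. *)
Lemma cocycle_finite (s : seq G) : exists B : {fset H},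
  forall g x, g \in s -> Qset theta x g -> a x g \in B.
Proof.
elim: s => [|g s [B HB]]; first by exists fset0.
have cQ : compact (pdom theta g).
  by apply: (subclosed_compact _ cX) => //; exact: pdom_closed.
have /compact_near_coveringP cov := cQ.
have [|B1 _ HB1] := cov {fset H} totally (fun B x => Qset theta x g -> a x g \in B) _.
  move=> x Q; exists ([set x' | Qset theta x' g -> a x' g = a x g],
    [set B | ([fset a x g] `<=` B)%fset]).
    by split; [exact: (ch_near half Q)|exists [fset a x g]%fset].
  move=> [x' B2] [/= E /fsubsetP sub] Q'.
  by rewrite E //; apply: sub; rewrite inE.
exists (B1 `|` B)%fset => g' x; rewrite in_cons in_fsetU => /orP[/eqP ->|gs] Q.
  by rewrite (HB1 B1 (fsubset_refl _) x Q Q).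
by rewrite (HB g') ?orbT.
Qed.

End CocycleFiniteness.

Section CrossedPush.
Variables (R : realType) (G H : groupType) (X Y : topologicalType).
Variables (theta : ore_action G X) (rho : ore_action H Y).
Variables (phi : X -> Y) (psi : Y -> X) (a : X -> G -> H) (b : Y -> H -> G).
Hypotheses (cX : compact [set: X]) (hX : hausdorff_space X) (oth : open_images theta).
Hypotheses (cY : compact [set: Y]) (hY : hausdorff_space Y) (orh : open_images rho).
Hypothesis h1 : cocycle_half theta rho phi psi a b.
Hypothesis h2 : cocycle_half rho theta psi phi b a.

(** In terms of functions on arrows: composition with the inverse of the
    groupoid isomorphism. *)
Definition crs_push (xi : pcp_module R theta) : pcp_module R rho :=
  pcp_of rho (fun h y => if `[< Qset rho y h >] then (xi : pcp R theta) (b y h) (psi y) else 0).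

(** The convergence stays uniform: the tail of the sum over [H] beyond the finitely
    many values of the cocycle at a finite subset of [G] is a tail of the sum over
    [G] beyond this subset. *)
Lemma crs_push_mem (xi : pcp R theta) :
  (fun h y => if `[< Qset rho y h >] then xi (b y h) (psi y) else 0)
    \in @pcp_pred R H Y rho.
Proof.
apply/pcp_predP; split.
- move=> h; apply/continuous_cmodP => y e e0.
  have [Q|nQ] := pselect (Qset rho y h); last first.
    have K := near_npdom cY hY nQ; apply: filterS K => y' nQ'.
    by case: asboolP => // _; case: asboolP => // _; rewrite subrr cmod0.
  have /continuous_cmodP cxi := @pcp_continuous R G X theta xi (b y h).
  have K1 : \forall y' \near y, cmod (xi (b y h) (psi y) - xi (b y h) (psi y')) < e.
    exact: (ch_cont h2 (cxi (psi y) e e0)).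
  have K2 := near_pdom orh Q; have K3 := ch_near h2 Q.
  apply: filterS3 K1 K2 K3 => y' E1 Q' Eb.
  by case: asboolP => // _; case: asboolP => // _; rewrite Eb.
- by move=> h y nQ; case: asboolP.
have [s cs /unif_net Hs] := pcp_uniform xi.
exists (s \o psi).
  by move=> y; apply: continuous_comp; [exact: (ch_cont h2)|exact: cs].
apply/unif_net => e e0; have [A HA] := Hs e e0.
have [A' HA'] := cocycle_finite cX hX h1 A.
exists A' => B A'B y.
pose B0 := [fset h in B | `[< Qset rho y h >]]%fset.
pose D := [fset b y h | h in B0]%fset.
have B0Q h : h \in B0 -> Qset rho y h by rewrite !inE => /andP[_ /asboolP].
have binj : {in B0 &, injective (b y)}.
  by move=> h h' /B0Q Q /B0Q Q' E; rewrite -(ch_b h2 Q) E (ch_b h2 Q').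
suff -> : \sum_(h <- B) cmod (if `[< Qset rho y h >] then xi (b y h) (psi y) else 0) ^+ 2
    = \sum_(g <- (A `|` D)%fset) cmod (xi g (psi y)) ^+ 2.
  by apply: HA; exact: fsubsetUl.
transitivity (\sum_(h <- B0) cmod (xi (b y h) (psi y)) ^+ 2).
  transitivity (\sum_(h <- B0)
      cmod (if `[< Qset rho y h >] then xi (b y h) (psi y) else 0) ^+ 2).
    apply/esym/big_fset_incl; first by apply/fsubsetP => h; rewrite !inE => /andP[].
    move=> h hB; rewrite !inE hB /=; case: asboolP => // _ _.
    by rewrite cmod0 expr0n.
  by apply: eq_big_seq => h /B0Q Q; case: asboolP.
transitivity (\sum_(g <- D) cmod (xi g (psi y)) ^+ 2).
  by rewrite [RHS]big_imfset.
apply: big_fset_incl; first exact: fsubsetUr.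
move=> g; rewrite in_fsetU => /orP[gA|->//] gD.
rewrite (_ : xi g (psi y) = 0) ?cmod0 ?expr0n //.
apply: contrapT => nz; move/negP: gD; apply.
have Q : Qset theta (psi y) g by apply: contrapT => nQ; apply: nz; exact: pcp_out.
have Qa := ch_Q h1 Q; rewrite (ch_can h2) in Qa.
apply/imfsetP; exists (a (psi y) g) => /=.
  rewrite !inE; apply/andP; split; last exact/asboolP.
  by apply: (fsubsetP A'B); exact: HA'.
by have := ch_b h1 Q; rewrite (ch_can h2).
Qed.

Lemma crs_pushE (xi : pcp R theta) h y : (crs_push xi : pcp R rho) h y =
  if `[< Qset rho y h >] then xi (b y h) (psi y) else 0.
Proof. by rewrite pcp_ofE //; exact: crs_push_mem. Qed.

Lemma crs_push_in (xi : pcp R theta) h y : Qset rho y h ->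
  (crs_push xi : pcp R rho) h y = xi (b y h) (psi y).
Proof. by move=> Q; rewrite crs_pushE; case: asboolP. Qed.

Lemma crs_push_out (xi : pcp R theta) h y : ~ Qset rho y h ->
  (crs_push xi : pcp R rho) h y = 0.
Proof. by move=> Q; rewrite crs_pushE; case: asboolP. Qed.

End CrossedPush.

#[global] Opaque crs_push.

Section CrossedUnitary.
Variables (R : realType) (G H : groupType) (X Y : topologicalType).
Variables (theta : ore_action G X) (rho : ore_action H Y).
Variables (phi : X -> Y) (psi : Y -> X) (a : X -> G -> H) (b : Y -> H -> G).
Hypotheses (cX : compact [set: X]) (hX : hausdorff_space X) (oth : open_images theta).
Hypotheses (cY : compact [set: Y]) (hY : hausdorff_space Y) (orh : open_images rho).
Hypothesis h1 : cocycle_half theta rho phi psi a b.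
Hypothesis h2 : cocycle_half rho theta psi phi b a.
Local Notation U := (@crs_push R G H X Y theta rho psi b).
Local Notation U' := (@crs_push R H G Y X rho theta phi a).

Let push_in (xi : pcp R theta) h y : Qset rho y h ->
  (U xi : pcp R rho) h y = xi (b y h) (psi y).
Proof. exact: (crs_push_in cX hX cY hY orh h1 h2). Qed.

Let push_out (xi : pcp R theta) h y : ~ Qset rho y h -> (U xi : pcp R rho) h y = 0.
Proof. exact: (crs_push_out cX hX cY hY orh h1 h2). Qed.

Let pull_in (eta : pcp R rho) g x : Qset theta x g ->
  (U' eta : pcp R theta) g x = eta (a x g) (phi x).
Proof. exact: (crs_push_in cY hY cX hX oth h2 h1). Qed.

Lemma crs_pushK (xi : pcp R theta) : U' (U xi) = xi.
Proof.
apply: pcp_ext => g x; have [Q|nQ] := pselect (Qset theta x g); last first.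
  by rewrite (pcp_out _ nQ) (pcp_out xi nQ).
rewrite (pull_in (U xi) Q) (push_in xi (ch_Q h1 Q)).
by rewrite (ch_b h1 Q) (ch_can h1).
Qed.

Lemma crs_push_ip (xi eta : pcp R theta) y :
  hm_ip (U xi) (U eta) y = hm_ip (xi : pcp_module R theta) (eta : pcp_module R theta) (psi y).
Proof.
rewrite [LHS]pcp_ipE [RHS]pcp_ipE.
apply: (usum_reindex (s := b y) (t := a (psi y))) => [h|g] nz.
- have Q : Qset rho y h.
    apply: contrapT => nQ; apply: nz.
    by rewrite (push_out xi nQ) conjC0 mul0r.
  by rewrite (push_in xi Q) (push_in eta Q) (ch_b h2 Q).
- have Q : Qset theta (psi y) g.
    by apply: contrapT => nQ; apply: nz; rewrite (pcp_out xi nQ) conjC0 mul0r.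
  have Qa := ch_Q h1 Q; have Eb := ch_b h1 Q; rewrite (ch_can h2) in Qa Eb.
  by rewrite (push_in xi Qa) (push_in eta Qa) Eb.
Qed.

Lemma crs_push_add (xi eta : pcp R theta) :
  U (xi + eta : pcp R theta) = (U xi + U eta : pcp R rho).
Proof.
apply: pcp_ext => h y; rewrite pcp_addE.
have [Q|nQ] := pselect (Qset rho y h).
  by rewrite (push_in _ Q) (push_in xi Q) (push_in eta Q).
by rewrite (push_out _ nQ) (push_out xi nQ) (push_out eta nQ) addr0.
Qed.

Lemma crs_push_scale (c : Cplx R) (xi : pcp R theta) :
  U (c *: xi : pcp R theta) = (c *: U xi : pcp R rho).
Proof.
apply: pcp_ext => h y; rewrite pcp_scaleE.
have [Q|nQ] := pselect (Qset rho y h).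
  by rewrite (push_in _ Q) (push_in xi Q).
by rewrite (push_out _ nQ) (push_out xi nQ) mulr0.
Qed.

Lemma conj_crs_D (f : X -> Cplx R) : continuous f ->
  conj_op U U' (crs_D f) = crs_D (f \o psi).
Proof.
move=> cf; apply/funext => eta; apply: pcp_ext => h y.
have cfp : continuous (f \o psi).
  by move=> y'; apply: continuous_comp; [exact: (ch_cont h2)|exact: cf].
rewrite (crs_DE cY hY orh eta h y cfp) /conj_op /comp.
have [Q|nQ] := pselect (Qset rho y h); last first.
  by rewrite (push_out _ nQ) (pcp_out eta nQ) mulr0.
have Qb := ch_Q h2 Q; have Ea := ch_b h2 Q.
rewrite (push_in _ Q) (crs_DE cX hX oth (U' eta) _ _ cf) (pull_in eta Qb).
by rewrite (hat_actionE _ Qb) (hat_actionE _ Q) -(ch_u h2 Q) Ea (ch_can h2).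
Qed.

Lemma crossed_sum (s : seq H) (w : H -> Y -> Cplx R) : (forall k, continuous (w k)) ->
  crossed_product R rho (fun eta => \sum_(k <- s) (crs_D (w k) (crs_N k eta) : pcp R rho)).
Proof.
move=> cw; have cA := crossed_subalgebra R cY hY orh.
elim: s => [|k s IH].
  rewrite (_ : (fun eta => _) = 0); first exact: (cstar0 cA).
  by apply/funext => eta; rewrite big_nil.
rewrite (_ : (fun eta => _) = (crs_D (w k) \o crs_N k) +
    (fun eta => \sum_(k <- s) (crs_D (w k) (crs_N k eta) : pcp R rho))).
  apply: (cstarD cA) => //; apply: (cstarM cA).
    exact: crossed_D.
  exact: crossed_N.
by apply/funext => eta; rewrite big_cons.
Qed.

(** The copy of the domain of [g] is carried to finitely many clopen pieces, on
    each of which the cocycle is constant. *)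
Lemma conj_crs_N g : crossed_product R rho (conj_op U U' (crs_N g)).
Proof.
have [B HB] := cocycle_finite cX hX h1 [:: g].
pose w k y : Cplx R :=
  if `[< Qset theta (psi y) g /\ a (psi y) g = k >] then 1 else 0.
have cw k : continuous (w k).
  apply: continuous_near => y; have [Q|nQ] := pselect (Qset theta (psi y) g).
    have K : \forall x' \near psi y, a x' g = a (psi y) g /\ Qset theta x' g.
      have K1 := near_pdom oth Q; have K2 := ch_near h1 Q.
      by apply: filterS2 K1 K2 => x' Q' Ea; split => //; exact: Ea.
    have K' : \forall y' \near y, a (psi y') g = a (psi y) g /\ Qset theta (psi y') g.
      exact: (ch_cont h2 K).
    apply: filterS K' => y' [Ea Q']; rewrite /w Ea.
    by congr (if _ then _ else _); apply: asbool_equiv_eq; split => -[].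
  have K' : \forall y' \near y, ~ Qset theta (psi y') g.
    exact: (ch_cont h2 (near_npdom cX hX nQ)).
  apply: filterS K' => y' nQ'; rewrite /w.
  by case: asboolP => [[]//|_]; case: asboolP => [[]|].
have := crossed_sum B cw; congr (crossed_product _ _).
apply/funext => eta; apply: pcp_ext => h y; rewrite pcp_sumE /conj_op /comp.
have [Q|nQ] := pselect (Qset rho y h); last first.
  by rewrite (pcp_out _ nQ) big1 // => k _; rewrite (pcp_out _ nQ).
have Qb := ch_Q h2 Q; have Ea := ch_b h2 Q; have ub := ch_u h2 Q.
rewrite (push_in _ Q) (crs_N_in cX hX oth g (U' eta) Qb).
have T k : (crs_D (w k) (crs_N k eta) : pcp R rho) h y =
    w k (uact rho y h) * eta (h * k)%g y.
  rewrite (crs_DE cY hY orh _ h y (cw k)) (hat_actionE _ Q).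
  by rewrite (crs_N_in cY hY orh k eta Q).
under eq_bigr do rewrite T.
have [Qg|nQg] := pselect (Qset theta (psi (uact rho y h)) g); last first.
  rewrite big1 => [|k _]; last by rewrite /w; case: asboolP => [[]//|_]; rewrite mul0r.
  rewrite (pcp_out (U' eta)) // => Q2; apply: nQg; rewrite ub.
  by have := QsetVM Qb Q2; rewrite mulgA mulVg mul1g.
have Qg' : Qset theta (uact theta (psi y) (b y h)) g by rewrite -ub.
rewrite (pull_in eta (QsetM Qb Qg')) (ch_can h2) (ch_M h1 Qb Qg') Ea -ub.
set k0 := a (psi (uact rho y h)) g.
have kB : k0 \in B by apply: (HB g) => //; rewrite inE.
rewrite (bigD1_seq k0) ?fset_uniq //= big1 ?addr0 => [|k /eqP kk].
  by rewrite /w; case: asboolP => [_|[]//]; rewrite mul1r.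
by rewrite /w; case: asboolP => [[_ E]|_]; [case: kk|rewrite mul0r].
Qed.

End CrossedUnitary.

Section CrossedTransport.
Variables (R : realType) (G H : groupType) (X Y : topologicalType).
Variables (theta : ore_action G X) (rho : ore_action H Y).
Hypotheses (cX : compact [set: X]) (hX : hausdorff_space X) (oth : open_images theta).
Hypotheses (cY : compact [set: Y]) (hY : hausdorff_space Y) (orh : open_images rho).

Lemma crs_push_unitary phi psi a b :
  cocycle_half theta rho phi psi a b -> cocycle_half rho theta psi phi b a ->
  unitary (@crs_push R G H X Y theta rho psi b) (@crs_push R H G Y X rho theta phi a) psi.
Proof.
move=> h1 h2; split.
- move=> xi; exact: (crs_pushK cX hX oth cY hY orh h1 h2).
- move=> xi; exact: (crs_pushK cY hY orh cX hX oth h2 h1).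
- move=> xi eta; exact: (crs_push_add cX hX cY hY orh h1 h2).
- move=> c xi; exact: (crs_push_scale cX hX cY hY orh h1 h2).
- move=> xi eta y; exact: (crs_push_ip cX hX cY hY orh h1 h2).
- by move=> x; exists (phi x); exact: (ch_can h1).
Qed.

Lemma crossed_diag_transport phi psi a b (T : pcp_module R theta -> pcp_module R theta) :
  cocycle_half theta rho phi psi a b -> cocycle_half rho theta psi phi b a ->
  crossed_diag R theta T -> crossed_diag R rho
    (conj_op (@crs_push R G H X Y theta rho psi b) (@crs_push R H G Y X rho theta phi a) T).
Proof.
move=> h1 h2; rewrite crossed_diagE // crossed_diagE // => -[f cf <-].
rewrite (conj_crs_D cX hX oth cY hY orh h1 h2 cf); exists (f \o psi) => //.
by move=> y; apply: continuous_comp; [exact: (ch_cont h2)|exact: cf].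
Qed.

Lemma crossed_product_transport phi psi a b (T : pcp_module R theta -> pcp_module R theta) :
  cocycle_half theta rho phi psi a b -> cocycle_half rho theta psi phi b a ->
  crossed_product R theta T -> crossed_product R rho
    (conj_op (@crs_push R G H X Y theta rho psi b) (@crs_push R H G Y X rho theta phi a) T).
Proof.
move=> h1 h2; apply: (cstar_gen_transport (crs_push_unitary h1 h2)).
- move=> S [DS|[g /(v_opP cX hX oth) ->]].
    have := crossed_diagE R cX hX oth; move: DS => /[swap] -> [f cf <-].
    by exists (crs_D (fun x => (f x)^*)); exact: crs_D_adjoint.
  by exists (crs_N g^-1%g); exact: crs_N_adjoint.
- exact: crossed_subalgebra.
- move=> S [DS|[g /(v_opP cX hX oth) ->]]; last first.
    exact: (conj_crs_N cX hX oth cY hY orh h1 h2).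
  have := crossed_diag_transport h1 h2 DS.
  rewrite crossed_diagE // => -[f cf <-]; exact: crossed_D.
Qed.

End CrossedTransport.

Lemma cocycle_equivalent_crossed (R : realType) (G H : groupType) (X Y : topologicalType)
    (theta : ore_action G X) (rho : ore_action H Y) :
  compact [set: X] -> hausdorff_space X -> open_images theta ->
  compact [set: Y] -> hausdorff_space Y -> open_images rho ->
  cocycle_equivalent theta rho -> exists Psi,
    cstar_isomorphism (crossed_product R theta) (crossed_product R rho) Psi /\
    Psi @` crossed_diag R theta = crossed_diag R rho.
Proof.
move=> cX hX oth cY hY orh [phi [psi [a [b [h1 h2]]]]].
apply: (conj_op_isomorphism (crs_push_unitary R cX hX oth cY hY orh h1 h2)) => T HT.
- exact: (crossed_product_transport cX hX oth cY hY orh h1 h2).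
- exact: (crossed_product_transport cY hY orh cX hX oth h2 h1).
- exact: (crossed_diag_transport cX hX oth cY hY orh h1 h2).
- exact: (crossed_diag_transport cY hY orh cX hX oth h2 h1).
Qed.

(** * The equivalences *)

Theorem theorem3p6 (R : realType) (G H : groupType) (X Y : topologicalType)
    (theta : ore_action G X) (rho : ore_action H Y)
    (hG : countable [set: G]) (hH : countable [set: H])
    (hX2 : @second_countable X) (hXc : compact [set: X])
    (hXh : hausdorff_space X)
    (hY2 : @second_countable Y) (hYc : compact [set: Y])
    (hYh : hausdorff_space Y)
    (htheta : open_images theta) (hrho : open_images rho) :
  let KX := transformation_groupoid theta in
  let KY := transformation_groupoid rho in
  let i := continuously_orbit_equivalent theta rho in
  let ii := etale_isomorphic KX KY in
  let iii := exists Phi,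
    cstar_isomorphism (reduced_cstar R KX) (reduced_cstar R KY) Phi /\
    Phi @` reduced_diag R KX = reduced_diag R KY in
  let iv := exists Psi,
    cstar_isomorphism (crossed_product R theta) (crossed_product R rho) Psi /\
    Psi @` crossed_diag R theta = crossed_diag R rho in
  (topologically_free theta -> topologically_free rho ->
     [/\ i <-> ii, ii <-> iii & iii <-> iv]) /\
  (ii -> i).
Proof.
move=> KX KY i ii iii iv.
have ii_i : ii -> i.
  by move=> /etale_isomorphic_cocycle; exact: cocycle_orbit_equivalent.
split=> // tft tfr.
have local_ii : local_orbit_equivalent theta rho -> ii.
  move=> loc; apply: cocycle_etale_isomorphic.
  exact: local_orbit_equivalent_cocycle loc.
have i_ii : i -> ii by move=> /(orbit_equivalent_local htheta hrho).
have ii_iii : ii -> iii by exact: etale_isomorphic_reduced.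
have ii_iv : ii -> iv.
  by move=> /etale_isomorphic_cocycle; exact: cocycle_equivalent_crossed.
have iii_ii : iii -> ii.
  move=> HPhi; apply: local_ii.
  exact: (isomorphism_local_orbit_equivalent (reduced_model R hXc hXh htheta)
    (reduced_model R hYc hYh hrho) hXc hXh htheta hYc hYh hrho HPhi).
have iv_ii : iv -> ii.
  move=> HPsi; apply: local_ii.
  exact: (isomorphism_local_orbit_equivalent (crossed_model R hXc hXh htheta)
    (crossed_model R hYc hYh hrho) hXc hXh htheta hYc hYh hrho HPsi).
by split; split=> // [/iii_ii|/iv_ii].
Qed.
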